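(* Let $\nu$ be a self-conformal measure on $\mathbb{R}^d$ satisfying the asymptotically weak separation condition. Then for every $\alpha\in[\tau'_\nu(+\infty),\tau'_\nu(0+)]$, $$E_\nu(\alpha)\neq\emptyset\quad\text{and}\quad\dim_HE_\nu(\alpha)=\tau_\nu^*(\alpha):=\inf\{\alpha q-\tau_\nu(q):\ q\in\mathbb{R}\}.$$
   Context: Multifractal notation. Let $\mu$ be a finite Borel measure on $\mathbb{R}^d$ with compact support, and let $B_r(x)$ denote the closed ball of radius $r$ centered at $x$. For $q\in\mathbb{R}$ the $L^q$ spectrum of $\mu$ is $$\tau_\mu(q)=\liminf_{r\to0}\frac{\log\Theta_\mu(q;r)}{\log r},\qquad \Theta_\mu(q;r)=\sup\sum_i\mu(B_r(x_i))^q,$$ where the supremum is over all families of disjoint balls $\{B_r(x_i)\}_i$ with $x_i\in\mathrm{supp}(\mu)$; $\tau_\mu$ is concave in $q$. We write $\tau'_\mu(+\infty):=\lim_{q\to+\infty}\tau_\mu(q)/q$ and $\tau'_\mu(0+)$ for the right derivative of $\tau_\mu$ at $0$. For $\alpha\in\mathbb{R}$, $$E_\mu(\alpha)=\left\{x\in\mathbb{R}^d:\ \lim_{r\to0}\frac{\log\mu(B_r(x))}{\log r}\text{ exists and equals }\alpha\right\}.$$ $\dim_H$ denotes Hausdorff dimension. Self-conformal measures. Let $U\subset\mathbb{R}^d$ be open. A $C^1$-map $S:U\to\mathbb{R}^d$ is conformal if its differential satisfies $|S'(x)y|=|S'(x)|\cdot|y|\neq0$ for all $x\in U$ and $y\in\mathbb{R}^d\setminus\{0\}$;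 it is contracting if there is $0<c<1$ with $|S(x)-S(y)|\le c|x-y|$ for all $x,y\in U$. A family $\{S_i:X\to X\}_{i=1}^\ell$ is a $C^1$-conformal iterated function system (IFS) on a compact set $X\subset\mathbb{R}^d$ if each $S_i$ extends to an injective contracting $C^1$-conformal map $S_i:U\to U$ on an open set $U\supset X$. Its attractor is the unique non-empty compact $K\subset X$ with $K=\bigcup_{i=1}^\ell S_i(K)$. Given a probability vector $(p_1,\dots,p_\ell)$, the associated self-conformal measure is the unique Borel probability measure $\nu$ with $\nu=\sum_{i=1}^\ell p_i\,\nu\circ S_i^{-1}$. Asymptotically weak separation condition (AWSC). Let $\mathcal{A}=\{1,\dots,\ell\}$, $\mathcal{A}^*=\bigcup_{n\ge1}\mathcal{A}^n$. For $u=u_1\cdots u_k\in\mathcal{A}^*$ write $S_u=S_{u_1}\circ\cdots\circ S_{u_k}$, $K_u=S_u(K)$, and let $\tilde u$ be the word obtained by dropping the last letter of $u$ ($K_{\tilde u}=K$ if $\tilde u$ is empty). For $n\in\mathbb{N}$ let $$W_n=\{u\in\mathcal{A}^*:\ \mathrm{diam}(K_u)\le2^{-n},\ \mathrm{diam}(K_{\tilde u})>2^{-n}\},$$ and $\mathbf{D}_n=\{[0,2^{-n})^d+\mathbf{v}:\ \mathbf{v}\in2^{-n}\mathbb{Z}^d\}$. The IFS satisfies the AWSC if there is a sequence $(t_n)$ of natural numbers with $\lim_{n\to\infty}\frac1n\log t_n=0$ such that for each $n\in\mathbb{N}$ and $\widetilde Q\in\mathbf{D}_n$, $$\#\{S_u:\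 u\in W_n,\ K_u\cap\widetilde Q\neq\emptyset\}\le t_n$$ (the maps $S_u$ are counted without multiplicity). A self-conformal measure satisfies the AWSC if the IFS defining it does. *)

(* Defs.v *)
From HB Require Import structures.
From mathcomp Require Import all_boot all_order all_algebra.
From mathcomp Require Import all_classical all_reals all_analysis.

Set Implicit Arguments.
Unset Strict Implicit.
Unset Printing Implicit Defensive.

Import Order.TTheory GRing.Theory Num.Theory.
Import numFieldNormedType.Exports.

Local Open Scope classical_set_scope.
Local Open Scope card_scope.
Local Open Scope ring_scope.

(** Euclidean geometry of ['rV[R]_d]. The norm [`|x|] that the library puts on
    row vectors is the sup norm: it induces the Euclidean topology (so [open],
    [compact] and ['d] are the usual notions), but not the Euclidean metric. *)

Definition enorm {R : realType} {d : nat} (x : 'rV[R]_d) : R :=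
  Num.sqrt (\sum_(i < d) x ord0 i ^+ 2).

Definition cball {R : realType} {d : nat} (x : 'rV[R]_d) (r : R)
    : set 'rV[R]_d :=
  [set y | enorm (y - x) <= r].

(** The set is extended by [0] so that the empty set has diameter [0]. *)
Definition diam {R : realType} {d : nat} (A : set 'rV[R]_d) : \bar R :=
  ereal_sup (0%E |` [set (enorm (xy.1 - xy.2))%:E | xy in A `*` A]).

(** Only used with [s > 0], so that the empty members of a cover contribute
    [0]. *)
Definition hausdorff_content {R : realType} {d : nat} (s delta : R)
    (A : set 'rV[R]_d) : \bar R :=
  ereal_inf [set (\sum_(0 <= k <oo) diam (F k) `^ s)%E |
    F in [set F : nat -> set 'rV[R]_d |
      A `<=` \bigcup_k F k /\ (forall k, (diam (F k) <= delta%:E)%E)]].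

Definition hausdorff_measure {R : realType} {d : nat} (s : R)
    (A : set 'rV[R]_d) : \bar R :=
  ereal_sup [set hausdorff_content s delta A | delta in [set e : R | 0 < e]].

Definition dimH {R : realType} {d : nat} (A : set 'rV[R]_d) : \bar R :=
  ereal_inf [set s%:E | s in [set s : R | 0 < s /\ hausdorff_measure s A = 0%E]].

Notation borelRV R d := (g_sigma_algebraType (@open ('rV[R]_d))).

Definition msupport {R : realType} {d : nat}
    (mu : {measure set (borelRV R d) -> \bar R}) : set 'rV[R]_d :=
  [set x | forall V : set 'rV[R]_d, open V -> V x -> (0 < mu V)%E].

(** For [r > 0] disjoint closed balls of radius [r] have distinct centres, so
    that a disjoint family of such balls is given by its set [D] of centres. *)
Definition Lq_sum {R : realType} {d : nat}
    (mu : {measure set (borelRV R d) -> \bar R}) (q r : R) : \bar R :=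
  ereal_sup [set (\esum_(x in D) mu (cball x r) `^ q)%E |
    D in [set D : set 'rV[R]_d |
      D `<=` msupport mu /\ trivIset D (fun x => cball x r)]].

(** [lne] is the logarithm with [lne 0 = -oo] and [lne +oo = +oo]. *)
Definition Lq_spectrum {R : realType} {d : nat}
    (mu : {measure set (borelRV R d) -> \bar R}) (q : R) : \bar R :=
  limf_einf (fun r : R => lne (Lq_sum mu q r) / (ln r)%:E)%E 0^'+.

Definition Lq_slope_pinfty {R : realType} {d : nat}
    (mu : {measure set (borelRV R d) -> \bar R}) : \bar R :=
  lim ((Lq_spectrum mu q / q%:E)%E @[q --> (+oo : set_system R)]).

Definition Lq_right_deriv0 {R : realType} {d : nat}
    (mu : {measure set (borelRV R d) -> \bar R}) : \bar R :=
  lim (((Lq_spectrum mu h - Lq_spectrum mu 0) / h%:E)%E @[h --> (0 : R)^'+]).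

Definition Lq_legendre {R : realType} {d : nat}
    (mu : {measure set (borelRV R d) -> \bar R}) (alpha : R) : \bar R :=
  ereal_inf (range (fun q : R => ((alpha * q)%:E - Lq_spectrum mu q)%E)).

Definition level_set {R : realType} {d : nat}
    (mu : {measure set (borelRV R d) -> \bar R}) (alpha : R) : set 'rV[R]_d :=
  [set x | (lne (mu (cball x r)) / (ln r)%:E)%E @[r --> (0 : R)^'+]
             --> alpha%:E].

Definition opnorm {R : realType} {d : nat} (L : 'rV[R]_d -> 'rV[R]_d) : R :=
  sup [set enorm (L y) | y in [set y | enorm y <= 1]].

Definition C1_conformal {R : realType} {d : nat} (U : set 'rV[R]_d)
    (f : 'rV[R]_d -> 'rV[R]_d) : Prop :=
  [/\ forall x, U x -> differentiable f x,
      forall x, U x -> {for x, continuous (jacobian f)} &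
      forall x y, U x -> y != 0 ->
        enorm ('d f x y) = opnorm ('d f x) * enorm y /\ enorm ('d f x y) != 0].

Definition contracting {R : realType} {d : nat} (U : set 'rV[R]_d)
    (f : 'rV[R]_d -> 'rV[R]_d) : Prop :=
  exists2 c : R, 0 < c < 1 &
    forall x y, U x -> U y -> enorm (f x - f y) <= c * enorm (x - y).

(** The values of [S i] outside [X] are irrelevant: [S i] stands for a map
    [X -> X], and [f i] for its extension [U -> U]. *)
Definition C1_conformal_IFS {R : realType} {d l : nat} (X : set 'rV[R]_d)
    (S : 'I_l -> 'rV[R]_d -> 'rV[R]_d) : Prop :=
  [/\ compact X, forall i, set_fun X X (S i) &
      exists (U : set 'rV[R]_d) (f : 'I_l -> 'rV[R]_d -> 'rV[R]_d),
        [/\ open U, X `<=` U &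
            forall i, [/\ forall x, X x -> f i x = S i x, set_fun U U (f i),
                          set_inj U (f i), contracting U (f i) &
                          C1_conformal U (f i)]]].

Definition is_attractor {R : realType} {d l : nat} (X : set 'rV[R]_d)
    (S : 'I_l -> 'rV[R]_d -> 'rV[R]_d) (K : set 'rV[R]_d) : Prop :=
  [/\ K !=set0, compact K, K `<=` X & K = \bigcup_(i in setT) (S i @` K)].

Definition probability_vector {R : realType} {l : nat} (p : 'I_l -> R) : Prop :=
  (forall i, 0 <= p i) /\ \sum_(i < l) p i = 1.

(** Since [S i] is a map [X -> X], the preimage of [A] is taken in [X]; for
    [A = setT] the equation says that [nu] is carried by [X]. *)
Definition self_conformal_measure {R : realType} {d l : nat} (X : set 'rV[R]_d)
    (S : 'I_l -> 'rV[R]_d -> 'rV[R]_d) (p : 'I_l -> R)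
    (nu : probability (borelRV R d) R) : Prop :=
  forall A : set (borelRV R d), measurable A ->
    nu A = (\sum_(i < l) (p i)%:E * nu (X `&` S i @^-1` A))%E.

Definition word_map {R : realType} {d l : nat}
    (S : 'I_l -> 'rV[R]_d -> 'rV[R]_d) (u : seq 'I_l) : 'rV[R]_d -> 'rV[R]_d :=
  foldr (fun i f => S i \o f) id u.

Definition drop_last {T : Type} (u : seq T) : seq T := take (size u).-1 u.

Definition scale_words {R : realType} {d l : nat}
    (S : 'I_l -> 'rV[R]_d -> 'rV[R]_d) (K : set 'rV[R]_d) (n : nat)
    : set (seq 'I_l) :=
  [set u | [/\ u != [::], (diam (word_map S u @` K) <= (2 ^- n)%:E)%E &
               ((2 ^- n)%:E < diam (word_map S (drop_last u) @` K))%E]].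

Definition dyadic_cubes {R : realType} {d : nat} (n : nat) : set (set 'rV[R]_d) :=
  [set [set x : 'rV[R]_d | forall i,
          (v ord0 i)%:~R * 2 ^- n <= x ord0 i < (v ord0 i)%:~R * 2 ^- n + 2 ^- n]
  | v in [set: 'rV[int]_d]].

(** Restricting [word_map S u] to [X] makes two words count once exactly when
    they define the same map [X -> X]. *)
Definition AWSC {R : realType} {d l : nat} (X : set 'rV[R]_d)
    (S : 'I_l -> 'rV[R]_d -> 'rV[R]_d) (K : set 'rV[R]_d) : Prop :=
  exists t : nat -> nat,
    [/\ forall n, (0 < t n)%N,
        (ln (t n)%:R / n%:R : R) @[n --> \oo] --> (0 : R) &
        forall (n : nat) (Q : set 'rV[R]_d), dyadic_cubes n Q ->
          [set word_map S u \_ X | u in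
             scale_words S K n `&`
             [set u | (word_map S u @` K) `&` Q !=set0]] #<= `I_(t n)].

(* Main.v *)
Require Import Defs.
From HB Require Import structures.
From mathcomp Require Import all_boot all_order all_algebra.
From mathcomp Require Import all_classical all_reals all_analysis.
From mathcomp Require Import ring lra zify.

Set Implicit Arguments.
Unset Strict Implicit.
Unset Printing Implicit Defensive.

Import Order.TTheory GRing.Theory Num.Theory.
Import numFieldNormedType.Exports.

Local Open Scope classical_set_scope.
Local Open Scope ring_scope.

(** Fix [alpha] and let [s] be the largest number such that at arbitrarily fine scales [exp (- L)] there
    are about [exp (L s)] separated cylinders of mass at least about [exp (- L alpha)]. Concatenating
    words shows that these systems exist at every fine scale and that the set of the pairs
    [(alpha, s)] is convex and closed; its Legendre transform is the spectrum on [q >= 0], so that a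
    supergradient at [alpha] bounds the infimum by [s], provided that [alpha] lies to the left of the
    derivative at [0].

    For the lower bound, one stage of a Moran construction places such a system inside a given
    cylinder. As [s] cannot be attained at a level below [alpha], the asymptotically weak separation
    condition allows only few of the new cylinders to have neighbourhoods of mass much larger than
    [exp (- L alpha)]; the others are kept. Stages whose length is a vanishing fraction of the current
    scale give a Cantor set inside the level set, and a map from [[0, 1[] to it with a Holder inverse of
    every exponent less than [s].

    For the upper bound, a maximal packing of the points at which the local dimension is uniformly
    close to [alpha] has at most about [exp (r (alpha q - tau q))] balls of radius [exp (- r)]. *)

(** Two difficulties shape the proof. First, cylinders overlap. A single word bounds the mass of a
    ball from below, through its cylinder, but an upper bound must see every map that acts near the
    ball. The separation condition leaves only [exp (o(r))] such maps at scale [exp (- r)]. So one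
    of them carries the mass of the ball up to that factor, and many overweight balls inside a
    cylinder pull back through one map to a packing at the relative scale [exp (- L)]. That packing
    is impossible because the best exponent drops strictly to the left of [alpha]: were [s] attained
    at [alpha - dl], concavity would make it the maximum over all levels, which is [- tau(0)], and
    the right derivative at 0 would be at most [alpha - dl]. Second, a C^1 system distorts by
    [exp (e b)] at scale [exp (- b)], not by a constant. A stage of bounded length would drown in
    this error, so a stage has length [eta b] with [e] much smaller than [eta], and [eta] still
    tends to 0. The pairs [(a, s)] record lower bounds of masses only, hence they see only [q >= 0];
    the upper bound of the dimension treats every real [q] directly. *)

Lemma pigeonhole_class (I V : finType) (f : I -> V) :
  exists2 A : {set I}, (#|I| <= #|V| * #|A|)%N &
    {in A &, forall i j, f i = f j}.
Proof.
have [h|h] := pselect (exists v, (#|I| <= #|V| * #|[set i | f i == v]%SET|)%N).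
  case: h => v hv; exists [set i | f i == v]%SET => //.
  by move=> i j; rewrite !inE => /eqP -> /eqP ->.
exists finset.set0; last by move=> i j; rewrite inE.
case: (posnP #|I|) => [->//|/card_gt0P[i0 _]]; exfalso.
have hlt v : (#|V| * #|[set i | f i == v]%SET| < #|I|)%N.
  by rewrite ltnNge; apply/negP => hv; apply: h; exists v.
have e : (\sum_(v : V) #|[set i | f i == v]%SET| = #|I|)%N.
  rewrite -sum1_card (partition_big f xpredT) //=.
  by apply: eq_bigr => v _; rewrite -sum1_card; apply: eq_bigl => i; rewrite !inE.
have V0 : (0 < #|V|)%N by apply/card_gt0P; exists (f i0).
have : (\sum_(v : V) #|V| * #|[set i | f i == v]%SET| < \sum_(v : V) #|I|)%N.
  rewrite (bigD1 (f i0)) //= [ltnRHS](bigD1 (f i0)) //=.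
  by rewrite -addSn leq_add //; apply: leq_sum => v _; apply: ltnW.
by rewrite -big_distrr /= e sum_nat_const ltnn.
Qed.

(** * The Euclidean norm, its balls and diameters *)

Section Euclid.
Context {R : realType} {d : nat}.
Implicit Types x y z : 'rV[R]_d.

Lemma enorm_ge0 x : 0 <= enorm x.
Proof. exact: sqrtr_ge0. Qed.

Lemma enorm_sq x : enorm x ^+ 2 = \sum_(i < d) x ord0 i ^+ 2.
Proof. by rewrite sqr_sqrtr // sumr_ge0 // => i _; rewrite sqr_ge0. Qed.

Lemma enorm_eq0 x : enorm x = 0 -> x = 0.
Proof.
move=> h; have := enorm_sq x; rewrite h expr0n /= => /esym /eqP.
rewrite psumr_eq0; last by move=> i _; rewrite sqr_ge0.
move=> /allP hx; apply/rowP => i; rewrite mxE.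
by have := hx i (mem_index_enum _); rewrite sqrf_eq0 => /eqP.
Qed.

Lemma enorm0 : enorm (0 : 'rV[R]_d) = 0.
Proof.
by rewrite /enorm big1 ?sqrtr0 // => i _; rewrite mxE expr0n.
Qed.

Lemma enormZ (a : R) x : enorm (a *: x) = `|a| * enorm x.
Proof.
rewrite /enorm -sqrtr_sqr -sqrtrM ?sqr_ge0 // mulr_sumr.
by congr Num.sqrt; apply: eq_bigr => i _; rewrite !mxE exprMn.
Qed.

Lemma enormN x : enorm (- x) = enorm x.
Proof. by rewrite -scaleN1r enormZ normrN1 mul1r. Qed.

Lemma enormB x y : enorm (x - y) = enorm (y - x).
Proof. by rewrite -enormN opprB. Qed.

(** Cauchy-Schwarz, by expanding the squared norm of [|y| x - |x| y]. *)
Lemma inner_le_enorm x y : \sum_(i < d) x ord0 i * y ord0 i <= enorm x * enorm y.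
Proof.
have [/enorm_eq0 ->|x0] := eqVneq (enorm x) 0.
  by rewrite enorm0 mul0r big1 // => i _; rewrite mxE mul0r.
have [/enorm_eq0 ->|y0] := eqVneq (enorm y) 0.
  by rewrite enorm0 mulr0 big1 // => i _; rewrite mxE mulr0.
have a0 : 0 < enorm x by rewrite lt_def x0 enorm_ge0.
have b0 : 0 < enorm y by rewrite lt_def y0 enorm_ge0.
set s := \sum_(i < d) _.
have : 0 <= \sum_(i < d) (enorm y * x ord0 i - enorm x * y ord0 i) ^+ 2.
  by apply: sumr_ge0 => i _; rewrite sqr_ge0.
have -> : \sum_(i < d) (enorm y * x ord0 i - enorm x * y ord0 i) ^+ 2 =
    enorm y ^+ 2 * enorm x ^+ 2 + enorm x ^+ 2 * enorm y ^+ 2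
    - 2 * enorm x * enorm y * s.
  rewrite [X in _ = _ * X + _ - _]enorm_sq [X in _ = _ + _ * X - _]enorm_sq.
  rewrite /s !mulr_sumr -big_split -sumrB /=.
  by apply: eq_bigr => i _; ring.
have ab : 0 < 2 * enorm x * enorm y by rewrite !mulr_gt0.
move=> h; rewrite -(ler_pM2l ab) -subr_ge0; apply: le_trans h _.
by rewrite le_eqVlt; apply/orP; left; apply/eqP; ring.
Qed.

Lemma enormD x y : enorm (x + y) <= enorm x + enorm y.
Proof.
rewrite -(@ler_pXn2r _ 2) ?nnegrE ?addr_ge0 ?enorm_ge0 // enorm_sq.
under eq_bigr do rewrite mxE sqrrD.
rewrite !big_split /= -!enorm_sq sqrrD lerD2r lerD2l.
by rewrite mulr2n lerD // inner_le_enorm.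
Qed.

Lemma enorm_triangle z x y : enorm (x - y) <= enorm (x - z) + enorm (z - y).
Proof. by rewrite -[x - y](subrKA z) enormD. Qed.

Lemma coord_le_enorm x i : `|x ord0 i| <= enorm x.
Proof.
rewrite -sqrtr_sqr ler_wsqrtr // (bigD1 i) //= lerDl.
by apply: sumr_ge0 => j _; rewrite sqr_ge0.
Qed.

Lemma enorm_le_coord x (c : R) : 0 <= c ->
  (forall i, `|x ord0 i| <= c) -> enorm x <= d%:R * c.
Proof.
move=> c0 h; rewrite -(@ler_pXn2r _ 2) ?nnegrE ?mulr_ge0 ?enorm_ge0 // enorm_sq.
apply: (@le_trans _ _ (\sum_(i < d) c ^+ 2)).
  by apply: ler_sum => i _; rewrite -real_normK ?num_real // ler_pXn2r ?nnegrE.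
rewrite sumr_const card_ord -(mulr_natl (c ^+ 2)) exprMn.
apply: ler_wpM2r; first exact: sqr_ge0.
by rewrite -natrX ler_nat; case: (d) => // n; rewrite -mulnn leq_pmull.
Qed.

Lemma norm_le_enorm x : `|x| <= enorm x.
Proof.
rewrite /Num.norm /= mx_normrE; apply: bigmax_le => [|[i j] _].
  exact: enorm_ge0.
by rewrite /= (ord1 i) coord_le_enorm.
Qed.

Lemma coord_le_norm x i : `|x ord0 i| <= `|x|.
Proof.
rewrite [leRHS]/Num.norm /= mx_normrE.
exact: (@le_bigmax _ _ _ 0 (fun ij : 'I_1 * 'I_d => `|x ij.1 ij.2|) (ord0, i)).
Qed.

Lemma enorm_le_norm x : enorm x <= d%:R * `|x|.
Proof. by apply: enorm_le_coord => // i; apply: coord_le_norm. Qed.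

Lemma enorm_lip x y : `|enorm x - enorm y| <= enorm (x - y).
Proof.
rewrite ler_norml; apply/andP; split.
  by have := enormD (y - x) x; rewrite subrK enormB; lra.
by have := enormD (x - y) y; rewrite subrK; lra.
Qed.

Lemma enorm_sub_continuous x : continuous (fun y => enorm (y - x)).
Proof.
move=> z; apply/(@cvgrPdist_le _ _ _ (nbhs z)) => e e0; near=> y.
apply: le_trans (enorm_lip _ _) _.
rewrite opprB addrA subrK; apply: le_trans (enorm_le_norm _) _.
(* The factor [d.+1] instead of [d] can be divided by in dimension 0 as well. *)
apply: (@le_trans _ _ (d.+1%:R * `|z - y|)); first by rewrite ler_wpM2r ?ler_nat.
rewrite -ler_pdivlMl ?ltr0n //; near: y.
by apply: (cvgr_dist_le id); [exact: cvg_id|rewrite mulr_gt0 // invr_gt0 ltr0n].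
Unshelve. all: by end_near. Qed.

Lemma nbhs_cball x (e : R) : 0 < e -> nbhs x (cball x e).
Proof.
move=> e0; have := @enorm_sub_continuous x x.
move=> /(@cvgrPdist_le _ _ _ (nbhs x)) /(_ e e0); apply: filterS => y.
by rewrite subrr enorm0 sub0r normrN ger0_norm ?enorm_ge0.
Qed.

Lemma cball_closed x r : closed (cball x r).
Proof.
have -> : cball x r = (fun y => enorm (y - x)) @^-1` [set t | t <= r] by [].
by apply: preimage_closed; [move=> y _; exact: enorm_sub_continuous|exact: closed_le].
Qed.

Lemma cballS x y (r s : R) : enorm (x - y) + r <= s -> cball x r `<=` cball y s.
Proof.
move=> h z hz; apply: le_trans h.
by apply: le_trans (enorm_triangle x _ _) _; rewrite addrC lerD2l.
Qed.

Lemma diam_leP (A : set 'rV[R]_d) (c : R) :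
  (diam A <= c%:E)%E <-> 0 <= c /\ forall x y, A x -> A y -> enorm (x - y) <= c.
Proof.
split=> [h|[c0 h]].
  split; first by rewrite -lee_fin; apply: le_trans h; apply: ereal_sup_ubound; left.
  move=> x y Ax Ay; rewrite -lee_fin; apply: le_trans h.
  by apply: ereal_sup_ubound; right; exists (x, y).
apply: ge_ereal_sup => _ [->|[[x y] /= [Ax Ay] <-]]; first by rewrite lee_fin.
by rewrite lee_fin h.
Qed.

Lemma diam_ge0 (A : set 'rV[R]_d) : (0 <= diam A)%E.
Proof. by apply: ereal_sup_ubound; left. Qed.

End Euclid.

(** * Thinning out separated sets *)

Section Packing.
Context {R : realType} {d : nat}.

(* Colour the cells of a grid of mesh proportional to [r] by their coordinates modulo a large number:
   a cell contains at most one point, and cells of the same colour are far apart. *)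
Lemma separated_subset (k : R) : 0 < k -> exists2 M : nat, (0 < M)%N &
  forall (r : R) (I : finType) (x : I -> 'rV[R]_d), 0 < r ->
    (forall i j, i != j -> r <= enorm (x i - x j)) ->
    exists2 A : {set I}, (#|I| <= M * #|A|)%N &
      forall i j, i \in A -> j \in A -> i != j -> k * r < enorm (x i - x j).
Proof.
move=> k0.
(* A cell of mesh [c * r] has Euclidean diameter at most [d * c * r < r], so it holds at most one of
   the points. *)
pose c : R := (d.+1)%:R^-1.
have c0 : 0 < c by rewrite invr_gt0.
(* Distinct cells of the same colour differ by at least [m.+1] in some coordinate, so their points
   are more than [m * c * r > k * r] apart. *)
have [m hm] : exists m : nat, k / c < m%:R.
  by exists (Num.bound (k / c)); rewrite archi_boundP // divr_ge0 ?ltW.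
exists (#|{: {ffun 'I_d -> 'I_m.+1}}|).
  by apply/card_gt0P; exists [ffun=> ord0].
move=> r I x r0 sep.
have cr : 0 < c * r by rewrite mulr_gt0.
pose fl i j : int := Num.Def.floor (x i ord0 j / (c * r)).
have fb i t : (fl i t)%:~R * (c * r) <= x i ord0 t < (fl i t)%:~R * (c * r) + c * r.
  have := floor_itv (x i ord0 t / (c * r)).
  by rewrite ler_pdivlMr // ltr_pdivrMr // intrD mulrDl mul1r.
pose cl i : {ffun 'I_d -> 'I_m.+1} :=
  [ffun j => inord (absz (modz (fl i j) m.+1))].
have [A hA cA] := pigeonhole_class cl; exists A => // i j iA jA ij.
have [/forallP same|] := boolP [forall t, fl i t == fl j t].
  exfalso; have := sep _ _ ij; apply/negP; rewrite -ltNge.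
  apply: (@le_lt_trans _ _ (d%:R * (c * r))).
    apply: enorm_le_coord => [|t]; first exact: ltW.
    rewrite !mxE ler_norml; have := fb i t; have := fb j t.
    by rewrite (eqP (same t)) => /andP[? ?] /andP[? ?]; apply/andP; split; lra.
  by rewrite mulrA -[ltRHS]mul1r ltr_pM2r // /c ltr_pdivrMr ?ltr0n // mul1r ltr_nat.
rewrite negb_forall => /existsP[t ht].
have /ffunP/(_ t)/(congr1 val) := cA _ _ iA jA.
rewrite !ffunE /= !inordK; last 2 first.
- by have := ltz_pmod (fl j t) (isT : 0 < m.+1%:Z); have := modz_ge0 (fl j t) (isT : m.+1%:Z != 0); lia.
- by have := ltz_pmod (fl i t) (isT : 0 < m.+1%:Z); have := modz_ge0 (fl i t) (isT : m.+1%:Z != 0); lia.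
move=> e; have {}e : (fl i t = fl j t %[mod m.+1])%Z.
  by have := modz_ge0 (fl j t) (isT : m.+1%:Z != 0); have := modz_ge0 (fl i t) (isT : m.+1%:Z != 0); lia.
have {}e : (m.+1 %| fl i t - fl j t)%Z by rewrite -eqz_mod_dvd; apply/eqP.
have hd : (m.+1%:Z <= `|fl i t - fl j t|).
  have n0 : fl i t - fl j t != 0 by rewrite subr_eq0.
  case/dvdzP: e n0 => z ->; rewrite mulf_eq0 negb_or => /andP[z0 _].
  by rewrite normrM ler_peMl // ?normr_ge0 //; lia.
apply: (@lt_le_trans _ _ (m%:R * (c * r))).
  by rewrite mulrA ltr_pM2r // -ltr_pdivrMr.
apply: (@le_trans _ _ `|(x i - x j) ord0 t|); last exact: coord_le_enorm.
have : (m.+1%:R : R) <= `|(fl i t)%:~R - (fl j t)%:~R|.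
  by rewrite -intrB -intr_norm pmulrn ler_int.
have /andP[i1 i2] := fb i t; have /andP[j1 j2] := fb j t.
rewrite !mxE ler_normr => /orP[] h.
  have := ler_wpM2r (ltW cr) h; rewrite -natr1 !mulrDl mul1r mulNr => h'.
  by apply: le_trans (ler_norm _); lra.
have := ler_wpM2r (ltW cr) h; rewrite opprB -natr1 !mulrDl mul1r mulNr => h'.
by rewrite -normrN; apply: le_trans (ler_norm _); lra.
Qed.

End Packing.

(** * Conformal maps are almost similarities on small balls *)

Section LocalSimilarity.
Context {R : realType} {d : nat} (U : set 'rV[R]_d) (f : 'rV[R]_d -> 'rV[R]_d).
Hypotheses (oU : open U) (fU : C1_conformal U f).

Lemma nbhs_cballP (x : 'rV[R]_d) (P : set 'rV[R]_d) :
  nbhs x P -> exists2 r : R, 0 < r & cball x r `<=` P.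
Proof.
move=> /nbhs_normP[r /= r0 hr]; exists (r / 2); first by rewrite divr_gt0.
move=> y hy; apply: hr => /=; rewrite distrC.
apply: le_lt_trans (norm_le_enorm _) _; apply: le_lt_trans hy _.
by rewrite ltr_pdivrMr // ltr_pMr // ltr1n.
Qed.

Lemma differential_similarity x : U x ->
  exists2 c : R, 0 < c & forall v, enorm ('d f x v) = c * enorm v.
Proof.
move=> Ux; have [_ _ cf] := fU.
have [[v v0]|h] := pselect (exists v : 'rV[R]_d, v != 0).
  exists (opnorm ('d f x)).
    have [e ne] := cf x v Ux v0.
    have v1 : 0 < enorm v.
      by rewrite lt_def enorm_ge0 andbT; apply: contraNN v0 => /eqP/enorm_eq0 ->.
    have : 0 < enorm ('d f x v) by rewrite lt_def ne enorm_ge0.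
    by rewrite e pmulr_lgt0.
  move=> w; have [->|w0] := eqVneq w 0; first by rewrite linear0 enorm0 mulr0.
  by have [] := cf x w Ux w0.
(* In dimension 0 the operator norm vanishes, so it cannot serve as the ratio; any positive number
   does. *)
have z v : v = 0 :> 'rV[R]_d by apply: contrapT => /eqP v0; apply: h; exists v.
by exists 1 => // v; rewrite (z v) linear0 enorm0 mulr0.
Qed.

Lemma mulmx_coord_le (v : 'rV[R]_d) (J : 'M[R]_d) (c : R) j :
  `|J| <= c -> `|(v *m J) ord0 j| <= d%:R * enorm v * c.
Proof.
move=> hJ; rewrite mxE; apply: le_trans (ler_norm_sum _ _ _) _.
apply: (@le_trans _ _ (\sum_(i < d) enorm v * c)); last first.
  by rewrite sumr_const card_ord -[leLHS]mulr_natl mulrA.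
apply: ler_sum => i _; rewrite normrM ler_pM ?coord_le_enorm //.
apply: le_trans hJ; rewrite [leRHS]/Num.norm /= mx_normrE.
exact: (@le_bigmax _ _ _ 0 (fun ij : 'I_d * 'I_d => `|J ij.1 ij.2|) (i, j)).
Qed.

Lemma is_derive_line (w v : 'rV[R]_d) (t : R) j : U (w + t *: v) ->
  is_derive t 1 (fun s : R => f (w + s *: v) ord0 j) (('d f (w + t *: v) v) ord0 j).
Proof.
move=> Uw; have [df _ _] := fU; have {}df := df _ Uw.
have lim : ((fun h : R => (h^-1 *: (f (h *: v + (w + t *: v)) - f (w + t *: v)))) h) @[h --> 0^'] --> 'd f (w + t *: v) v.
  by rewrite -deriveE //; exact: diff_derivable.
have lim' : (h^-1 *: (f (w + (h *: 1 + t) *: v) ord0 j - f (w + t *: v) ord0 j) : R) @[h --> 0^'] --> ('d f (w + t *: v) v) ord0 j.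
  have := cvg_comp _ _ lim (@coord_continuous R 1 d ord0 j ('d f (w + t *: v) v)).
  apply: cvg_trans; apply: near_eq_cvg; near=> h.
  by rewrite /= !mxE scalerDl addrCA [h *: 1]mulr1 /GRing.scale /=.
split; first by apply/cvg_ex; eexists; exact: lim'.
exact: cvg_lim lim'.
Unshelve. all: by end_near. Qed.

Lemma differential_jacobian w (v : 'rV[R]_d) : 'd f w v = v *m jacobian f w.
Proof. by rewrite /jacobian mul_rV_lin1. Qed.

Lemma differential_sub_le w1 w2 (v : 'rV[R]_d) (c : R) j :
  `|jacobian f w1 - jacobian f w2| <= c ->
  `|('d f w1 v) ord0 j - ('d f w2 v) ord0 j| <= d%:R * enorm v * c.
Proof.
move=> h.
have sub (J1 J2 : 'M[R]_d) : (v *m J1) ord0 j - (v *m J2) ord0 j = (v *m (J1 - J2)) ord0 j.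
  by rewrite !mxE -sumrB; apply: eq_bigr => i _; rewrite !mxE mulrBr.
pose co w := congr1 (fun u : 'rV[R]_d => u ord0 j) (differential_jacobian w v).
have e := etrans (f_equal2 (fun a b : R => a - b) (co w1) (co w2)) (sub _ _).
exact: (eq_ind_r (fun t => `|t| <= _) (mulmx_coord_le v j h) e).
Qed.

(** Mean value theorem for each coordinate of [f - 'd f x] along the segment from [z] to [y]; the
    continuity of the Jacobian at [x] makes the derivative small. Both points vary, so this is
    strict differentiability and needs the C^1 assumption. *)
Lemma difference_approx x (e : R) : U x -> 0 < e -> exists2 r : R, 0 < r &
  forall y z, cball x r y -> cball x r z ->
    enorm (f y - f z - 'd f x (y - z)) <= e * enorm (y - z).
Proof.
move=> Ux e0; have [df cJ _] := fU.
(* One dimension factor is lost in bounding a coordinate of [v *m J] by the entries of [J], the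
   other in passing from coordinates to the Euclidean norm. *)
pose e1 := e / (d.+1%:R * d.+1%:R).
have e10 : 0 < e1 by rewrite divr_gt0 // mulr_gt0.
have hJ : \forall y \near x, `|jacobian f x - jacobian f y| <= e1.
  by have := cJ x Ux; move=> /(@cvgrPdist_le _ _ _ (nbhs x)) /(_ e1 e10).
have hU : \forall y \near x, U y by exact: open_nbhs_nbhs.
have [r r0 hr] := nbhs_cballP (filterI hJ hU).
exists r => // y z yx zx.
have seg (t : R) : 0 <= t <= 1 -> cball x r (z + t *: (y - z)).
  move=> /andP[t0 t1]; rewrite /cball /=.
  have -> : z + t *: (y - z) - x = (1 - t) *: (z - x) + t *: (y - x).
    by apply/rowP => i; rewrite !mxE; ring.
  apply: le_trans (enormD _ _) _; rewrite !enormZ !ger0_norm ?subr_ge0 //.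
  have := ler_wpM2l t0 yx; have : (1 - t) * enorm (z - x) <= (1 - t) * r.
    by apply: ler_wpM2l zx; rewrite subr_ge0.
  by lra.
have bound j : `|(f y - f z - 'd f x (y - z)) ord0 j| <= d%:R * enorm (y - z) * e1.
  pose g t := f (z + t *: (y - z)) ord0 j - t * ('d f x (y - z)) ord0 j.
  pose dg t := ('d f (z + t *: (y - z)) (y - z)) ord0 j - ('d f x (y - z)) ord0 j.
  have gd (t : R) : 0 <= t <= 1 -> is_derive t 1 g (dg t).
    move=> /seg/hr[_ Ut].
    have D1 := is_derive_line j Ut.
    have D2 : is_derive t (1 : R) (fun s : R => s * ('d f x (y - z)) ord0 j)
        (('d f x (y - z)) ord0 j).
      apply/is_derive1_caratheodory; exists (cst (('d f x (y - z)) ord0 j)).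
      by split => // [u|]; [rewrite /cst; ring|exact: cvg_cst].
    exact: is_deriveB D1 D2.
  have [c] : exists2 c, c \in `[0, 1]%R & g 1 - g 0 = dg c * (1 - 0).
    apply: MVT_segment => //.
      by move=> t; rewrite in_itv /= => /andP[t0 t1]; apply: gd; rewrite !ltW.
    apply: derivable_within_continuous => t; rewrite in_itv /= => ht.
    by have [] := gd _ ht.
  rewrite in_itv /= => hc; rewrite subr0 mulr1 /g !(scale0r, scale1r, mul0r, mul1r, addr0, subr0) (subrKC z y) => e2.
  rewrite !mxE; rewrite (_ : _ - _ = dg c); last by rewrite -e2; ring.
  have [/= hJc _] := hr _ (seg _ hc).
  by rewrite distrC; apply: differential_sub_le.

apply: le_trans (enorm_le_coord _ bound) _; first by rewrite !mulr_ge0 ?enorm_ge0 // ltW.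
move: (enorm_ge0 (y - z)); move: (enorm _) => N N0.
have -> : d%:R * (d%:R * N * e1) = (d%:R * d%:R * e1) * N by ring.
apply: ler_wpM2r => //.
rewrite /e1 mulrA ler_pdivrMr ?mulr_gt0 // mulrC; apply: ler_wpM2l; first exact: ltW.
by rewrite ler_pM // ler_nat.
Qed.

Lemma similarity_at x (e : R) : U x -> 0 < e -> exists c r : R, [/\ 0 < c, 0 < r &
  forall y z, cball x r y -> cball x r z ->
    expR (- e) * c * enorm (y - z) <= enorm (f y - f z) <= expR e * c * enorm (y - z)].
Proof.
move=> Ux e0; have [c c0 hc] := differential_similarity Ux.
(* An additive error [c * (1 - expR (- e))] gives the lower factor exactly, and the upper one
   because [expR e + expR (- e) >= 2]. *)
have he : expR (- e) < 1 by rewrite expR_lt1 oppr_lt0.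
have e1 : 0 < c * (1 - expR (- e)) by rewrite mulr_gt0 // subr_gt0.
have [r r0 hr] := difference_approx Ux e1.
exists c, r; split => // y z xy xz; have := hr y z xy xz; have := hc (y - z).
set v := 'd f x (y - z); set w := f y - f z => hv hw.
have h1 : enorm v <= enorm w + enorm (w - v).
  by rewrite -{1}[v](subrKC w) -opprB; apply: le_trans (enormD _ _) _; rewrite enormN.
have h2 : enorm w <= enorm v + enorm (w - v).
  by rewrite -{1}[w](subrKC v); apply: enormD.
have ee : 2 <= expR e + expR (- e).
  have : expR e * expR (- e) = 1 by rewrite -expRD subrr expR0.
  have : 0 <= (expR e - expR (- e)) ^+ 2 by exact: sqr_ge0.
  by have := expR_gt0 e; have := expR_gt0 (- e); nra.
have y0 := enorm_ge0 (y - z).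
have cy : 0 <= c * enorm (y - z) by rewrite mulr_ge0 // ltW.
by apply/andP; split; nra.
Qed.

End LocalSimilarity.

Section UniformSimilarity.
Context {R : realType} {d : nat} (U K : set 'rV[R]_d) (f : 'rV[R]_d -> 'rV[R]_d).
Hypotheses (oU : open U) (fU : C1_conformal U f) (cK : compact K) (KU : K `<=` U).

(** Compactness: the ball of radius [r / 2] about a point within [r / 2] of [x] lies in the ball
    where [x] controls [f]. The form with [\near] lets finitely many maps share one radius. *)
Lemma uniform_similarity (e : R) : 0 < e ->
  \forall r \near (0 : R)^'+, forall x, K x -> exists2 c : R, 0 < c &
    forall y z, cball x r y -> cball x r z ->
    expR (- e) * c * enorm (y - z) <= enorm (f y - f z) <= expR e * c * enorm (y - z).
Proof.
move=> e0; apply: ((compact_near_coveringP K).1 cK) => x Kx.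
have [c [r [c0 r0 hc]]] := similarity_at oU fU (KU Kx) e0.
exists (cball x (r / 2), [set t | t <= r / 2]).
  split => /=; first by apply: nbhs_cball; rewrite divr_gt0.
  by apply: nbhs_right_le; rewrite divr_gt0.
move=> [x' t] /= [hx' ht]; exists c => // y z hy hz.
have sub : cball x' t `<=` cball x r.
  apply: cballS; move: hx'; rewrite /cball /= => hx'.
  by rewrite [leRHS](splitr r); apply: lerD.
by apply: hc; apply: sub.
Qed.

Lemma similar_continuous x : U x -> {for x, continuous (fun y => enorm (f y - f x))}.
Proof.
move=> Ux; have [df _ _] := fU.
have cf := differentiable_continuous (df _ Ux).
exact: (cvg_comp _ _ cf (@enorm_sub_continuous _ _ _ _)).
Qed.

(** Compactness of [K * K]: near the diagonal the local similarity gives the bound, away from it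
    injectivity and continuity do. *)
Lemma bilipschitz_lower : set_inj U f ->
  \forall b \near (0 : R)^'+, forall y z, K y -> K z ->
    b * enorm (y - z) <= enorm (f y - f z).
Proof.
move=> inj.
have cKK := compact_setX cK cK.
suff : \forall b \near (0 : R)^'+, K `*` K `<=` (fun yz => b * enorm (yz.1 - yz.2) <= enorm (f yz.1 - f yz.2)).
  by apply: filterS => b hb y z Ky Kz; apply: (hb (y, z)).
apply: ((compact_near_coveringP _).1 cKK) => -[y z] /= [Ky Kz].
have [->|yz] := eqVneq y z.
  have [c [r [c0 r0 hc]]] := similarity_at oU fU (KU Kz) ltr01.
  have cc : 0 < expR (- 1) * c by rewrite mulr_gt0 ?expR_gt0.
  exists (cball z r `*` cball z r, [set t | t <= expR (- 1) * c]).
    split => /=; last exact: nbhs_right_le.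
    by exists (cball z r, cball z r) => //=; split; apply: nbhs_cball.
  move=> [[y' z'] t] /= [[hy hz] ht].
  have /andP[h _] := hc _ _ hy hz; apply: le_trans h.
  by rewrite ler_wpM2r ?enorm_ge0.
have yz1 : 0 < enorm (y - z).
  rewrite lt_def enorm_ge0 andbT; apply: contraNN yz => /eqP/enorm_eq0/eqP.
  by rewrite subr_eq0.
have fyz : 0 < enorm (f y - f z).
  rewrite lt_def enorm_ge0 andbT; apply: contraNN yz => /eqP/enorm_eq0/eqP.
  by rewrite subr_eq0 => /eqP e; apply/eqP; apply: inj; rewrite ?inE //; apply: KU.
pose D := enorm (f y - f z); pose N := enorm (y - z).
have D4 : 0 < D / 4 by rewrite divr_gt0.
have near_ w : K w -> \forall w' \near w, enorm (f w' - f w) <= D / 4.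
  move=> Kw; have := similar_continuous (KU Kw).
  move=> /(@cvgrPdist_le _ _ _ (nbhs w)) /(_ _ D4); apply: filterS => w'.
  by rewrite subrr enorm0 sub0r normrN ger0_norm ?enorm_ge0.
(* Moving [y] and [z] by at most [N] keeps their distance below [3 * N]; moving each image by at
   most [D / 4] leaves at least [D / 2]. *)
have t0 : 0 < D / 2 / (3 * N) by rewrite !divr_gt0 // mulr_gt0.
exists (((cball y N `&` (fun w' => enorm (f w' - f y) <= D / 4)) `*` (cball z N `&` (fun w' => enorm (f w' - f z) <= D / 4))), [set t | 0 < t <= D / 2 / (3 * N)]).
  split => /=.
    exists (cball y N `&` (fun w' => enorm (f w' - f y) <= D / 4), cball z N `&` (fun w' => enorm (f w' - f z) <= D / 4)) => //=.
    by split; apply: filterI; [exact: nbhs_cball|exact: near_|exact: nbhs_cball|exact: near_].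
  by near=> t; rewrite /=; apply/andP; split; near: t; [exact: nbhs_right_gt|exact: nbhs_right_le].
move=> [[y' z'] t] /= [[[hy1 hy2] [hz1 hz2]] /andP[t1 t2]].
have h1 : enorm (y' - z') <= 3 * N.
  have := enorm_triangle y y' z'; have := enorm_triangle z y z'.
  by move: hy1 hz1; rewrite /cball /= (enormB z z') -/N => *; lra.
have h2 : D / 2 <= enorm (f y' - f z').
  have := enorm_triangle (f y') (f y) (f z); have := enorm_triangle (f z') (f y') (f z).
  by rewrite (enormB (f y) (f y')) -/D; lra.
apply: le_trans h2; apply: (@le_trans _ _ (t * (3 * N))); first by rewrite ler_wpM2l // ltW.
by rewrite -ler_pdivlMr // mulr_gt0.
Unshelve. all: by end_near. Qed.

End UniformSimilarity.

(** * Compositions of the maps along words *)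

Section Attractor.
Context {R : realType} {d l : nat} (X : set 'rV[R]_d)
  (S : 'I_l -> 'rV[R]_d -> 'rV[R]_d) (K : set 'rV[R]_d).
Hypotheses (hS : C1_conformal_IFS X S) (hK : is_attractor X S K).
Local Notation T := (word_map S).
Implicit Types (u v w : seq 'I_l) (x y z : 'rV[R]_d).

Lemma attractor_sub : K `<=` X.
Proof. by have [] := hK. Qed.

Lemma attractor_compact : compact K.
Proof. by have [] := hK. Qed.

Lemma attractor_map i x : K x -> K (S i x).
Proof. by have [_ _ _ e] := hK => Kx; rewrite e; exists i => //; exists x. Qed.

Lemma word_attractor u x : K x -> K (T u x).
Proof. by move=> Kx; elim: u => //= i u IH; apply: attractor_map. Qed.

Lemma word_domain u x : X x -> X (T u x).
Proof.
have [_ hX _] := hS => Xx; elim: u => //= i u IH.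
exact: (hX i).
Qed.

Lemma word_cat u v x : T (u ++ v) x = T u (T v x).
Proof. by elim: u => //= i u ->. Qed.

Lemma attractor_bounded : exists2 D : R, 1 <= D &
  forall x y, K x -> K y -> enorm (x - y) <= D.
Proof.
have [M [_ hM]] := compact_bounded attractor_compact.
have {}hM x : K x -> `|x| <= `|M| + 1.
  by move=> Kx; apply: hM => //; apply: le_lt_trans (ler_norm _) _; rewrite ltrDl.
have m0 : 0 <= `|M| + 1 by rewrite addr_ge0.
exists (1 + d%:R * (`|M| + 1) + d%:R * (`|M| + 1)).
  by rewrite -addrA lerDl addr_ge0 // mulr_ge0.
move=> x y /hM hx /hM hy; apply: le_trans (enormD _ _) _; rewrite enormN.
apply: lerD; last exact: le_trans (enorm_le_norm _) (ler_wpM2l _ hy).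
apply: le_trans (enorm_le_norm _) (le_trans (ler_wpM2l _ hx) _) => //.
by rewrite lerDr.
Qed.

Lemma uniform_contraction : exists2 c : R, 0 < c < 1 &
  forall i x y, X x -> X y -> enorm (S i x - S i y) <= c * enorm (x - y).
Proof.
have [_ _ [U [f [_ XU hf]]]] := hS.
have : \forall c \near (1 : R)^'-, 0 < c < 1 /\
    forall i x y, X x -> X y -> enorm (S i x - S i y) <= c * enorm (x - y).
  apply: filterI.
    by near=> c; apply/andP; split; near: c; [apply: nbhs_left_gt|apply: nbhs_left_lt].
  suff h i : \forall c \near (1 : R)^'-,
      forall x y, X x -> X y -> enorm (S i x - S i y) <= c * enorm (x - y).
    exact: filter_forall h.
  have [e _ _ [c /andP[c0 c1] hc] _] := hf i.
  near=> c' => x y Xx Xy; rewrite -!e //.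
  apply: le_trans (hc _ _ (XU _ Xx) (XU _ Xy)) _; rewrite ler_wpM2r ?enorm_ge0 //.
  by near: c'; apply: nbhs_left_ge.
by move=> /filter_ex[c [hc1 hc2]]; exists c.
Unshelve. all: by end_near. Qed.

Lemma map_similarity (e : R) : 0 < e -> exists2 r : R, 0 < r &
  forall i x, K x -> exists2 c : R, 0 < c & forall y z, K y -> K z ->
    enorm (y - x) <= r -> enorm (z - x) <= r ->
    expR (- e) * c * enorm (y - z) <= enorm (S i y - S i z)
      <= expR e * c * enorm (y - z).
Proof.
move=> e0; have [_ _ [U [f [oU XU hf]]]] := hS.
have KU : K `<=` U by apply: subset_trans XU; apply: attractor_sub.
have h : \forall r \near (0 : R)^'+, 0 < r /\ forall i x, K x ->
    exists2 c : R, 0 < c & forall y z, cball x r y -> cball x r z ->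
    expR (- e) * c * enorm (y - z) <= enorm (f i y - f i z) <= expR e * c * enorm (y - z).
  apply: filterI; first by apply: nbhs_right_gt.
  have h i : \forall r \near (0 : R)^'+, forall x, K x ->
    exists2 c : R, 0 < c & forall y z, cball x r y -> cball x r z ->
    expR (- e) * c * enorm (y - z) <= enorm (f i y - f i z) <= expR e * c * enorm (y - z).
    have [_ _ _ _ hc] := hf i.
    exact: (uniform_similarity oU hc attractor_compact KU e0).
  exact: filter_forall h.
have [r [r0 hr]] := filter_ex h; exists r => // i x Kx.
have [c c0 hc] := hr i x Kx; exists c => // y z Ky Kz hy hz.
have [ef _ _ _ _] := hf i.
by rewrite -!ef; [exact: hc|exact: attractor_sub..].
Qed.

Lemma map_lower : exists2 b : R, 0 < b < 1 &
  forall i y z, K y -> K z -> b * enorm (y - z) <= enorm (S i y - S i z).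
Proof.
have [_ _ [U [f [oU XU hf]]]] := hS.
have KU : K `<=` U by apply: subset_trans XU; apply: attractor_sub.
have h : \forall b \near (0 : R)^'+, 0 < b < 1 /\
    forall i y z, K y -> K z -> b * enorm (y - z) <= enorm (f i y - f i z).
  apply: filterI.
    by near=> b; apply/andP; split; near: b; [apply: nbhs_right_gt|apply: nbhs_right_lt].
  have h i : \forall b \near (0 : R)^'+,
      forall y z, K y -> K z -> b * enorm (y - z) <= enorm (f i y - f i z).
    have [_ _ inj _ hc] := hf i.
    exact: (bilipschitz_lower oU hc attractor_compact KU inj).
  exact: filter_forall h.
have [b [b0 hb]] := filter_ex h; exists b => // i y z Ky Kz.
have [ef _ _ _ _] := hf i.
by rewrite -!ef; [exact: hb|exact: attractor_sub..].
Unshelve. all: by end_near. Qed.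

Lemma word_contraction : exists2 c : R, 0 < c < 1 &
  forall u x y, X x -> X y -> enorm (T u x - T u y) <= c ^+ size u * enorm (x - y).
Proof.
have [c /andP[c0 c1] hc] := uniform_contraction; exists c; first by rewrite c0.
elim=> [|i u IH] x y Xx Xy; first by rewrite expr0 mul1r.
apply: le_trans (hc i _ _ (word_domain u Xx) (word_domain u Xy)) _.
by rewrite exprS -mulrA ler_wpM2l ?IH // ltW.
Qed.

Lemma word_nonexpanding u x y : X x -> X y -> enorm (T u x - T u y) <= enorm (x - y).
Proof.
move=> Xx Xy; have [c /andP[c0 c1] hc] := word_contraction.
apply: le_trans (hc u x y Xx Xy) _; rewrite ler_piMl ?enorm_ge0 //.
by rewrite exprn_ile1 // ltW.
Qed.

(** The word maps are controlled on [X] only, where they are nonexpanding; the compactness of [X]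
    brings limit points back into it. *)
Lemma word_preimage_closed u (A : set 'rV[R]_d) :
  closed A -> closed (X `&` T u @^-1` A).
Proof.
have [cX _ _] := hS; move=> cA.
have clX : closed X by apply: compact_closed => //; exact: norm_hausdorff.
have sub x : closure (X `&` T u @^-1` A) x -> X x.
  by move=> hx; apply: clX; apply: closureS hx => y [].
move=> x hx; split; first exact: sub.
apply: cA => V /nbhs_cballP[r r0 hr].
have [y [[Xy Ay] hy]] := hx _ (nbhs_cball x r0).
exists (T u y); split => //; apply: hr; rewrite /cball /=.
exact: le_trans (word_nonexpanding u Xy (sub _ hx)) hy.
Qed.

(** * Levels of words and distortion of cylinders *)

Hypothesis nondegenerate : exists x y, [/\ K x, K y & x != y].

Definition cyl_diam u : R := fine (diam (T u @` K)).

(** Scale on a logarithmic axis. The logarithm is meaningful since [nondegenerate] makes all the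
    diameters positive. The empty word has level [- ln (diam K)], which need not be 0 or even
    nonnegative. *)
Definition lev u : R := - ln (cyl_diam u).

(* A [C^1] system need not have bounded distortion: cylinders are compared up to the subexponential
   factor [expR (e * lev u + C)] only. *)
Definition distortion_bound (e C : R) := [/\ 0 < C,
  forall u, 0 <= e * lev u + C,
  forall u y z, K y -> K z ->
    expR (- lev u - (e * lev u + C)) * enorm (y - z) <= enorm (T u y - T u z)
      <= expR (- lev u + (e * lev u + C)) * enorm (y - z) &
  forall u v, `|lev (u ++ v) - (lev u + lev v)| <= e * lev u + C].

Lemma cyl_diamE u : diam (T u @` K) = (cyl_diam u)%:E.
Proof.
have [D D1 hD] := attractor_bounded.
have h : (diam (T u @` K) <= D%:E)%E.
  apply/diam_leP; split; first exact: le_trans ler01 D1.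
  by move=> _ _ [x Kx <-] [y Ky <-]; apply: hD; apply: word_attractor.
rewrite /cyl_diam fineK // ge0_fin_numE ?diam_ge0 //.
exact: le_lt_trans h (ltry _).
Qed.

Lemma cyl_diam_ub u y z : K y -> K z -> enorm (T u y - T u z) <= cyl_diam u.
Proof.
move=> Ky Kz; have /diam_leP[_] : (diam (T u @` K) <= (cyl_diam u)%:E)%E.
  by rewrite cyl_diamE.
by apply; [exists y|exists z].
Qed.

Lemma cyl_diam_le u (c : R) : (forall y z, K y -> K z -> enorm (T u y - T u z) <= c) ->
  cyl_diam u <= c.
Proof.
move=> h; rewrite -lee_fin -cyl_diamE; apply/diam_leP.
have [[x Kx] _ _ _] := hK.
split; first by apply: le_trans (enorm_ge0 _) (h _ _ Kx Kx).
by move=> _ _ [y Ky <-] [z Kz <-]; apply: h.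
Qed.

Lemma enorm_gt0 x y : x != y -> 0 < enorm (x - y).
Proof.
move=> xy; rewrite lt_def enorm_ge0 andbT; apply: contraNN xy => /eqP/enorm_eq0/eqP.
by rewrite subr_eq0.
Qed.

(** The last letter acts first. Once the inner word has [k] letters its image of [K] has diameter at
    most [r], and every further letter on the left is a similarity up to [expR e]. The at most [k]
    inner letters act on large sets and cost a factor [b = expR (- B)] each, a bounded total. *)
Lemma word_similarity (e : R) : 0 < e -> exists2 C : R, 0 <= C &
  forall u, exists2 c : R, 0 < c & forall y z, K y -> K z ->
    expR (- (C + e * (size u)%:R)) * c * enorm (y - z) <= enorm (T u y - T u z)
      <= expR (C + e * (size u)%:R) * c * enorm (y - z).
Proof.
move=> e0; have [r r0 hr] := map_similarity e0.
have [b /andP[b0 b1] hb] := map_lower.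
have [c /andP[c0 c1] hc] := word_contraction.
have [D D1 hD] := attractor_bounded.
have D0 : 0 < D by apply: lt_le_trans D1.
have [k hk] : exists k, forall n, (k <= n)%N -> c ^+ n * D <= r.
  have rD : 0 < r / D by rewrite divr_gt0.
  have : c ^+ n @[n --> \oo] --> 0 by apply: cvg_expr; rewrite ger0_norm // ltW.
  move=> /cvgrPdist_le/(_ _ rD)[k _ hk]; exists k => n /hk /=.
  have cn : 0 <= c ^+ n by apply: exprn_ge0; apply: ltW.
  by rewrite sub0r normrN (ger0_norm cn) (ler_pdivlMr _ _ D0).
pose B := - ln b; have B0 : 0 < B by rewrite oppr_gt0 ln_lt0 // b0.
have [K0 _ _ _] := hK; case: K0 => x0 Kx0.
exists (B * k%:R); first by rewrite mulr_ge0 // ltW.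
suff main u : exists2 c : R, 0 < c & forall y z, K y -> K z ->
    expR (- (B * (minn (size u) k)%:R + e * (size u)%:R)) * c * enorm (y - z)
      <= enorm (T u y - T u z)
      <= expR (B * (minn (size u) k)%:R + e * (size u)%:R) * c * enorm (y - z).
  move=> u; have [c' c'0 hc'] := main u; exists c' => // y z Ky Kz.
  have /andP[h1 h2] := hc' y z Ky Kz.
  have le : B * (minn (size u) k)%:R <= B * k%:R by rewrite ler_pM2l // ler_nat geq_minr.
  have cy : 0 <= c' * enorm (y - z) by rewrite mulr_ge0 ?enorm_ge0 // ltW.
  apply/andP; split.
    by apply: le_trans h1; rewrite -!mulrA ler_wpM2r // ler_expR lerN2 lerD2r.
  by apply: le_trans h2 _; rewrite -!mulrA ler_wpM2r // ler_expR lerD2r.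
elim: u => [|i u [c' c'0 IH]].
  exists 1 => // y z Ky Kz; rewrite min0n !mulr0 addr0 oppr0 expR0 !mul1r.
  by rewrite lexx.
have [ku|uk] := ltnP (size u) k.
  exists c' => // y z Ky Kz; have /andP[h1 h2] := IH y z Ky Kz.
  have Ky' := word_attractor u Ky; have Kz' := word_attractor u Kz.
  have h3 := hb i _ _ Ky' Kz'.
  have h4 : enorm (S i (T u y) - S i (T u z)) <= enorm (T u y - T u z).
    by apply: (@word_nonexpanding [:: i]); apply: attractor_sub.
  rewrite /= (minn_idPl ku); rewrite (minn_idPl (ltnW ku)) in h1 h2.
  have cy : 0 <= c' * enorm (y - z) by rewrite mulr_ge0 ?enorm_ge0 // ltW.
  apply/andP; split.
    apply: le_trans h3; apply: le_trans (ler_wpM2l (ltW b0) h1).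
    have bE : b = expR (- B) by rewrite opprK lnK // posrE.
    rewrite {1}bE -!(mulrA _ c') [leRHS]mulrA -expRD ler_wpM2r // ler_expR -!natr1.
    by lra.
  apply: le_trans h4 (le_trans h2 _).
  by rewrite -!(mulrA _ c') ler_wpM2r // ler_expR -!natr1; lra.
have [a a0 ha] := hr i _ (word_attractor u Kx0).
exists (a * c'); first by rewrite mulr_gt0.
move=> y z Ky Kz; have /andP[h1 h2] := IH y z Ky Kz.
have close (w : 'rV[R]_d) : K w -> enorm (T u w - T u x0) <= r.
  move=> Kw; apply: le_trans (hc u w x0 (attractor_sub Kw) (attractor_sub Kx0)) _.
  apply: le_trans (hk _ uk); apply: ler_wpM2l; first by apply: exprn_ge0; apply: ltW.
  exact: hD.
have /andP[h3 h4] := ha _ _ (word_attractor u Ky) (word_attractor u Kz) (close _ Ky) (close _ Kz).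
rewrite /= (minn_idPr (leqW uk)); rewrite (minn_idPr uk) in h1 h2.
have p1 : 0 <= expR (- e) * a by rewrite mulr_ge0 ?expR_ge0 // ltW.
have p2 : 0 <= expR e * a by rewrite mulr_ge0 ?expR_ge0 // ltW.
apply/andP; split.
  apply: le_trans h3; apply: le_trans (ler_wpM2l p1 h1).
  have -> : - (B * k%:R + e * (size u).+1%:R) = - e + - (B * k%:R + e * (size u)%:R).
    by rewrite -natr1; ring.
  by rewrite expRD le_eqVlt; apply/orP; left; apply/eqP; ring.
apply: le_trans h4 _; apply: le_trans (ler_wpM2l p2 h2) _.
have -> : B * k%:R + e * (size u).+1%:R = e + (B * k%:R + e * (size u)%:R).
  by rewrite -natr1; ring.
by rewrite expRD le_eqVlt; apply/orP; left; apply/eqP; ring.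
Qed.

Lemma cyl_diam_gt0 u : 0 < cyl_diam u.
Proof.
have [x [y [Kx Ky xy]]] := nondegenerate.
have [C _ hC] := word_similarity ltr01; have [c c0 hc] := hC u.
apply: lt_le_trans (cyl_diam_ub u Kx Ky).
have /andP[h _] := hc _ _ Kx Ky; apply: lt_le_trans h.
by rewrite !mulr_gt0 ?expR_gt0 ?enorm_gt0.
Qed.

Lemma cyl_diam_expR u : cyl_diam u = expR (- lev u).
Proof. by rewrite /lev opprK lnK // posrE cyl_diam_gt0. Qed.

Lemma word_dist_lev u y z : K y -> K z -> enorm (T u y - T u z) <= expR (- lev u).
Proof. by rewrite -cyl_diam_expR; apply: cyl_diam_ub. Qed.

Lemma lev_ge u (c : R) : (forall y z, K y -> K z -> enorm (T u y - T u z) <= expR (- c)) ->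
  c <= lev u.
Proof. by move=> /cyl_diam_le; rewrite cyl_diam_expR ler_expR lerN2. Qed.

Lemma size_le_lev : exists k c : R, [/\ 0 < k, 0 < c &
  forall u, (size u)%:R <= k * (lev u + c)].
Proof.
have [c /andP[c0 c1] hc] := word_contraction.
have [D D1 hD] := attractor_bounded; have D0 : 0 < D by apply: lt_le_trans D1.
have lc : 0 < - ln c by rewrite oppr_gt0 ln_lt0 // c0.
exists (- ln c)^-1, (ln D + 1); split; first by rewrite invr_gt0.
  by rewrite ltr_wpDl // ln_ge0.
move=> u; rewrite ler_pdivlMl //.
have : (- ln c) * (size u)%:R - ln D <= lev u.
  apply: lev_ge => y z Ky Kz.
  apply: le_trans (hc u y z (attractor_sub Ky) (attractor_sub Kz)) _.
  rewrite opprB expRD lnK ?posrE // -mulNr opprK expRM_natr lnK ?posrE // mulrC.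
  by apply: ler_wpM2r; [apply: exprn_ge0; apply: ltW|apply: hD].
by rewrite addrA => h; apply: ltW; apply: le_lt_trans _ (_ : lev u + ln D < _); lra.
Qed.

(** The unknown ratio of [word_similarity] is compared with the diameter: the pair [x1], [y1] bounds
    it from above, the diameter bound [D] of [K] from below. Almost additivity of [lev] follows by
    applying this to pairs inside the cylinder of [v]. *)
Lemma distortion (e : R) : 0 < e -> exists C, distortion_bound e C.
Proof.
move=> e0; have [k [c [k0 c0 hk]]] := size_le_lev.
(* The error of [word_similarity] is spent twice, and a length is at most [k] times the level plus a
   constant. *)
have e1 : 0 < e / (2 * k) by rewrite divr_gt0 // mulr_gt0.
have [C0 C00 hC0] := word_similarity e1.
have [D D1 hD] := attractor_bounded; have D0 : 0 < D by apply: lt_le_trans D1.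
have [x1 [y1 [Kx1 Ky1 xy1]]] := nondegenerate.
have N0 := enorm_gt0 xy1; set N := enorm (x1 - y1) in N0.
pose C := 2 * C0 + e * c + ln D + `|ln N| + 1.
have lD : 0 <= ln D by apply: ln_ge0.
have Cgt0 : 0 < C by rewrite ltr_wpDl // !addr_ge0 // mulr_ge0 // ltW.
have ec : 0 <= e * c by rewrite mulr_ge0 // ltW.
have szE u : e / (2 * k) * (size u)%:R <= (e * lev u + e * c) / 2.
  rewrite -mulrDr; have := ler_wpM2l (ltW e1) (hk u).
  by rewrite (_ : e / (2 * k) * (k * (lev u + c)) = e * (lev u + c) / 2) // ; field; rewrite lt0r_neq0.
have ge0 u : 0 <= e * lev u + e * c.
  have := szE u; have : 0 <= e / (2 * k) * (size u)%:R by rewrite mulr_ge0 // ltW.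
  by lra.
have dist u y z : K y -> K z ->
    expR (- lev u - (e * lev u + C)) * enorm (y - z) <= enorm (T u y - T u z)
      <= expR (- lev u + (e * lev u + C)) * enorm (y - z).
  move=> Ky Kz; have [a a0 ha] := hC0 u.
  set t := C0 + _ in ha; have ht : 2 * t <= 2 * C0 + (e * lev u + e * c).
    by have := szE u; rewrite /t; lra.
  pose la := ln a; have aE : a = expR la by rewrite lnK // posrE.
  have up : la <= - lev u + t - ln N.
    have /andP[h _] := ha _ _ Kx1 Ky1.
    have := le_trans h (word_dist_lev u Kx1 Ky1).
    rewrite -/N -{1}(@lnK _ N) ?posrE // aE -!expRD ler_expR; lra.
  have lo : - lev u <= t + la + ln D.
    rewrite -ler_expR -cyl_diam_expR; apply: cyl_diam_le => y' z' Ky' Kz'.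
    have /andP[_ h] := ha _ _ Ky' Kz'; apply: le_trans h _.
    rewrite !expRD -aE (@lnK _ D) ?posrE //; apply: ler_wpM2l (hD _ _ Ky' Kz').
    by rewrite mulr_ge0 ?expR_ge0 // ltW.
  have /andP[h1 h2] := ha _ _ Ky Kz; apply/andP; split.
    apply: le_trans h1; rewrite aE -expRD ler_wpM2r ?enorm_ge0 // ler_expR.
    by have := normr_ge0 (ln N); rewrite /C; lra.
  apply: le_trans h2 _; rewrite aE -expRD ler_wpM2r ?enorm_ge0 // ler_expR.
  by have := ler_norm (- ln N); rewrite normrN /C; lra.
exists C; split => //.
  by move=> u; have := ge0 u; rewrite /C; have := normr_ge0 (ln N); lra.
move=> u v; rewrite ler_norml; apply/andP; split.
  rewrite lerBrDr; apply: lev_ge => y z Ky Kz; rewrite !word_cat.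
  have Ky' := word_attractor v Ky; have Kz' := word_attractor v Kz.
  have /andP[_ h] := dist u _ _ Ky' Kz'; apply: le_trans h _.
  apply: le_trans (ler_wpM2l (expR_ge0 _) (word_dist_lev v Ky Kz)) _.
  by rewrite -expRD ler_expR; lra.
suff : lev (u ++ v) - lev u - (e * lev u + C) <= lev v by lra.
apply: lev_ge => y z Ky Kz.
have Ky' := word_attractor v Ky; have Kz' := word_attractor v Kz.
have /andP[h _] := dist u _ _ Ky' Kz'.
have := le_trans h (_ : _ <= expR (- lev (u ++ v))).
rewrite -!word_cat => /(_ (word_dist_lev _ Ky Kz)).
by rewrite -ler_pdivlMl ?expR_gt0 // -expRN -expRD => {}h; apply: le_trans h _; rewrite ler_expR; lra.
Qed.

(** [scale_words] with a real scale [exp (- L)] in place of [2 ^- n], since the stages of the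
    construction do not end at dyadic scales. *)
Definition section (L : R) : set (seq 'I_l) :=
  [set u | [/\ u != [::], L <= lev u & lev (drop_last u) < L]].

Lemma scale_wordsE n : scale_words S K n = section (n%:R * ln 2).
Proof.
have e : 2 ^- n = expR (- (n%:R * ln 2)) :> R.
  by rewrite expRN expRM_natl lnK // posrE.
apply/seteqP; split => u; rewrite /scale_words /section /= !cyl_diamE !lee_fin !lte_fin !cyl_diam_expR e.
  by rewrite !ler_expR !ltr_expR !lerN2 !ltrN2.
by rewrite !ler_expR !ltr_expR !lerN2 !ltrN2.
Qed.

Lemma drop_last_rcons (T : Type) (u : seq T) (i : T) : drop_last (rcons u i) = u.
Proof. by rewrite /drop_last size_rcons /= -cats1 take_size_cat. Qed.

(** Only the last letter crosses the level [L], and by almost additivity it adds a bounded amount up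
    to the distortion error. *)
Lemma section_lev (e : R) : 0 < e -> exists2 C, 0 < C &
  forall L u, section L u -> L <= lev u <= L + (e * L + C).
Proof.
move=> e0; have [C [C0 _ _ hcat]] := distortion e0.
pose B := \big[Num.max/0]_(i < l) lev [:: i].
have B0 : 0 <= B by apply: bigmax_ge_id.
exists (C + B); first by rewrite ltr_pwDl.
move=> L u [+ -> +]; case/lastP: u => // u i _; rewrite drop_last_rcons => hu /=.
have := hcat u [:: i]; rewrite cats1 ler_norml => /andP[_ h].
have hB : lev [:: i] <= B by apply: le_bigmax.
by have := ltr_pM2l e0 (lev u) L; rewrite hu => h'; lra.
Qed.

Lemma section_extend (i : 'I_l) L u : lev u < L ->
  exists m, section L (u ++ nseq m i).
Proof.
move=> hu; have [k [c [k0 c0 hk]]] := size_le_lev.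
have ex : exists m, L <= lev (u ++ nseq m i).
  exists (Num.bound (k * (L + c))).
  have := hk (u ++ nseq (Num.bound (k * (L + c))) i).
  rewrite size_cat size_nseq natrD => h; rewrite leNgt; apply/negP => h2.
  have : k * (lev (u ++ nseq (Num.bound (k * (L + c))) i) + c) < k * (L + c).
    by rewrite ltr_pM2l // ltrD2r.
  have h4 : 0 <= (size u)%:R :> R by [].
  have [h5|h5] := leP 0 (k * (L + c)); first by have := archi_boundP h5; lra.
  have h6 : 0 <= (Num.bound (k * (L + c)))%:R :> R by [].
  by lra.
case: (ex_minnP ex) => -[|m]; first by rewrite cats0 leNgt hu.
move=> h min; exists m.+1; split => //; first by case: (u).
rewrite -addn1 nseqD catA cats1 drop_last_rcons ltNge.
by apply/negP => /min; rewrite ltnn.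
Qed.

(** * The self-conformal measure and the masses of cylinders *)

Context (p : 'I_l -> R) (nu : probability (borelRV R d) R).
Hypotheses (hp : probability_vector p) (hnu : self_conformal_measure X S p nu).

(** Applied to closed sets: they are measurable, and the operation [X & S i @^-1] preserves them, so
    self-conformality can be iterated. *)
Definition mass (A : set 'rV[R]_d) : R := fine (nu A).

Lemma closed_measurable (A : set 'rV[R]_d) : closed A ->
  measurable (A : set (borelRV R d)).
Proof.
move=> cA; rewrite -[A]setCK; apply: measurableC.
by apply: sub_sigma_algebra; rewrite -[_ A]/(~` A); apply: closed_openC.
Qed.

Lemma massE (A : set 'rV[R]_d) : measurable (A : set (borelRV R d)) -> nu A = (mass A)%:E.
Proof.
move=> mA; rewrite /mass fineK // ge0_fin_numE ?measure_ge0 //.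
by apply: le_lt_trans (ltry 1); apply: probability_le1.
Qed.

Lemma mass_ge0 (A : set 'rV[R]_d) : 0 <= mass A.
Proof. exact/fine_ge0/measure_ge0. Qed.

Lemma mass_le1 (A : set 'rV[R]_d) : closed A -> mass A <= 1.
Proof.
move=> cA; have mA := closed_measurable cA.
by rewrite -lee_fin -massE //; apply: probability_le1.
Qed.

Lemma le_mass (A B : set 'rV[R]_d) : closed A -> closed B -> A `<=` B -> mass A <= mass B.
Proof.
move=> cA cB AB; have mA := closed_measurable cA; have mB := closed_measurable cB.
by rewrite -lee_fin -!massE //; apply: le_measure; rewrite ?inE.
Qed.

Lemma mass0 : mass set0 = 0.
Proof. by rewrite /mass measure0. Qed.

Lemma map_preimage_closed i (A : set 'rV[R]_d) : closed A -> closed (X `&` S i @^-1` A).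
Proof. by move=> cA; have := @word_preimage_closed [:: i] A cA. Qed.

Lemma mass_self_conformal (A : set 'rV[R]_d) : closed A ->
  mass A = \sum_(i < l) p i * mass (X `&` S i @^-1` A).
Proof.
move=> cA; have mA := closed_measurable cA.
have := hnu mA; rewrite massE // => e; apply: EFin_inj; rewrite e -sumEFin.
apply: eq_bigr => i _; rewrite EFinM massE //.
by apply: closed_measurable; apply: map_preimage_closed.
Qed.

(** Iterate self-conformality until all the preimages are empty. For [n = 0] one further step is
    needed: [A] misses [X], which contains the image of every [S i]. *)
Lemma mass_unreached n (A : set 'rV[R]_d) : closed A ->
  (forall u x, size u = n -> X x -> ~ A (T u x)) -> mass A = 0.
Proof.
elim: n A => [|n IH] A cA h; rewrite mass_self_conformal //; apply: big1 => i _.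
  rewrite (_ : _ `&` _ = set0) ?mass0 ?mulr0 //.
  apply/seteqP; split => // x [Xx Ax]; apply: (h [::] (S i x)) => //.
  exact: (word_domain [:: i]).
rewrite IH ?mulr0 //; first exact: map_preimage_closed.
by move=> u x su Xx [_ hA]; apply: (h (i :: u) x) => //=; rewrite su.
Qed.

Lemma domain_bounded : exists2 D : R, 0 < D &
  forall x y, X x -> X y -> enorm (x - y) <= D.
Proof.
have [cX _ _] := hS; have [M [_ hM]] := compact_bounded cX.
have {}hM x : X x -> `|x| <= `|M| + 1.
  by move=> Kx; apply: hM => //; apply: le_lt_trans (ler_norm _) _; rewrite ltrDl.
exists (d%:R * (`|M| + 1 + (`|M| + 1)) + 1).
  by rewrite ltr_wpDl // mulr_ge0 // !addr_ge0.
move=> x y /hM hx /hM hy; apply: le_trans (enorm_le_norm _) _.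
apply: (@le_trans _ _ (d%:R * (`|M| + 1 + (`|M| + 1)))); last by rewrite lerDl.
by apply: ler_wpM2l => //; apply: le_trans (ler_normB _ _) _; apply: lerD.
Qed.

Lemma far_closed (e : R) : closed [set x | forall y, K y -> e <= enorm (x - y)].
Proof.
have -> : [set x | forall y, K y -> e <= enorm (x - y)] =
    \bigcap_(y in K) (fun x => enorm (x - y)) @^-1` [set t | e <= t].
  by apply/seteqP; split => x h y Ky; apply: h.
apply: closed_bigI => y Ky.
by apply: preimage_closed; [move=> x _; exact: enorm_sub_continuous|exact: closed_ge].
Qed.

(** Words of length [n] map [X] to within [c ^+ n * D] of [K], so for large [n] they do not reach
    this set. *)
Lemma mass_far (e : R) : 0 < e -> mass [set x | forall y, K y -> e <= enorm (x - y)] = 0.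
Proof.
move=> e0; have [D D0 hD] := domain_bounded.
have [c /andP[c0 c1] hc] := word_contraction.
have eD : 0 < e / D by rewrite divr_gt0.
have : c ^+ n @[n --> \oo] --> 0 by apply: cvg_expr; rewrite ger0_norm // ltW.
move=> /cvgrPdist_lt/(_ _ eD)[n _ hn].
apply: (@mass_unreached n); first exact: far_closed.
move=> u x su Xx /= h; have [[y Ky] _ _ _] := hK.
have := h _ (word_attractor u Ky); apply/negP; rewrite -ltNge.
apply: le_lt_trans (hc _ _ _ Xx (attractor_sub Ky)) _.
have := hn n (leqnn n); rewrite /= sub0r normrN su.
rewrite ger0_norm; last by apply: exprn_ge0; apply: ltW.
rewrite ltr_pdivlMr // => h1; apply: le_lt_trans h1.
by apply: ler_wpM2l; [apply: exprn_ge0; apply: ltW|apply: hD => //; apply: attractor_sub].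
Qed.

Lemma attractor_closed : closed K.
Proof. by apply: compact_closed; [exact: norm_hausdorff|exact: attractor_compact]. Qed.

Lemma measure_le (A B : set (borelRV R d)) : measurable A -> measurable B ->
  A `<=` B -> (nu A <= nu B)%E.
Proof. by move=> mA mB AB; apply: le_measure; rewrite ?inE. Qed.

Lemma measure_bigcup_eq0 (F : nat -> set (borelRV R d)) : (forall n, measurable (F n)) ->
  (forall n, nu (F n) = 0%E) -> nu (\bigcup_n F n) = 0%E.
Proof.
move=> mF F0; apply/eqP; rewrite eq_le measure_ge0 andbT.
have mU : measurable (\bigcup_n F n) by apply: bigcupT_measurable.
apply: le_trans (@measure_sigma_subadditive _ _ _ nu _ _ mF mU (@subset_refl _ _)) _.
by rewrite eseries0 // => n _ _; apply: F0.
Qed.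

Lemma measure_attractorC : nu (~` K) = 0%E.
Proof.
have cK := attractor_closed.
pose F n := [set x | forall y, K y -> n.+1%:R^-1 <= enorm (x - y)].
have KF : ~` K = \bigcup_n F n.
  apply/seteqP; split => x.
    move=> nKx; have /nbhs_cballP[r r0 hr] : nbhs x (~` K).
      by apply: open_nbhs_nbhs; split => //; apply: closed_openC.
    exists (Num.bound (r^-1)) => //= y Ky.
    have hx : r <= enorm (x - y).
      rewrite leNgt; apply/negP => h; apply: (hr y) => //.
      by rewrite /cball /= enormB ltW.
    apply: le_trans hx; rewrite -[leRHS]invrK lef_pV2 ?posrE ?invr_gt0 //.
    apply/ltW/(@lt_le_trans _ _ (Num.bound r^-1)%:R); last by rewrite ler_nat.
    by rewrite archi_boundP // invr_ge0 ltW.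
  move=> [n _ hx] Kx; have := hx x Kx.
  by rewrite subrr enorm0 leNgt invr_gt0 ltr0n.
rewrite KF.
have mF n : measurable (F n : set (borelRV R d)).
  by apply: closed_measurable; apply: far_closed.
apply: measure_bigcup_eq0 => // n; rewrite massE // mass_far //.
Qed.

Lemma mass_meets (A : set 'rV[R]_d) : closed A -> 0 < mass A -> exists2 x, K x & A x.
Proof.
move=> cA A0; apply: contrapT => h; move: A0; apply/negP; rewrite -leNgt.
have mA := closed_measurable cA; have mK := closed_measurable attractor_closed.
rewrite -lee_fin -massE //.
have AK : A `<=` ~` K by move=> x Ax Kx; apply: h; exists x.
have := measure_le mA (measurableC mK) AK; by rewrite measure_attractorC.
Qed.

Lemma mass_contains (A : set 'rV[R]_d) : closed A -> K `<=` A -> mass A = 1.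
Proof.
move=> cA KA; have mA := closed_measurable cA.
have mK := closed_measurable attractor_closed.
have h : nu (~` A) = 0%E.
  apply/eqP; rewrite eq_le measure_ge0 andbT.
  rewrite -measure_attractorC; apply: measure_le; [exact: measurableC..|].
  exact: subsetC.
have := probability_setC nu mA; rewrite h massE // => /eqP.
by rewrite -EFinB eqe eq_sym subr_eq0 => /eqP.
Qed.

Lemma mass_support x (r : R) : msupport nu x -> 0 < r -> 0 < mass (cball x r).
Proof.
move=> sx r0; have mB := closed_measurable (@cball_closed _ _ x r).
rewrite -lte_fin -massE //; have := nbhs_cball x r0; rewrite nbhsE => -[V [oV Vx] VB].
apply: lt_le_trans (sx V oV Vx) _; apply: le_measure; rewrite ?inE //.
exact: sub_sigma_algebra.
Qed.

Lemma support_attractor : msupport nu `<=` K.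
Proof.
move=> x sx; apply: attractor_closed => V /nbhs_cballP[r r0 hr].
have [y Ky hy] := mass_meets (@cball_closed _ _ x r) (mass_support sx r0).
by exists y; split => //; apply: hr.
Qed.

Lemma positive_support x : (forall r : R, 0 < r -> 0 < mass (cball x r)) -> msupport nu x.
Proof.
move=> h V oV Vx; have /nbhs_cballP[r r0 hr] : nbhs x V by apply: open_nbhs_nbhs.
have mB := closed_measurable (@cball_closed _ _ x r).
apply: (@lt_le_trans _ _ (nu (cball x r))); first by rewrite massE // lte_fin h.
by apply: le_measure; rewrite ?inE //; apply: sub_sigma_algebra.
Qed.

Definition weight u : R := \prod_(i <- u) p i.

(* Since the separation condition counts maps and not words, [b] may be as large as the total weight
   of all the words that define the same map as [u]. *)
Definition admissible u (b : R) := 0 <= b /\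
  forall A : set 'rV[R]_d, closed A -> b * mass (X `&` T u @^-1` A) <= mass A.

Lemma weight_ge0 u : 0 <= weight u.
Proof. by apply: prodr_ge0 => i _; apply: hp.1. Qed.

Lemma preimage_cat u v (A : set 'rV[R]_d) :
  X `&` T v @^-1` (X `&` T u @^-1` A) = X `&` T (u ++ v) @^-1` A.
Proof.
apply/seteqP; split => x /=.
  by move=> [Xx [_ h]]; split => //; rewrite /preimage /= word_cat.
move=> [Xx h]; split => //; split; first exact: word_domain.
by move: h; rewrite /preimage /= word_cat.
Qed.

Lemma admissible_cat u v a b : admissible u a -> admissible v b ->
  admissible (u ++ v) (a * b).
Proof.
move=> [a0 ha] [b0 hb]; split; first exact: mulr_ge0.
move=> A cA; apply: le_trans (ha A cA); rewrite -mulrA; apply: ler_wpM2l => //.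
rewrite -preimage_cat; apply: hb; exact: word_preimage_closed.
Qed.

Lemma admissible_le u a b : 0 <= b <= a -> admissible u a -> admissible u b.
Proof.
move=> /andP[b0 ba] [a0 ha]; split => // A cA; apply: le_trans (ha A cA).
by apply: ler_wpM2r => //; apply: mass_ge0.
Qed.

Lemma admissible_weight u : admissible u (weight u).
Proof.
elim: u => [|i u IH].
  split => [|A cA]; rewrite /weight big_nil // mul1r.
  by apply: (le_mass (@word_preimage_closed [::] A cA) cA) => x [_ h]; exact: h.
have -> : weight (i :: u) = p i * weight u by rewrite /weight big_cons.
apply: (@admissible_cat [:: i]) => //; split => [|A cA]; first exact: hp.1.
rewrite [leRHS]mass_self_conformal // (bigD1 i) //= lerDl.
by apply: sumr_ge0 => j _; rewrite mulr_ge0 ?mass_ge0 //; apply: hp.1.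
Qed.

Lemma admissible_mass u b (A : set 'rV[R]_d) : admissible u b -> closed A ->
  (forall x, K x -> A (T u x)) -> b <= mass A.
Proof.
move=> [b0 hb] cA KA; apply: le_trans (hb A cA).
rewrite mass_contains ?mulr1 //; first exact: word_preimage_closed.
by move=> x Kx; split; [exact: attractor_sub|exact: KA].
Qed.

Lemma admissible_le1 u b : admissible u b -> b <= 1.
Proof.
move=> hb; have [cX _ _] := hS.
have cX' : closed X by apply: compact_closed => //; exact: norm_hausdorff.
apply: le_trans (mass_le1 cX'); apply: admissible_mass hb cX' _ => x Kx.
by apply: word_domain; apply: attractor_sub.
Qed.

Lemma weight_lower : exists2 a : R, 0 < a <= 1 &
  forall u, 0 < weight u -> a ^+ size u <= weight u.
Proof.
pose a := \big[Num.min/1]_(i < l | 0 < p i) p i.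
have a0 : 0 < a.
  by rewrite /a; elim/big_ind: _ => // x y x0 y0; rewrite lt_min x0.
have a1 : a <= 1 by apply: bigmin_le_id.
exists a; first by rewrite a0.
elim=> [|i u IH]; first by rewrite /weight big_nil.
rewrite /weight big_cons => h.
have pi0 : 0 < p i.
  rewrite lt_def hp.1 andbT; apply/eqP => e; by rewrite e mul0r ltxx in h.
rewrite exprS; apply: ler_pM; [exact: ltW|by apply: exprn_ge0; apply: ltW| |].
  exact: bigmin_le_cond.
by apply: IH; move: h; rewrite pmulr_rgt0.
Qed.

Lemma positive_letter : exists i, 0 < p i.
Proof.
apply: contrapT => h; have [_] := hp; rewrite big1 => [/eqP|i _].
  by rewrite eq_sym oner_eq0.
apply/eqP; rewrite eq_le hp.1 andbT leNgt; apply/negP => pi0.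
by apply: h; exists i.
Qed.

(** Self-conformality is iterated along each word just until it reaches level [L]; this stops at a
    bounded length because the level grows at least linearly with the length. *)
Lemma section_decomposition L : lev [::] < L -> exists s : seq (seq 'I_l),
  (forall w, w \in s -> section L w) /\
  (forall A : set 'rV[R]_d, closed A ->
    mass A = \sum_(w <- s) weight w * mass (X `&` T w @^-1` A)).
Proof.
move=> hL; have [k [c [k0 c0 hk]]] := size_le_lev.
(* [u] has been read already, [w] is still to come, and [n] bounds the number of letters left. The
   level is that of [u ++ w], while the weight and the preimage concern [w] alone. *)
suff main n u : lev u < L -> (forall w, (size u + n <= size w)%N -> L <= lev w) ->
    exists s : seq (seq 'I_l), (forall w, w \in s -> section L (u ++ w)) /\
  (forall A : set 'rV[R]_d, closed A ->
    mass A = \sum_(w <- s) weight w * mass (X `&` T w @^-1` A)).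
  apply: (main (Num.bound (k * (`|L| + c))) [::]) => // w hw.
  rewrite leNgt; apply/negP => h.
  have h1 : 0 <= k * (`|L| + c) by rewrite mulr_ge0 ?addr_ge0 // ltW.
  have := archi_boundP h1; have : k * (lev w + c) < k * (`|L| + c).
    by rewrite ltr_pM2l // ltrD2r; apply: lt_le_trans h (ler_norm _).
  move: hw; rewrite add0n -(@ler_nat R) => hw; have := hk w; lra.
elim: n u => [|n IH] u hu hn.
  by have := hn u; rewrite addn0 leqnn => /(_ isT); rewrite leNgt hu.
(* When the letter completes the word the suffix is empty and its term is the mass of [X & A], which
   is that of [A] only for [A] inside [X]. *)
have step i : exists s : seq (seq 'I_l),
    (forall w, w \in s -> section L (u ++ i :: w)) /\
    (forall A : set 'rV[R]_d, closed A -> A `<=` X ->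
    mass A = \sum_(w <- s) weight w * mass (X `&` T w @^-1` A)).
  have [h|h] := ltP (lev (rcons u i)) L.
    have [w|s [s1 s2]] := IH (rcons u i) h.
      by rewrite size_rcons addSnnS; apply: hn.
    by exists s; split => [w /s1|A cA _]; [rewrite cat_rcons|exact: s2].
  exists [:: [::]]; split => [w|A cA AX].
    rewrite inE => /eqP ->; rewrite cats1; split => //; first by case: (u).
    by rewrite drop_last_rcons.
  rewrite big_seq1 /weight big_nil mul1r; congr mass.
  by apply/seteqP; split => x => [Ax|[]//]; split => //; apply: AX.
have [s hs] := fin_all_exists step.
exists (flatten [seq [seq i :: w | w <- s i] | i <- enum 'I_l]); split.
  by move=> w /flatten_mapP[i _ /mapP[v vs ->]]; exact: (hs i).1.
move=> A cA; rewrite mass_self_conformal // big_flatten /= big_map big_enum /=.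
apply: eq_bigr => i _; rewrite big_map (hs i).2 ?mulr_sumr; last by move=> x [].
  apply: eq_bigr => w _; rewrite /weight big_cons mulrA; congr (_ * mass _).
  exact: (@preimage_cat [:: i]).
exact: map_preimage_closed.
Qed.

Lemma uniq_size_card (T' : eqType) (r : seq T') (A : set T') n :
  uniq r -> (forall x : T', x \in r -> A x) -> (A #<= `I_n)%card -> (size r <= n)%N.
Proof.
case: r => [//|x0 r']; set r := x0 :: r' => ur rA An.
rewrite -card_le_II; apply: card_le_trans An.
have inj : {in `I_(size r) &, injective (nth x0 r)}.
  move=> i j; rewrite !inE => hi hj /eqP; rewrite nth_uniq // => /eqP //.
have : (nth x0 r @` `I_(size r) #= `I_(size r))%card by apply: inj_card_eq.
rewrite card_eq_le => /andP[_ h]; apply: card_le_trans h _.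
by apply: subset_card_le => _ [i hi <-]; apply: rA; apply: mem_nth.
Qed.

Lemma sum_undup_map (T1 T2 : eqType) (F : T1 -> T2) (s : seq T1) (g : T1 -> R) :
  \sum_(w <- s) g w = \sum_(f <- undup (map F s)) \sum_(w <- s | F w == f) g w.
Proof.
under [RHS]eq_bigr do rewrite big_mkcond.
rewrite exchange_big /= big_seq [RHS]big_seq; apply: eq_bigr => w ws.
rewrite (bigD1_seq (F w)) ?undup_uniq ?mem_undup ?map_f //= eqxx big1 ?addr0 // => f.
by rewrite eq_sym => /negPf ->.
Qed.

(** * Local decompositions into few maps *)

Hypothesis hAWSC : AWSC X S K.

Local Tactic Notation "lra" "using" hyp_list(h) :=
  revert h; clear -hS hK nondegenerate hp hnu hAWSC; intros; lra.

Definition rad n : R := expR (- (n%:R * ln 2)).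

Lemma rad_pow n : rad n = 2 ^- n.
Proof. by rewrite /rad expRN expRM_natl lnK // posrE. Qed.

Lemma word_eq_preimage u v (A : set 'rV[R]_d) : T u \_ X = T v \_ X ->
  X `&` T u @^-1` A = X `&` T v @^-1` A.
Proof.
move=> e; apply/seteqP; split => x [Xx h]; split => //; move: h;
  by have := congr1 (@^~ x) e; rewrite /= !patchE mem_set // /preimage /= => ->.
Qed.

(** A point within two mesh widths of [x] lies in one of the [7 ^ d] dyadic cubes whose index
    differs from that of [x] by at most 3 in each coordinate. *)
Lemma int_offset (a b : int) : (b < a + 3 + 1 -> a - 3 - 1 < b ->
  exists c : 'I_7, a - 3 + (c : nat)%:Z = b)%R.
Proof.
move=> h1 h2; have lt7 : (absz (b - a + 3)%R < 7)%N by lia.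
by exists (Ordinal lt7); rewrite /=; lia.
Qed.

(** The words of the section whose cylinders meet the ball are grouped by the map they define. One
    representative per map receives the total weight of its group, which is admissible because all
    the words of a group have the same preimages. *)
Lemma AWSC_bound : exists t : nat -> nat,
  ((ln (t n)%:R / n%:R : R) @[n --> \oo] --> (0 : R)) /\
  forall n x, lev [::] < n%:R * ln 2 -> exists s : seq (seq 'I_l * R),
  [/\ (size s <= t n)%N,
     forall vP, vP \in s -> [/\ section (n%:R * ln 2) vP.1, admissible vP.1 vP.2
        & exists2 y, K y & cball x (2 * rad n) (T vP.1 y)] &
     forall A : set 'rV[R]_d, closed A -> A `<=` cball x (2 * rad n) ->
       mass A <= \sum_(vP <- s) vP.2 * mass (X `&` T vP.1 @^-1` A)].
Proof.
have [t0 [t00 ht0 hcard]] := hAWSC.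
pose M := #|{: {ffun 'I_d -> 'I_7}}|.
have M0 : (0 < M)%N by apply/card_gt0P; exists [ffun=> ord0].
exists (fun n => M * t0 n)%N; split.
  have lim : (ln M%:R / n%:R + ln (t0 n)%:R / n%:R : R) @[n --> \oo] --> (0 + 0 : R).
    apply: cvgD => //.
    have lM : 0 <= ln (M%:R : R) by rewrite ln_ge0 // ler1n.
    apply/cvgrPdist_le => e e0; near=> n.
    have n0 : (0 < n)%N by near: n; exists 1%N.
    rewrite sub0r normrN ger0_norm ?divr_ge0 // ler_pdivrMr ?ltr0n // mulrC -ler_pdivrMr //.
    apply: ltW; apply: lt_le_trans (archi_boundP (divr_ge0 lM (ltW e0))) _.
    by rewrite ler_nat; near: n; exact: nbhs_infty_ge.
  rewrite addr0 in lim; apply: cvg_trans lim; apply: near_eq_cvg; near=> n.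
  by rewrite natrM lnM ?posrE ?ltr0n // mulrDl.
move=> n x hn; have [s0 [hs0 ms0]] := section_decomposition hn.
pose s1 := [seq w <- s0 | `[< exists2 y, K y & cball x (2 * rad n) (T w y) >]].
pose F w := T w \_ X.
pose D := undup (map F s1).
pose rep f := head [::] [seq w <- s1 | F w == f].
pose P f := \sum_(w <- s1 | F w == f) weight w.
have repP f : f \in D -> rep f \in s1 /\ F (rep f) = f.
  rewrite mem_undup => /mapP[w ws ->].
  have : w \in [seq w' <- s1 | F w' == F w] by rewrite mem_filter eqxx.
  rewrite /rep; case E : [seq _ <- _ | _] => [//|a s'] _ /=.
  have : a \in [seq w' <- s1 | F w' == F w] by rewrite E mem_head.
  by rewrite mem_filter => /andP[/eqP].
have preE f w (A : set 'rV[R]_d) : f \in D -> F w == f ->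
    X `&` T w @^-1` A = X `&` T (rep f) @^-1` A.
  by move=> /repP[_ e] /eqP e'; apply: word_eq_preimage; rewrite -/(F w) e'.
have sumE f (A : set 'rV[R]_d) : f \in D ->
    P f * mass (X `&` T (rep f) @^-1` A) =
    \sum_(w <- s1 | F w == f) weight w * mass (X `&` T w @^-1` A).
  by move=> fD; rewrite mulr_suml; apply: eq_bigr => w e; rewrite (preE f).
have mS (w : seq 'I_l) (A : set 'rV[R]_d) : 0 <= weight w * mass (X `&` T w @^-1` A).
  by rewrite mulr_ge0 ?mass_ge0 ?weight_ge0.
exists [seq (rep f, P f) | f <- D]; split.
- rewrite size_map.
  pose Q (c : {ffun 'I_d -> 'I_7}) : set 'rV[R]_d := [set y | forall i,
    (Num.Def.floor (x ord0 i / 2 ^- n) - 3 + (c i : nat)%:Z)%:~R * 2 ^- n <= y ord0 i <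
    (Num.Def.floor (x ord0 i / 2 ^- n) - 3 + (c i : nat)%:Z)%:~R * 2 ^- n + 2 ^- n].
  pose A c := [set word_map S u \_ X | u in
             scale_words S K n `&` [set u | (word_map S u @` K) `&` Q c !=set0]].
  have hA c : (A c #<= `I_(t0 n))%card.
    apply: hcard; exists (\row_i (Num.Def.floor (x ord0 i / 2 ^- n) - 3 + (c i : nat)%:Z)) => //.
    by apply/seteqP; split => y h i; have := h i; rewrite mxE.
  have DA f : f \in D -> exists c, A c f.
    move=> /repP[]; rewrite mem_filter => /andP[/asboolP[y Ky hy] /hs0 hsec e].
    have hc i : exists c : 'I_7,
       (Num.Def.floor (x ord0 i / 2 ^- n) - 3 + (c : nat)%:Z)%:~R * 2 ^- n <= T (rep f) y ord0 i <
       (Num.Def.floor (x ord0 i / 2 ^- n) - 3 + (c : nat)%:Z)%:~R * 2 ^- n + 2 ^- n.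
      have r0 : 0 < 2 ^- n :> R by rewrite invr_gt0 exprn_gt0.
      set a := Num.Def.floor _; set b := T (rep f) y ord0 i.
      pose a' := Num.Def.floor (b / 2 ^- n).
      have /andP[a1 a2] := floor_itv (x ord0 i / 2 ^- n).
      have /andP[b1 b2] := floor_itv (b / 2 ^- n).
      have hb : `|b - x ord0 i| <= 2 * 2 ^- n.
        have := hy; rewrite /cball /= rad_pow => hy'; apply: le_trans hy'.
        by have := coord_le_enorm (T (rep f) y - x) i; rewrite !mxE.
      move: hb; rewrite ler_norml => /andP[d1 d2].
      have d3 : b / 2 ^- n - x ord0 i / 2 ^- n <= 2 by rewrite -mulrBl ler_pdivrMr.
      have d4 : - 2 <= b / 2 ^- n - x ord0 i / 2 ^- n.
        by rewrite -mulrBl ler_pdivlMr // mulNr.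
      rewrite -/a in a1 a2; rewrite -/a' in b1 b2; rewrite !intrD in a2 b2.
      have e1 : (a' < a + 3 + 1)%R by rewrite -(ltr_int R) !intrD; lra.
      have e2 : (a - 3 - 1 < a')%R by rewrite -(ltr_int R) !(intrD, intrB); lra.
      have [c' c'E] := int_offset e1 e2; exists c'; rewrite c'E.
      by move: b1 b2; rewrite ler_pdivlMr // ltr_pdivrMr // mulrDl mul1r => -> ->.
    have [c hc'] := fin_all_exists hc; exists (finfun c).
    exists (rep f) => //; split; first by rewrite scale_wordsE.
    exists (T (rep f) y); split; first by exists y.
    by move=> i; rewrite ffunE; exact: hc'.
  have le1 : (size D <= \sum_(c : {ffun 'I_d -> 'I_7}) size [seq f <- D | `[< A c f >]])%N.
    rewrite -sum1_size; under [leqRHS]eq_bigr do rewrite size_filter -sum1_count big_mkcond /=.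
    rewrite exchange_big /= big_seq [leqRHS]big_seq; apply: leq_sum => f fD.
    have [c hc] := DA f fD; rewrite (bigD1 c) //= asboolT //.
  apply: leq_trans le1 _; rewrite /M -sum_nat_const; apply: leq_sum => c _.
  apply: uniq_size_card (hA c); first by rewrite filter_uniq // undup_uniq.
  by move=> f; rewrite mem_filter => /andP[/asboolP].
- move=> _ /mapP[f fD ->] /=; have [rs _] := repP f fD.
  move: rs; rewrite mem_filter => /andP[/asboolP hy /hs0 hsec]; split => //.
  split; first by apply: sumr_ge0 => w _; apply: weight_ge0.
  move=> A cA; rewrite sumE // (ms0 A cA) /s1 big_filter_cond big_mkcond /=.
  by apply: ler_sum => w _; case: ifP.
- move=> A cA Ax; rewrite big_map (eq_big_seq (fun f => \sum_(w <- s1 | F w == f) weight w * mass (X `&` T w @^-1` A))); last by move=> f fD; rewrite sumE.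
  rewrite -sum_undup_map (ms0 A cA) /s1 big_filter big_mkcond [leRHS]big_mkcond /=.
  apply: ler_sum => w _; case: asboolP => // h.
  (* A discarded word has a cylinder that misses the ball, so its preimage of [A] misses [K] and has
     no mass. *)
  rewrite le_eqVlt mulf_eq0; apply/orP; left; apply/orP; right.
  apply/eqP/le_anti; rewrite mass_ge0 andbT leNgt; apply/negP.
  move=> /(mass_meets (@word_preimage_closed w A cA))[y Ky [_ Ay]].
  by apply: h; exists y => //; apply: Ax.
Unshelve. all: by end_near. Qed.

Lemma sum_pigeonhole (I : eqType) (s : seq I) (g : I -> R) (m N : R) : 0 < m ->
  (size s)%:R <= N -> m <= \sum_(i <- s) g i -> exists2 i, i \in s & m / N <= g i.
Proof.
move=> m0 sN hm; apply: contrapT => h.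
have lt i : i \in s -> g i <= m / N.
  by move=> si; rewrite leNgt; apply/negP => hi; apply: h; exists i => //; apply: ltW.
have N0 : 0 < N.
  apply: lt_le_trans sN; rewrite ltr0n; case: (s) hm => // hm.
  by move: hm; rewrite big_nil leNgt m0.
case: s h lt sN hm => [|a s'] h lt sN hm; first by move: hm; rewrite big_nil leNgt m0.
have lta : g a < m / N.
  by rewrite ltNge; apply/negP => hi; apply: h; exists a => //; rewrite mem_head.
move: hm; rewrite big_cons; apply/negP; rewrite -ltNge.
have : \sum_(j <- s') g j <= \sum_(j <- s') m / N.
  rewrite big_seq [leRHS]big_seq; apply: ler_sum => j js.
  by apply: lt; rewrite inE js orbT.
rewrite big_const_seq count_predT iter_addr_0 => h2.
have h3 : m / N *+ (size s').+1 <= m.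
  by rewrite -mulr_natr -mulrAC ler_pdivrMr // ler_wpM2l // ltW.
by move: h3; rewrite mulrS; lra.
Qed.

(** One parameter for all the error terms of a proof: alone or multiplied by either exponent it uses
    an eighth of the budget [e]. *)
Lemma small_eps (e a s : R) : 0 < e -> exists e1 : R,
  [/\ 0 < e1, e1 <= 1, e1 <= e / 8, e1 * `|a| <= e / 8 & e1 * `|s| <= e / 8].
Proof.
move=> e0; pose B := 1 + `|a| + `|s| + e / 8.
have a0 := normr_ge0 a; have s0 := normr_ge0 s.
have B0 : 0 < B by rewrite /B; lra.
exists (e / 8 / B); split; first by rewrite !divr_gt0.
- by rewrite ler_pdivrMr // mul1r /B; lra.
- by rewrite ler_pdivrMr // ler_peMr /B; lra.
- by rewrite mulrAC ler_pdivrMr // ler_wpM2l /B; lra.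
- by rewrite mulrAC ler_pdivrMr // ler_wpM2l /B; lra.
Qed.

(** Rounding [r / ln 2] down to an integer changes the scale by a factor at most 2, whence [r - 1]
    and the radius [4 * expR (- r)]. The lower bound on [r] makes the subexponential count at most
    [expR (e * r)]. *)
Lemma AWSC_scale (e : R) : 0 < e -> exists L0 : R, forall r x, L0 <= r ->
  exists s : seq (seq 'I_l * R),
  [/\ (size s)%:R <= expR (e * r),
     forall vP, vP \in s -> [/\ r - 1 <= lev vP.1 <= r + e * r, admissible vP.1 vP.2
        & exists2 y, K y & cball x (4 * expR (- r)) (T vP.1 y)] &
     forall A : set 'rV[R]_d, closed A -> A `<=` cball x (2 * expR (- r)) ->
       mass A <= \sum_(vP <- s) vP.2 * mass (X `&` T vP.1 @^-1` A)].
Proof.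
move=> e0; have [t [lim_t ht]] := AWSC_bound.
have e2 : 0 < e / 2 by rewrite divr_gt0.
have [C C0 hC] := section_lev e2.
have l0 : 0 < ln 2 :> R by rewrite ln_gt0 // ltr1n.
have l1 : ln 2 <= 1 :> R.
  by rewrite -ler_expR lnK ?posrE // (le_trans _ (expR_ge1Dx _)) //; lra.
have el0 : 0 < e * ln 2 by rewrite mulr_gt0.
have : \forall n \near \oo, (n > 0)%N /\ (ln (t n)%:R / n%:R : R) <= e * ln 2.
  apply: filterI; first by exists 1%N.
  move: lim_t => /cvgrPdist_le/(_ _ el0); apply: filterS => n.
  by rewrite sub0r normrN; apply: le_trans; apply: ler_norm.
move=> [n0 _ hn0].
exists (`|lev [::]| + n0%:R + 2 * C / e + 2) => r x hr.
have Ce : 0 <= 2 * C / e by rewrite divr_ge0 ?mulr_ge0 // ltW.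
have n00 : 0 <= n0%:R :> R by [].
have lv := ler_norm (lev [::]); have lv' := normr_ge0 (lev [::]).
have r0 : 0 <= r / ln 2 by rewrite divr_ge0 //; lra using l0 hr Ce n00 lv'.
pose n := Num.truncn (r / ln 2).
have /andP[n1 n2] : n%:R * ln 2 <= r < n%:R * ln 2 + ln 2.
  have := truncn_itv r0; rewrite -/n => /andP[h1 h2].
  move: h1 h2; rewrite ler_pdivlMr // ltr_pdivrMr // => -> h2.
  by move: h2; rewrite -natr1 mulrDl mul1r.
have nn0 : (n0 <= n)%N.
  rewrite -(ler_nat R); apply: (@le_trans _ _ (r - 1)); first by lra using hr Ce lv'.
  have : n%:R * ln 2 <= n%:R :> R by rewrite ler_piMr.
  by lra using l1 n2.
have [n_gt0 tn] := hn0 n nn0.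
have hl : lev [::] < n%:R * ln 2 by lra using l1 hr Ce n00 lv n2.
have radE : rad n <= 2 * expR (- r).
  rewrite -{1}(@lnK _ 2) ?posrE // -expRD ler_expR; lra using n2.
have radE2 : expR (- r) <= rad n by rewrite ler_expR; lra using n1.
have [s [s1 s2 s3]] := ht n x hl; exists s; split.
- have [t0|tpos] := posnP (t n).
    by move: s1; rewrite t0 leqn0 => /eqP ->; apply: expR_ge0.
  apply: (@le_trans _ _ (t n)%:R); first by rewrite ler_nat.
  rewrite -[leLHS]lnK ?posrE ?ltr0n // ler_expR.
  move: tn; rewrite ler_pdivrMr ?ltr0n // => h; apply: le_trans h _.
  by rewrite -mulrA ler_pM2l // mulrC.
- move=> vP hvP; have [h1 h2 [y Ky hy]] := s2 vP hvP; split => //.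
    have /andP[h4 h3] := hC _ _ h1; apply/andP; split; first by lra using l1 n2 h4.
    apply: le_trans h3 _; have : e / 2 * (n%:R * ln 2) <= e / 2 * r by rewrite ler_pM2l.
    have : 2 * C / e <= r by lra using hr n00 lv'.
    by rewrite ler_pdivrMr // => ? ?; lra.
  exists y => //; apply: cballS hy; rewrite subrr enorm0 add0r.
  by rewrite (_ : 4 = 2 * 2) -?mulrA ?ler_pM2l //; lra.
- move=> A cA Ax; apply: s3 => //; apply: subset_trans Ax _.
  by apply: cballS; rewrite subrr enorm0 add0r ler_pM2l.
Qed.

(** * Separated systems of cylinders and their concatenation *)

(** The window for the levels is one-sided and separation is measured at [expR (- L)], so a system
    can be reread at a larger [L] at the price of a larger tolerance [E]. *)
Definition family (L E N b : R) := exists (I : finType) (g : I -> seq 'I_l),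
  [/\ N <= #|I|%:R, forall i, L - E <= lev (g i) <= L,
      forall i, admissible (g i) (expR (- b)) &
      forall i j y z, i != j -> K y -> K z -> expR (- L) <= enorm (T (g i) y - T (g j) z)].

Lemma family_le (L E N b L' E' N' b' : R) : family L E N b ->
  L <= L' -> L' - L + E <= E' -> N' <= N -> b <= b' -> family L' E' N' b'.
Proof.
move=> [I [g [h1 h2 h3 h4]]] hL hE hN hb; exists I, g; split.
- exact: le_trans h1.
- by move=> i; have /andP[? ?] := h2 i; apply/andP; split; lra.
- by move=> i; apply: admissible_le (h3 i); rewrite expR_ge0 ler_expR lerN2.
- move=> i j y z ij Ky Kz; apply: le_trans (h4 i j y z ij Ky Kz).
  by rewrite ler_expR lerN2.
Qed.

(** If the first words differ, the separation is inherited from the first system. If they agree,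
    their common map shrinks the separation of the second system by at most the distortion bound,
    which the shift [e * L1 + C] of the scale pays for. *)
Lemma family_cat (e C : R) (L1 E1 N1 b1 L2 E2 N2 b2 : R) : distortion_bound e C ->
  0 < e -> 0 <= e * L1 + C -> 0 <= L2 -> 0 <= N1 -> 0 <= N2 ->
  family L1 E1 N1 b1 -> family L2 E2 N2 b2 ->
  family (L1 + L2 + (e * L1 + C)) (E1 + E2 + 2 * (e * L1 + C)) (N1 * N2) (b1 + b2).
Proof.
move=> [C0 hp0 hd hc] e0 x0 L20 N10 N20 [I [g [h1 h2 h3 h4]]] [J [k [k1 k2 k3 k4]]].
have xi i : e * lev (g i) + C <= e * L1 + C.
  by rewrite lerD2r ler_pM2l //; have /andP[] := h2 i.
exists (I * J)%type, (fun ij => g ij.1 ++ k ij.2); split.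
- by rewrite card_prod natrM ler_pM.
- move=> [i j] /=; have := hc (g i) (k j); rewrite ler_norml => /andP[? ?].
  have /andP[? ?] := h2 i; have /andP[? ?] := k2 j; have ? := xi i.
  by apply/andP; split; lra.
- move=> [i j] /=; rewrite opprD expRD; exact: admissible_cat.
- move=> [i j] [i' j'] y z /= hij Ky Kz; rewrite !word_cat.
  have Ky' := word_attractor (k j) Ky; have Kz' := word_attractor (k j') Kz.
  have [e_i|ii] := eqVneq i i'.
    have jj : j != j' by apply: contraNN hij => /eqP ->; rewrite e_i.
    subst i'; have /andP[+ _] := hd (g i) _ _ Ky' Kz'; apply: le_trans.
    apply: le_trans (ler_wpM2l (expR_ge0 _) (k4 j j' y z jj Ky Kz)).
    rewrite -expRD ler_expR; have /andP[? ?] := h2 i; have ? := xi i; lra.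
  by apply: le_trans (h4 i i' _ _ ii Ky' Kz'); rewrite ler_expR; lra.
Qed.

(* The points [(a, s)] with arbitrarily fine systems of about [exp (L s)] well separated cylinders of
   size about [exp (- L)] that carry mass about [exp (- L a)] each: a coarse multifractal spectrum. *)
Definition realized (a s : R) := forall e L0 : R, 0 < e -> exists2 L, L0 <= L &
  family L (e * L) (expR (L * (s - e))) (L * (a + e)).

Lemma family_power (e C q E N b : R) n : distortion_bound e C -> 0 < e -> 0 <= q -> 0 <= E ->
  0 <= N -> family q E N b ->
  family (n.+1%:R * (q + (e * q + C))) (n.+1%:R * (E + 2 * (e * q + C))) (N ^+ n.+1)
    (n.+1%:R * b).
Proof.
move=> hd e0 l0 E0 N0 F; have [C0 _ _ _] := hd.
have x0 : 0 <= e * q + C by rewrite addr_ge0 ?mulr_ge0 // ltW.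
elim: n => [|n IH].
  by apply: family_le F _ _ _ _; rewrite ?expr1 ?mul1r //; lra.
have L0 : 0 <= n.+1%:R * (q + (e * q + C)) by rewrite mulr_ge0 // addr_ge0.
apply: family_le (family_cat hd e0 x0 L0 N0 (exprn_ge0 _ N0) F IH) _ _ _ _.
- by rewrite -[n.+2%:R]natr1; lra.
- by rewrite -[n.+2%:R]natr1; lra.
- by rewrite [leLHS]exprS.
- by rewrite -[n.+2%:R]natr1; lra.
Qed.

(** A system at one fine scale [q] is concatenated with itself until less than one more step is
    missing to reach [L]; that step is negligible against [L]. *)
Lemma realized_eventually (a s e : R) : realized a s -> 0 < e -> exists L0 : R,
  forall L, L0 <= L -> family L (e * L) (expR (L * (s - e))) (L * (a + e)).
Proof.
move=> ha e0; have [e1 [e10 e11 e18 e1a e1s]] := small_eps a s e0.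
have [C hd] := distortion e10; have [C0 _ _ _] := hd.
(* Beyond the scale [C / e1] the additive constant is absorbed, and one concatenation shifts the
   scale by [x <= 2 * (e1 * q)]. *)
have [q hl F] := ha e1 (1 + C / e1) e10.
have Ce1 : 0 <= C / e1 by rewrite divr_ge0 // ltW.
have l0 : 0 < q by lra.
have Cl : C <= e1 * q by rewrite mulrC -ler_pdivrMr //; lra.
pose x := e1 * q + C.
have el : 0 < e1 * q by rewrite mulr_gt0.
have x0 : 0 < x by rewrite addr_gt0.
have x2 : x <= 2 * (e1 * q) by rewrite /x; lra.
pose B := 1 + `|a| + `|s|.
have a0 := normr_ge0 a; have s0 := normr_ge0 s.
(* Chosen so that one step [q + x], even multiplied by the size [B] of the exponents, is at most
   [e * L / 8]. *)
exists ((q + x) * (1 + 8 * B / e)) => L hL.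
have lx0 : 0 < q + x by rewrite addr_gt0.
have B8 : 0 <= 8 * B / e by rewrite divr_ge0 ?mulr_ge0 ?(ltW e0) // /B; lra using a0 s0.
have L1 : q + x <= L.
  by apply: le_trans hL; rewrite ler_peMr; lra.
have Lg0 : 0 < L by lra using lx0 L1.
have lB : (q + x) * B <= e * L / 8.
  have h : (q + x) * (8 * B / e) <= L by apply: le_trans hL; rewrite ler_pM2l //; lra.
  have -> : (q + x) * B = (q + x) * (8 * B / e) * (e / 8) by field; rewrite lt0r_neq0.
  by rewrite (_ : e * L / 8 = L * (e / 8)) ?ler_pM2r ?divr_gt0 //; ring.
have [n [nL1 nL2]] : exists n, n.+1%:R * (q + x) <= L /\ L <= n.+1%:R * (q + x) + (q + x).
  have h0 : 0 <= L / (q + x) by rewrite divr_ge0 ?ltW.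
  have /andP[h1 h2] := truncn_itv h0.
  case E : (Num.truncn (L / (q + x))) h1 h2 => [|n] h1 h2.
    by move: h2; rewrite ltr_pdivrMr // mul1r ltNge L1.
  exists n; split; first by rewrite -ler_pdivlMr.
  by move: h2; rewrite ltr_pdivrMr // -[n.+2%:R]natr1 mulrDl mul1r => /ltW.
have F' := family_power n hd e10 (ltW l0) (ltW el) (expR_ge0 _) F.
rewrite -/x in F'; set m : R := n.+1%:R in F' nL1 nL2.
have m0 : 0 < m by [].
have mE : m * (q + x) = m * q + m * x by rewrite mulrDr.
have ml0 : 0 < m * q by rewrite mulr_gt0.
have mx : m * x <= 2 * e1 * (m * q).
  have := ler_wpM2l (ltW m0) x2; rewrite (_ : 2 * e1 * (m * q) = m * (2 * (e1 * q))) //; ring.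
have mx0 : 0 <= m * x by rewrite mulr_ge0 // ltW.
have mlL : m * q <= L by lra using nL1 mx0.
have eml : e1 * (m * q) <= e1 * L by rewrite ler_pM2l.
have eL : e1 * L <= e * L / 8 by rewrite mulrAC ler_pM2r.
have lxB : q + x <= (q + x) * B by rewrite ler_peMr /B; lra using l0 x0 a0 s0.
have dL : 0 <= L - m * q by lra using mlL.
have dL2 : L - m * q <= (q + x) + 2 * (e1 * L) by lra using nL2 mx eml.
have key (c : R) : `|c| <= `|a| \/ `|c| <= `|s| -> (L - m * q) * `|c| <= e * L * (3 / 8).
  move=> hc.
  have c0 := normr_ge0 c.
  have e1c : e1 * `|c| <= e / 8.
    by case: hc => /(ler_wpM2l (ltW e10)) h; apply: le_trans h _.
  have cB : `|c| <= B by rewrite /B; case: hc; lra using a0 s0.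
  have h1 := ler_wpM2r c0 dL2.
  have h2 : (q + x) * `|c| <= (q + x) * B by rewrite ler_pM2l.
  have h3 : e1 * `|c| * L <= e / 8 * L by rewrite ler_pM2r.
  by lra using lB h1 h2 h3.
apply: family_le F' _ _ _ _.
- exact: nL1.
- rewrite (_ : m * (e1 * q + 2 * x) = e1 * (m * q) + 2 * (m * x)); last by ring.
  by lra using lB nL1 eml eL lxB dL dL2.
- rewrite -expRM_natl -/m ler_expR.
  rewrite (_ : m * (q * (s - e1)) = L * s - (L - m * q) * s - e1 * (m * q)); last by ring.
  have := key s (or_intror (lexx _)).
  have := ler_wpM2l dL (ler_norm s); rewrite mulrBr; lra using mx mx0 eml eL.
- rewrite (_ : m * (q * (a + e1)) = L * a + (L - m * q) * (- a) + e1 * (m * q)); last by ring.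
  have := key a (or_introl (lexx _)).
  have := ler_wpM2l dL (ler_norm (- a)); rewrite normrN mulrDr; lra using mx mx0 eml eL.
Qed.

Lemma realized_le (a s a' s' : R) : realized a s -> a <= a' -> s' <= s -> realized a' s'.
Proof.
move=> h aa ss e L0 e0; have [L hL F] := h e (Num.max L0 0) e0.
move: hL; rewrite ge_max => /andP[hL L_0]; exists L => //.
apply: family_le F _ _ _ _; rewrite ?lexx // ?subrr ?add0r //.
  by rewrite ler_expR ler_wpM2l //; lra.
by rewrite ler_wpM2l //; lra.
Qed.

Lemma realized_closed (a s : R) : (forall e : R, 0 < e -> realized (a + e) (s - e)) -> realized a s.
Proof.
move=> h e L0 e0; have e2 : 0 < e / 2 by rewrite divr_gt0.
have [L hL F] := h _ e2 (e / 2) (Num.max L0 0) e2.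
move: hL; rewrite ge_max => /andP[hL L_0]; exists L => //.
apply: family_le F _ _ _ _; rewrite ?lexx //.
- by rewrite subrr add0r mulrC [leRHS]mulrC ler_wpM2l //; lra.
- by rewrite ler_expR ler_wpM2l //; lra.
- by rewrite ler_wpM2l //; lra.
Qed.

Lemma realized0 (a s : R) : realized a s -> realized a 0.
Proof.
move=> h e L0 e0; have [L hL [I [g [h1 h2 h3 h4]]]] := h e (Num.max L0 0) e0.
move: hL; rewrite ge_max => /andP[hL L_0]; exists L => //; exists I, g; split => //.
apply: (@le_trans _ _ 1).
  by rewrite -expR0 ler_expR sub0r mulrN oppr_le0 mulr_ge0 // ltW.
by rewrite ler1n -(ltr0n R); apply: lt_le_trans h1; apply: expR_gt0.
Qed.

(** Concatenate a system of scale [t * Z] with one of scale [(1 - t) * Z]: levels, logarithms of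
    counts and mass exponents all add up. *)
Lemma realized_convex (a1 s1 a2 s2 t : R) : realized a1 s1 -> realized a2 s2 ->
  0 <= t <= 1 -> realized (t * a1 + (1 - t) * a2) (t * s1 + (1 - t) * s2).
Proof.
move=> h1 h2 /andP[]; rewrite le_eqVlt => /orP[/eqP <- _|t0].
  by rewrite !mul0r !add0r subr0 !mul1r.
rewrite le_eqVlt => /orP[/eqP ->|t1]; first by rewrite subrr !mul0r !addr0 !mul1r.
set a := (X in realized X _); set s := (X in realized _ X).
move=> e L0 e0.
have [e1 [e10 e11 e18 e1a e1s]] := small_eps a s e0.
have [M1 F1] := realized_eventually h1 e10; have [M2 F2] := realized_eventually h2 e10.
have [C hd] := distortion e10; have [C0 _ _ _] := hd.
have t1' : 0 < 1 - t by rewrite subr_gt0.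
pose Z := `|L0| + `|M1| / t + `|M2| / (1 - t) + C / e1 + 1.
have q1 : 0 <= `|M1| / t by rewrite divr_ge0 // ltW.
have q2 : 0 <= `|M2| / (1 - t) by rewrite divr_ge0 // ltW.
have q3 : 0 <= C / e1 by rewrite divr_ge0 // ltW.
have q4 := normr_ge0 L0; have q5 := ler_norm L0.
have Z0 : 0 < Z by rewrite /Z; lra using q1 q2 q3 q4.
have {}F1 := F1 (t * Z) _; have {}F2 := F2 ((1 - t) * Z) _.
have Zt : M1 <= t * Z.
  by rewrite mulrC -ler_pdivrMr // (le_trans _ (_ : `|M1| / t <= Z)) ?ler_pM2r ?invr_gt0 ?ler_norm // /Z; lra using q2 q3 q4.
have Zt' : M2 <= (1 - t) * Z.
  by rewrite mulrC -ler_pdivrMr // (le_trans _ (_ : `|M2| / (1 - t) <= Z)) ?ler_pM2r ?invr_gt0 ?ler_norm // /Z; lra using q1 q3 q4.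
have CZ : C <= e1 * Z by rewrite mulrC -ler_pdivrMr // /Z; lra using q1 q2 q4.
set x := e1 * (t * Z) + C.
have tZ : t * Z <= Z by rewrite ger_pMl // ltW.
have x0 : 0 <= x by rewrite /x addr_ge0 ?ltW // !mulr_gt0.
have x2 : x <= 2 * (e1 * Z).
  have : e1 * (t * Z) <= e1 * Z by rewrite ler_pM2l.
  by rewrite /x; lra using CZ.
have tZ0 : 0 <= (1 - t) * Z by rewrite mulr_ge0 // ltW.
have F := family_cat hd e10 x0 tZ0 (expR_ge0 _) (expR_ge0 _) (F1 Zt) (F2 Zt').
rewrite -/x in F.
have kx (c : R) : e1 * `|c| <= e / 8 -> x * `|c| <= e * Z / 4.
  move=> hc; have := ler_wpM2r (normr_ge0 c) x2.
  have := ler_wpM2r (ltW Z0) hc; lra using.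
have e1Z : e1 * Z <= e * Z / 8 by rewrite mulrAC ler_pM2r.
have eZ : 0 < e * Z by rewrite mulr_gt0.
have ex : 0 <= e * x by rewrite mulr_ge0 // ltW.
exists (Z + x); first by rewrite /Z; lra using q1 q2 q3 q5 x0.
apply: family_le F _ _ _ _.
- lra using.
- lra using x2 e1Z eZ ex.
- rewrite -expRD ler_expR.
  have := kx s e1s; have := ler_wpM2l x0 (ler_norm s).
  rewrite (_ : t * Z * (s1 - e1) + (1 - t) * Z * (s2 - e1) = Z * s - e1 * Z); last by rewrite /s; ring.
  rewrite (_ : (Z + x) * (s - e) = Z * s - e * Z + x * s - e * x); last by ring.
  lra using e1Z eZ ex.
- have := kx a e1a; have := ler_wpM2l x0 (ler_norm (- a)); rewrite normrN.
  rewrite (_ : t * Z * (a1 + e1) + (1 - t) * Z * (a2 + e1) = Z * a + e1 * Z); last by rewrite /a; ring.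
  rewrite (_ : (Z + x) * (a + e) = Z * a + e * Z - x * (- a) + e * x); last by ring.
  lra.
Qed.

(** * Packings by balls and the sums defining the spectrum *)

Definition packing (r N m : R) := exists (I : finType) (x : I -> 'rV[R]_d),
  [/\ N <= #|I|%:R, forall i j, i != j -> 2 * r < enorm (x i - x j) &
      forall i, m <= mass (cball (x i) r)].

(** Near each ball there are at most [expR (e1 * r)] maps, so one of them is admissible with the
    mass of the ball up to that factor. Its cylinder may stick out of the ball, so the centres are
    thinned out beforehand. *)
Lemma realized_of_packings (a s : R) :
  (forall L0 : R, exists2 r, L0 <= r & packing (expR (- r)) (expR (r * s)) (expR (- (r * a)))) ->
  realized a s.
Proof.
move=> h e L0 e0.
have [e1 [e10 e11 e18 e1a e1s]] := small_eps a s e0.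
have [R0 hR0] := AWSC_scale e10.
(* A chosen cylinder stays within [(4 + expR 1) * expR (- r)] of its centre: 4 from the ball it
   meets, [expR 1] from its diameter. Centres [2 * (5 + expR 1) * expR (- r)] apart leave a gap. *)
have k0 : 0 < 5 + expR 1 :> R by rewrite addr_gt0 ?expR_gt0.
have [M M0 hM] := @separated_subset R d _ k0.
have [r hr [I [x [x1 x2 x3]]]] := h (`|L0| + `|R0| + 2 * `|ln M%:R| / e + 8 / e + 1).
have lM0 := normr_ge0 (ln M%:R : R); have lM1 := ler_norm (ln M%:R : R).
have l1 := normr_ge0 L0; have l2 := ler_norm L0; have l3 := normr_ge0 R0; have l4 := ler_norm R0.
have d1 : 0 <= 2 * `|ln M%:R| / e by rewrite divr_ge0 ?mulr_ge0 // ltW.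
have d2 : 0 <= 8 / e by rewrite divr_ge0 // ltW.
have r0 : 0 < r by lra using hr l1 l3 d1 d2.
have er8 : 8 <= e * r by rewrite mulrC -ler_pdivrMr //; lra using hr l1 l3 d1.
have erM : 2 * `|ln M%:R| <= e * r by rewrite [leRHS]mulrC -ler_pdivrMr //; lra using hr l1 l3 d2.
have rR : R0 <= r by lra using hr l1 l4 d1 d2.
have r2 : 0 < 2 * expR (- r) by rewrite mulr_gt0 ?expR_gt0.
have [A hA sA] := hM (2 * expR (- r)) I x r2 (fun i j ij => ltW (x2 i j ij)).
have pick i : exists v, [/\ r - 1 <= lev v <= r + e1 * r, admissible v (expR (- (r * (a + e1)))) &
    exists2 y, K y & cball (x i) (4 * expR (- r)) (T v y)].
  have [s0 [s1 s2 s3]] := hR0 r (x i) rR.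
  have cB : cball (x i) (expR (- r)) `<=` cball (x i) (2 * expR (- r)).
    by apply: cballS; rewrite subrr enorm0 add0r; have := expR_gt0 (- r); lra using.
  have hm := le_trans (x3 i) (s3 _ (@cball_closed _ _ _ _) cB).
  have [[v P] vs hv] := sum_pigeonhole (expR_gt0 _) s1 hm.
  have [/= v1 v2 v3] := s2 _ vs; exists v; split => //; have [P0 _] := v2.
  apply: admissible_le v2; rewrite expR_ge0 /=.
  have -> : expR (- (r * (a + e1))) = expR (- (r * a)) / expR (e1 * r).
    by rewrite -expRN -expRD; congr expR; ring.
  apply: le_trans hv _ => /=; apply: ler_piMr => //.
  by apply: mass_le1; apply: word_preimage_closed; apply: cball_closed.
have [v hv] := fin_all_exists pick.
pose L := r + e1 * r.
have er0 := mulr_gt0 e10 r0.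
exists L; first by rewrite /L; lra using hr l2 l3 d1 d2 er0.
exists {i : I | i \in A}, (fun i => v (val i)); split.
- rewrite card_sig; apply: (@le_trans _ _ (expR (r * s) / M%:R)); last first.
    rewrite ler_pdivrMr ?ltr0n // -natrM mulnC; apply: le_trans x1 _; rewrite ler_nat.
    by apply: leq_trans hA _; rewrite leq_mul2l; apply/orP; right; apply: eq_leq; apply: eq_card.
  have -> : expR (r * s) / M%:R = expR (r * s - ln M%:R).
    by rewrite expRB lnK // posrE ltr0n.
  rewrite ler_expR.
  have := ler_wpM2l (ltW (mulr_gt0 e10 r0)) (ler_norm s).
  have := ler_wpM2r (ltW r0) e1s; have := mulr_gt0 e10 r0; have := mulr_gt0 (mulr_gt0 e0 e10) r0.
  rewrite /L; lra using lM1 er8 erM.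
- move=> [i iA] /=; have [/andP[v1 v2] _ _] := hv i; rewrite v2 andbT.
  have := ler_wpM2r (ltW r0) e18; have : 0 <= e * (e1 * r) by rewrite !mulr_ge0 // ltW.
  by rewrite /L; lra using er8 v1.
- move=> [i iA] /=; have [_ v2 _] := hv i; apply: admissible_le v2.
  rewrite expR_ge0 ler_expR lerN2.
  have := ler_wpM2l (ltW (mulr_gt0 e10 r0)) (ler_norm (- a)); rewrite normrN.
  have := ler_wpM2r (ltW r0) e1a; have := ler_wpM2r (ltW r0) e18.
  have : 0 <= e * (e1 * r) by rewrite !mulr_ge0 // ltW.
  by rewrite /L; lra using er0.
- move=> [i iA] [j jA] y z /= ij Ky Kz.
  have {}ij : i != j by apply: contraNN ij => /eqP e2; apply/eqP/val_inj.
  have sep := sA i j iA jA ij.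
  have near_ i' (w : 'rV[R]_d) : K w -> enorm (T (v i') w - x i') <= (4 + expR 1) * expR (- r).
    move=> Kw; have [/andP[v1 _] _ [w' Kw' hw']] := hv i'.
    apply: le_trans (enorm_triangle (T (v i') w') _ _) _.
    rewrite mulrDl addrC; apply: lerD; first exact: hw'.
    apply: le_trans (word_dist_lev _ Kw Kw') _.
    by rewrite -expRD ler_expR; lra using v1.
  have n1 := near_ i y Ky; have n2 := near_ j z Kz.
  have t1 := enorm_triangle (T (v i) y) (x i) (x j).
  have t2 := enorm_triangle (T (v j) z) (T (v i) y) (x j).
  rewrite (enormB (x i) (T (v i) y)) in t1.
  apply: (@le_trans _ _ (expR (- r))).
    by rewrite ler_expR /L; have := mulr_gt0 e10 r0; lra using.
  have := expR_gt0 (- r).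
  move: n1 n2 t1 t2 sep; move: (expR 1) (expR (- r)) => c q n1 n2 t1 t2 sep q0.
  by lra using n1 n2 t1 t2 sep q0.
Qed.

Definition separated_in (I : finType) (x : I -> 'rV[R]_d) (r : R) :=
  (forall i, msupport nu (x i)) /\ (forall i j, i != j -> 2 * r < enorm (x i - x j)).

Lemma disjoint_balls x y (r : R) : 0 <= r ->
  cball x r `&` cball y r = set0 <-> 2 * r < enorm (x - y).
Proof.
move=> r0; split=> [h|h].
  rewrite ltNge; apply/negP => hle.
  have : (cball x r `&` cball y r) (2^-1 *: (x + y)).
    split; rewrite /cball /=.
      have -> : 2^-1 *: (x + y) - x = 2^-1 *: (y - x).
        by apply/rowP => i; rewrite !mxE; field.
      by rewrite enormZ gtr0_norm ?invr_gt0 // enormB ler_pdivrMl.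
    have -> : 2^-1 *: (x + y) - y = 2^-1 *: (x - y).
      by apply/rowP => i; rewrite !mxE; field.
    by rewrite enormZ gtr0_norm ?invr_gt0 // ler_pdivrMl.
  by rewrite h.
apply/seteqP; split => // z [h1 h2]; move: h; apply/negP; rewrite -leNgt.
apply: le_trans (enorm_triangle z _ _) _.
by rewrite mulr2n mulrDl mul1r (enormB x z); apply: lerD.
Qed.

Lemma ball_powE x (r q : R) : (nu (cball x r) `^ q)%E = (mass (cball x r) `^ q)%:E.
Proof.
by rewrite massE ?poweR_EFin //; apply: closed_measurable; apply: cball_closed.
Qed.

Lemma Lq_sum_ge (q r : R) (I : finType) (x : I -> 'rV[R]_d) : 0 <= r ->
  separated_in x r -> ((\sum_i mass (cball (x i) r) `^ q)%:E <= Lq_sum nu q r)%E.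
Proof.
move=> r0 [sx sep].
have xinj : injective x.
  move=> i j e; apply/eqP; apply: contraT => /sep.
  by rewrite e subrr enorm0 ltNge mulr_ge0.
apply: (@le_trans _ _ (\esum_(z in range x) nu (cball z r) `^ q)%E); last first.
  apply: ereal_sup_ubound; exists (range x) => //=; split.
    by move=> _ [i _ <-].
  apply/trivIsetP => _ _ [i _ <-] [j _ <-] ne; apply/disjoint_balls => //.
  by apply: sep; apply: contraNN ne => /eqP ->.
apply: esum_ge; exists [set` map x (enum I)].
  split; first exact/finite_seqP/(ex_intro _ (map x (enum I))).
  by move=> z /= /mapP[i _ ->]; exists i.
have u : uniq (map x (enum I)) by rewrite map_inj_uniq ?enum_uniq.
rewrite -fsbig_seq //; rewrite big_map big_enum /= -sumEFin.
by apply: lee_sum => i _; rewrite ball_powE.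
Qed.

(** A strict lower bound survives the passage from a possibly infinite packing to a finite part of
    it. *)
Lemma Lq_sum_gt (q r c : R) : 0 <= r -> (c%:E < Lq_sum nu q r)%E ->
  exists (I : finType) (x : I -> 'rV[R]_d), separated_in x r /\
    c < \sum_i mass (cball (x i) r) `^ q.
Proof.
move=> r0 /ereal_sup_gt[_ [D [sD tD] <-]] /ereal_sup_gt[_ [A [fA AD] <-]].
have /finite_seqP[s As] := fA.
have {}As : A = [set` undup s] by rewrite As; apply/seteqP; split => x /=; rewrite mem_undup.
rewrite As -fsbig_seq ?undup_uniq // => h.
pose x (i : 'I_(size (undup s))) : 'rV[R]_d := nth 0 (undup s) (i : nat).
exists 'I_(size (undup s)), x; split.
  have mA i : A (x i) by rewrite As /=; apply: mem_nth.
  split => [i|i j ij]; first by apply/sD/AD/mA.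
  apply/disjoint_balls => //; move/trivIsetP : tD; apply; [exact/AD/mA..|].
  by rewrite nth_uniq // undup_uniq.
move: h; rewrite (big_nth 0) big_mkord -lte_fin -sumEFin => h; apply: lt_le_trans h _.
rewrite le_eqVlt; apply/orP; left; apply/eqP; apply: eq_bigr => i _; exact: ball_powE.
Qed.

(** Division by [ln (expR (- r)) = - r] reverses the inequality. The conventions agree with this:
    the quotient is [+oo] for a sum equal to 0 and [-oo] for an infinite sum. *)
Lemma spectrum_quotient (q t r : R) : 0 < r ->
  ((lne (Lq_sum nu q (expR (- r))) / (ln (expR (- r)))%:E <= t%:E)%E <->
   ((expR (- (r * t)))%:E <= Lq_sum nu q (expR (- r)))%E).
Proof.
move=> r0; rewrite expRK inver oppr_eq0 gt_eqF //.
have S0 : (0 <= Lq_sum nu q (expR (- r)))%E.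
  apply: ereal_sup_ubound; exists set0 => /=; last by rewrite esum_set0.
  by split => // i; rewrite in_set0.
have ri : (- r)^-1 < 0 :> R by rewrite invrN oppr_lt0 invr_gt0.
move: S0; case: (Lq_sum nu q (expR (- r))) => [s| |] //; rewrite ?lee_fin => s0.
  have [->|sn0] := eqVneq s 0.
    rewrite le0_lneNy // mulNyr ltr0_sg // mulN1e leNgt ltry /= leNgt expR_gt0.
    by split.
  have sp : 0 < s by rewrite lt_def sn0.
  rewrite lne_EFin // -EFinM !lee_fin invrN mulrN -mulNr ler_pdivrMr //.
  rewrite -{2}(lnK sp) ler_expR; split; lra.
rewrite /lne leey; split => // _.
by rewrite mulyr ltr0_sg // mulN1e leNye.
Qed.

Lemma spectrum_lt (q t L0 : R) : (Lq_spectrum nu q < t%:E)%E ->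
  exists2 r, L0 <= r & ((expR (- (r * t)))%:E <= Lq_sum nu q (expR (- r)))%E.
Proof.
rewrite /Lq_spectrum /limf_einf lteNl => h.
(* The bound [2^-1] makes [ln r] negative, as [spectrum_quotient] requires. *)
pose V := [set r : R | 0 < r <= Num.min 2^-1 (expR (- L0))].
have m0 : 0 < Num.min 2^-1 (expR (- L0)) by rewrite lt_min invr_gt0 expR_gt0 andbT.
have FV : (0 : R)^'+ V.
  near=> r; rewrite /V /=; apply/andP; split; near: r; first exact: nbhs_right_gt.
  exact: nbhs_right_le.
have : (- t%:E < ereal_sup ((fun r => - (lne (Lq_sum nu q r) / (ln r)%:E))%E @` V))%E.
  by apply: lt_le_trans h _; apply: ereal_inf_lbound; exists V.
move=> /ereal_sup_gt[_ [r /= /andP[r0 hr] <-]] hlt.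
have {}hlt : (lne (Lq_sum nu q r) / (ln r)%:E < t%:E)%E by rewrite -lteN2.
move: hr; rewrite le_min => /andP[hr1 hr2].
have e : r = expR (- (- ln r)) by rewrite opprK lnK.
have l0 : 0 < - ln r.
  rewrite oppr_gt0; apply: ln_lt0; rewrite r0 /=; apply: le_lt_trans hr1 _.
  by rewrite invf_lt1 // ltr1n.
exists (- ln r); first by rewrite e ler_expR in hr2; lra.
by apply/(spectrum_quotient q t l0); rewrite -e ltW.
Unshelve. all: by end_near. Qed.

Lemma spectrum_le (q t : R) : (forall L0 : R, exists2 r, L0 <= r &
    ((expR (- (r * t)))%:E <= Lq_sum nu q (expR (- r)))%E) ->
  (Lq_spectrum nu q <= t%:E)%E.
Proof.
move=> h; rewrite /Lq_spectrum /limf_einf leeNl.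
apply: le_ereal_inf_tmp => _ [V FV <-].
move: FV => /nbhs_right0P[e /= e0 hV].
have [r hr hq] := h (`|ln (e / 2)| + 1).
have r0 : 0 < r by have := normr_ge0 (ln (e / 2)); lra.
have e2 : 0 < e / 2 by rewrite divr_gt0.
apply: le_ereal_sup_tmp; exists (- (lne (Lq_sum nu q (expR (- r))) / (ln (expR (- r)))%:E))%E.
  exists (expR (- r)) => //.
  rewrite -[expR _]add0r; apply: hV; last exact: expR_gt0.
  rewrite /ball_ /= sub0r normrN ger0_norm ?expR_ge0 //.
  apply: (@le_lt_trans _ _ (e / 2)); last by rewrite ltr_pdivrMr // ltr_pMr // ltr1n.
  rewrite -[leRHS]lnK ?posrE // ler_expR.
  by have := ler_norm (- ln (e / 2)); rewrite normrN; lra.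
by rewrite EFinN leeN2; apply/spectrum_quotient.
Qed.

Lemma spectrum_gt (q t : R) : (t%:E < Lq_spectrum nu q)%E -> exists L0 : R, forall r, L0 <= r ->
  (Lq_sum nu q (expR (- r)) <= (expR (- (r * t)))%:E)%E.
Proof.
move=> h; apply: contrapT => hn; move: h; apply/negP; rewrite -leNgt.
apply: spectrum_le => L0; apply: contrapT => h; apply: hn; exists L0 => r hr.
by rewrite leNgt; apply/negP => hlt; apply: h; exists r => //; apply: ltW.
Qed.

Lemma size_weight : exists c C : R, [/\ 0 < c, 0 < C &
  forall u, 0 < weight u -> expR (- (c * (lev u + C))) <= weight u].
Proof.
have [a /andP[a0 a1] ha] := weight_lower.
have [k [C [k0 C0 hk]]] := size_le_lev.
(* The summand 1 keeps the constant positive when [a = 1]. *)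
exists ((1 - ln a) * k), C; split => //.
  by rewrite mulr_gt0 // subr_gt0 (le_lt_trans _ ltr01) // ln_le0.
move=> u /ha; apply: le_trans.
have la : ln a <= 0 by apply: ln_le0.
rewrite -{2}(@lnK _ a) ?posrE // -expRM_natr ler_expR -mulrA.
have h0 : 0 <= k * (lev u + C) by apply: le_trans (hk u).
have := ler_wpM2l (_ : 0 <= - ln a) (hk u); rewrite oppr_ge0 => /(_ la).
by rewrite !mulNr mulrBl mul1r; lra.
Qed.

(** Words of nearly equal levels are brought to one section by repeating a letter of positive
    weight; the mass lost is exponential in the added level only. *)
Lemma extension : exists2 c : R, 0 < c & forall e, 0 < e -> exists2 C : R, 0 < C &
  forall L u, 0 <= L -> lev u < L -> exists v, section L (u ++ v) /\
    admissible v (expR (- (c * (L - lev u) + e * L + C))).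
Proof.
have [c [C0 [c0 C00 hc]]] := size_weight; exists c => // e e0.
have [i pi] := positive_letter.
have e1 : 0 < e / (2 * c) by rewrite divr_gt0 // mulr_gt0.
have [C1 hd] := distortion e1; have [C10 _ _ hcat] := hd.
have [C2 C20 hsec] := section_lev e1.
exists (c * (C1 + C2 + C0)); first by rewrite mulr_gt0 // !addr_gt0.
move=> L u L0 hu; have [m hm] := section_extend i hu.
exists (nseq m i); split => //; apply: admissible_le (admissible_weight _).
have w0 : 0 < weight (nseq m i).
  by elim: (m) => [|n IH]; rewrite /weight ?big_nil //= big_cons mulr_gt0.
rewrite expR_ge0 /=; apply: le_trans (hc _ w0); rewrite ler_expR lerN2.
have /andP[_ h1] := hsec _ _ hm; have := hcat u (nseq m i).
rewrite ler_norml => /andP[h2 _].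
have h3 : e / (2 * c) * lev u <= e / (2 * c) * L by rewrite ler_pM2l // ltW.
have h4 : c * (e / (2 * c) * L) = e * L / 2 by field; rewrite lt0r_neq0.
have : lev (nseq m i) + C0 <= L - lev u + 2 * (e / (2 * c) * L) + (C1 + C2 + C0) by lra.
move=> /(ler_wpM2l (ltW c0)); lra.
Qed.

(* [y] is a cluster point of the cylinders [iii...i] of a letter [i] of positive weight. *)
Lemma support_point : exists2 y, K y & forall u b, admissible u b -> 0 < b -> msupport nu (T u y).
Proof.
have [i pi] := positive_letter.
have w0 m : 0 < weight (nseq m i).
  by elim: m => [|n IH]; rewrite /weight ?big_nil //= big_cons mulr_gt0.
have [[z Kz] _ _ _] := hK.
have [c /andP[c0 c1] hc] := word_contraction.
have [D D1 hD] := attractor_bounded; have D0 : 0 < D by apply: lt_le_trans D1.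
pose f n := T (nseq n i) z.
have [y [Ky cy]] : K `&` cluster (f @ \oo) !=set0.
  by apply: attractor_compact; exists 0%N => // n _; apply: word_attractor.
exists y => // u b hb b0; apply: positive_support => r r0.
have r2 : 0 < r / 2 by rewrite divr_gt0.
have rD : 0 < r / 2 / D by rewrite divr_gt0.
have : c ^+ n @[n --> \oo] --> 0 by apply: cvg_expr; rewrite ger0_norm // ltW.
move=> /cvgrPdist_le/(_ _ rD)[N _ hN].
have [|_ [[n /= Nn <-] hy]] := cy (f @` [set n | (N <= n)%N]) _ _ (nbhs_cball y r2).
  by exists N => // n /= Nn; exists n.
apply: (@lt_le_trans _ _ (b * weight (nseq n i))); first by rewrite mulr_gt0.
apply: admissible_mass (admissible_cat hb (admissible_weight _)) (@cball_closed _ _ _ _) _.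
move=> x Kx; rewrite word_cat /cball /=.
have Xy := attractor_sub Ky.
have Xx : X (T (nseq n i) x) by apply: word_domain; apply: attractor_sub.
apply: le_trans (word_nonexpanding u Xx Xy) _.
apply: le_trans (enorm_triangle (f n) _ _) _; rewrite [leRHS](splitr r); apply: lerD; last exact: hy.
apply: le_trans (hc _ _ _ (attractor_sub Kx) (attractor_sub Kz)) _; rewrite size_nseq.
have := hN n Nn; rewrite /= sub0r normrN.
have cn : 0 <= c ^+ n by apply: exprn_ge0; apply: ltW.
rewrite (ger0_norm cn) (ler_pdivlMr _ _ D0); apply: le_trans.
by apply: ler_wpM2l => //; apply: hD.
Qed.

(** A word of positive weight has a cylinder that meets the ball of half the radius and is small
    enough to lie in the whole ball. *)
Lemma support_mass : exists A L0 : R, 0 <= A /\ forall r x, L0 <= r -> msupport nu x ->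
  expR (- (r * A)) <= mass (cball x (expR (- r))).
Proof.
have [c [C0 [c0 C00 hc]]] := size_weight.
have [C2 C20 hsec] := section_lev ltr01.
(* The section is cut at [r + 1], so a diameter is at most [expR (- r) / 2]. With error 1,
   [section_lev] bounds the level by [2 * (r + 1) + C2], and adding [C0] still leaves at most
   [3 * r]. *)
exists (3 * c), (`|lev [::]| + 2 + C2 + C0); split; first by rewrite mulr_ge0 // ltW.
move=> r x hr sx.
have hL : lev [::] < r + 1 by have := ler_norm (lev [::]); lra.
have [s [s1 s2]] := section_decomposition hL.
have q0 : 0 < expR (- r) / 2 by rewrite divr_gt0 ?expR_gt0.
have := mass_support sx q0; rewrite s2; last exact: cball_closed.
move=> h; have [w ws hw] : exists2 w, w \in s &
    0 < weight w * mass (X `&` T w @^-1` (cball x (expR (- r) / 2))).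
  apply: contrapT => hn; move: h; apply/negP; rewrite -leNgt big_seq.
  apply: sumr_le0 => w ws; rewrite leNgt; apply/negP => hw; apply: hn.
  by exists w.
have w0 : 0 < weight w.
  by rewrite lt_def weight_ge0 andbT; apply/eqP => e; rewrite e mul0r ltxx in hw.
have m0 : 0 < mass (X `&` T w @^-1` (cball x (expR (- r) / 2))) by move: hw; rewrite pmulr_rgt0.
have [y Ky [_ hy]] := mass_meets (@word_preimage_closed w _ (@cball_closed _ _ _ _)) m0.
have /andP[l1 l2] := hsec _ _ (s1 w ws).
apply: le_trans (_ : weight w <= _); last first.
  apply: admissible_mass (admissible_weight w) (@cball_closed _ _ _ _) _ => z Kz.
  rewrite /cball /=; apply: le_trans (enorm_triangle (T w y) _ _) _.
  rewrite [leRHS](splitr); apply: lerD; last exact: hy.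
  apply: le_trans (word_dist_lev _ Kz Ky) _.
  rewrite ler_pdivlMr //; apply: (@le_trans _ _ (expR (- lev w) * expR 1)).
    by rewrite ler_pM2l ?expR_gt0 //; have := expR_ge1Dx (1 : R); lra.
  by rewrite -expRD ler_expR; lra.
apply: le_trans (hc w w0); rewrite ler_expR lerN2.
rewrite (_ : r * (3 * c) = c * (3 * r)); last by ring.
by rewrite ler_pM2l //; have := normr_ge0 (lev [::]); lra.
Qed.

(** Each doubling of the separation keeps a proportion [M^-1] of the points; after [n] doublings the
    separation exceeds the diameter and one point is left. *)
Lemma card_separated_pow : exists2 M : nat, (0 < M)%N &
  forall n (r : R) (I : finType) (x : I -> 'rV[R]_d), 0 < r ->
    (forall i j, i != j -> r < enorm (x i - x j)) ->
    (forall i j, enorm (x i - x j) <= 2 ^+ n * r) -> (#|I| <= M ^ n)%N.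
Proof.
have [M M0 hM] := @separated_subset R d 2 (ltr0n _ 2); exists M => //.
elim=> [|n IH] r I x r0 sep near_.
  rewrite expn0; apply/card_le1P => i _ j; rewrite inE; apply/esym/eqP.
  apply/eqP; apply: contraT => ji; have := sep _ _ ji.
  by rewrite ltNge; have := near_ j i; rewrite expr0 mul1r => ->.
have [A hA sA] := hM r I x r0 (fun i j ij => ltW (sep i j ij)).
have r2 : 0 < 2 * r by rewrite mulr_gt0.
have := IH (2 * r) {i : I | i \in A} (fun i => x (val i)) r2 _ _.
rewrite card_sig => h; apply: leq_trans hA _; rewrite expnS leq_mul2l; apply/orP; right.
rewrite (_ : #|A| = #|[pred x0 | x0 \in A]|); last by apply: eq_card.
apply: h.
  by move=> [i iA] [j jA] /= ij; apply: sA.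
by move=> i j; rewrite mulrA -exprSr; apply: near_.
Qed.

Lemma packing_exponent : exists D L0 : R, 0 <= D /\ forall r (I : finType) (x : I -> 'rV[R]_d),
  L0 <= r -> (forall i, K (x i)) -> (forall i j, i != j -> expR (- r) < enorm (x i - x j)) ->
  #|I|%:R <= expR (r * D).
Proof.
have [M M0 hM] := card_separated_pow; have [D D1 hD] := attractor_bounded.
have D0 : 0 < D by apply: lt_le_trans D1.
have lM : 0 <= ln (M%:R : R) by rewrite ln_ge0 // ler1n.
have l2 : 0 < ln 2 :> R by rewrite ln_gt0 // ltr1n.
pose k := (ln 2)^-1 : R; have k0 : 0 < k by rewrite invr_gt0.
exists ((2 * k + 1) * ln M%:R), (ln D + 1).
have lD : 0 <= ln D by apply: ln_ge0.
split; first by rewrite mulr_ge0 // addr_ge0 // mulr_ge0 // ltW.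
move=> r I x hr xK sep.
have h0 : 0 <= (r + ln D) * k by rewrite mulr_ge0 ?(ltW k0) //; lra.
pose n := (Num.truncn ((r + ln D) * k)).+1.
have /andP[n1 n2] := truncn_itv h0.
have hn : (r + ln D) <= n%:R * ln 2.
  by move: n2; rewrite ltr_pdivrMr // => /ltW.
have := hM n _ I x (expR_gt0 (- r)) sep; rewrite -(ler_nat R) natrX => h.
have {}h : #|I|%:R <= M%:R ^+ n :> R.
  apply: h => i j; apply: le_trans (hD _ _ (xK i) (xK j)) _.
  rewrite -{1}(@lnK _ D) ?posrE // -{1}(@lnK _ 2) ?posrE // -expRM_natl -expRD ler_expR.
  by lra.
apply: le_trans h _; rewrite -{1}(@lnK _ M%:R) ?posrE ?ltr0n // -expRM_natl ler_expR mulrA.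
apply: ler_wpM2r => //; rewrite /n -natr1.
have : (r + ln D) * k <= 2 * r * k by rewrite ler_pM2r //; lra.
by lra.
Qed.

(** The words are extended to the section at [L + 2]: their cylinders then fit into balls of radius
    [expR (- (L + 2))], and these are disjoint because [2 < expR 2]. *)
Lemma packing_of_realized (a s e L0 : R) : realized a s -> 0 < e -> exists2 r, L0 <= r &
  exists (I : finType) (x : I -> 'rV[R]_d), [/\ separated_in x (expR (- r)),
    expR (r * (s - e)) <= #|I|%:R & forall i, expR (- (r * (a + e))) <= mass (cball (x i) (expR (- r)))].
Proof.
move=> ha e0; have [c c0 hext] := extension; have [y Ky hy] := support_point.
have [e1 [e10 e11 e18 e1a e1s]] := small_eps a s e0.
(* Extending a word from a level at least [L - e2 * L] up to [L + 2] costs [c * (e2 * L + 2)] in the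
   mass exponent, whence the division. *)
pose e2 := e1 / (c + 1).
have c1 : 0 < c + 1 by rewrite addr_gt0.
have e20 : 0 < e2 by rewrite divr_gt0.
have ce2 : c * e2 <= e1.
  by rewrite /e2 mulrCA ler_piMr ?(ltW e10) // ler_pdivrMr // mul1r; lra.
have e21 : e2 <= e1 by rewrite ler_pdivrMr // ler_peMr // ?(ltW e10) //; lra.
have [C C0 hC] := hext e1 e10.
pose B := 2 * c + 2 * e1 + C + 2 * `|s| + 2 * `|a| + 2.
have na := normr_ge0 a; have ns := normr_ge0 s.
have B0 : 0 < B by rewrite /B; lra using c1 e20 e21 C0 na ns.
have [L hL [I [g [g1 g2 g3 g4]]]] := ha e2 (`|L0| + 4 * B / e) e20.
have lL := ler_norm L0; have lL' := normr_ge0 L0.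
have Be : 0 < 4 * B / e by rewrite divr_gt0 // mulr_gt0.
have L_0 : 0 < L by lra using hL lL' Be.
have eB : 4 * B <= e * L by rewrite [leRHS]mulrC -ler_pdivrMr //; lra using hL lL'.
have ext i : exists v, section (L + 2) (g i ++ v) /\
    admissible v (expR (- (c * (L + 2 - lev (g i)) + e1 * (L + 2) + C))).
  by apply: hC; [lra|have /andP[_ h] := g2 i; lra].
have [v hv] := fin_all_exists ext.
have ad i := admissible_cat (g3 i) (hv i).2.
exists (L + 2); first by lra using hL lL Be.
exists I, (fun i => T (g i ++ v i) y); split.
- split => [i|i j ij].
    by apply: hy (ad i) _; rewrite mulr_gt0 ?expR_gt0.
  rewrite !word_cat; apply: lt_le_trans (g4 i j _ _ ij (word_attractor _ Ky) (word_attractor _ Ky)).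
  rewrite -(@ltr_pM2r _ (expR 2)) ?expR_gt0 // -mulrA -!expRD mulrC.
  rewrite (_ : - (L + 2) + 2 = - L) ?expRD ?ltr_pM2l ?expR_gt0 //; last by ring.
  by have := expR_ge1Dx (1 : R); nra.
- apply: le_trans g1; rewrite ler_expR.
  have := ler_norm s; have := ler_wpM2l (ltW L_0) e21; have := ler_wpM2r (ltW L_0) e18.
  by rewrite /B in eB; lra using e0 c0 e10 C0 na ns eB.
- move=> i; apply: le_trans (admissible_mass (ad i) (@cball_closed _ _ _ _) _); last first.
    move=> z Kz; apply: le_trans (word_dist_lev _ Kz Ky) _; rewrite ler_expR lerN2.
    by have [_ h _] := (hv i).1.
  rewrite -expRD ler_expR.
  have /andP[h1 h2] := g2 i.
  have h3 : c * (L + 2 - lev (g i)) <= c * (e2 * L + 2) by rewrite ler_pM2l //; lra using h1.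
  have h4 := ler_wpM2r (ltW L_0) ce2.
  have := ler_wpM2l (ltW L_0) e21; have := ler_wpM2r (ltW L_0) e18.
  have := ler_norm (- a); rewrite normrN /B in eB *.
  by lra.
Qed.

(** The packing contributes about [exp (r s)] terms of size at least [exp (- r q a)]; as masses are
    bounded from below only, this needs [0 <= q]. *)
Lemma spectrum_le_realized (a s q : R) : realized a s -> 0 <= q ->
  (Lq_spectrum nu q <= (q * a - s)%:E)%E.
Proof.
move=> ha q0; apply/lee_addgt0Pr => e e0; rewrite -EFinD; apply: spectrum_le => L0.
have q1 : 0 < q + 1 by lra.
have e1 : 0 < e / (q + 1) by rewrite divr_gt0.
have [r hr [I [x [sx cI hm]]]] := packing_of_realized (Num.max L0 0) ha e1.
move: hr; rewrite ge_max => /andP[hr r0]; exists r => //.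
apply: le_trans (Lq_sum_ge q (expR_ge0 _) sx); rewrite lee_fin.
apply: (@le_trans _ _ (\sum_(i : I) expR (- (r * (a + e / (q + 1)))) `^ q)); last first.
  by apply: ler_sum => i _; apply: ge0_ler_powR => //; rewrite ?nnegrE ?expR_ge0 ?mass_ge0.
rewrite sumr_const -mulr_natl /powR gt_eqF ?expR_gt0 // expRK.
apply: (@le_trans _ _ (expR (r * (s - e / (q + 1))) * expR (q * - (r * (a + e / (q + 1)))))).
  rewrite -expRD ler_expR.
  rewrite (_ : r * _ + _ = - (r * (q * a - s + e / (q + 1) * (q + 1)))); last by ring.
  by rewrite divfK // lt0r_neq0.
by rewrite ler_pM2r ?expR_gt0.
Qed.

(** The balls of a good packing are sorted by mass into finitely many classes, finitely many by
    [support_mass]. At arbitrarily fine scales one fixed class must carry a large share of the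
    sum. *)
Lemma realized_of_spectrum_lt (q t : R) : 0 <= q -> (Lq_spectrum nu q < t%:E)%E ->
  exists a s, realized a s /\ q * a - s <= t.
Proof.
move=> q0 hlt.
have [t0 ht0 t0t] : exists2 t0, (Lq_spectrum nu q < t0%:E)%E & t0 < t.
  move: hlt; case: (Lq_spectrum nu q) => [z| |] // h.
    by rewrite lte_fin in h; exists ((z + t) / 2); rewrite ?lte_fin; lra.
  by exists (t - 1); [exact: ltNyr|lra].
pose t' := (t0 + t) / 2; have t't : t' < t by rewrite /t'; lra.
have t0t' : t0 < t' by rewrite /t'; lra.
(* Class [k] consists of the mass exponents in [[e k, e (k + 1)]]. Reading [a] at the right end and
   [s] at the left end costs [q * e <= (t - t') / 2]. *)
pose e := (t - t') / (2 * (q + 1)).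
have q1 : 0 < q + 1 by lra.
have e0 : 0 < e by rewrite divr_gt0 ?mulr_gt0 // subr_gt0.
have [A [L0 [A0 hA]]] := support_mass.
pose B := Num.truncn (A / e).
pose P (k : 'I_B.+1) (r : R) := packing (expR (- r)) (expR (r * (q * (e * k%:R) - (t + t') / 2)))
   (expR (- (r * (e * k.+1%:R)))).
suff [k hk] : exists k, forall L, exists2 r, L <= r & P k r.
  exists (e * k.+1%:R), (q * (e * k%:R) - (t + t') / 2).
  split; first exact: realized_of_packings.
  have eq : q * e + e = (t - t') / 2.
    by rewrite /e; field; rewrite lt0r_neq0.
  by rewrite -natr1; lra.
apply: contrapT => hn.
have bad k : exists L, forall r, L <= r -> ~ P k r.
  apply: contrapT => h; apply: hn; exists k => L; apply: contrapT => h'.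
  by apply: h; exists L => r hr hP; apply: h'; exists r.
have [Lk hLk] := fin_all_exists bad.
pose M := \sum_k `|Lk k|.
have MLk k : Lk k <= M.
  by apply: le_trans (ler_norm _) _; rewrite /M (bigD1 k) //= lerDl sumr_ge0.
have M0 : 0 <= M by apply: sumr_ge0.
(* From this scale on the number of classes is at most [exp (r (t - t') / 2)]. *)
pose Z := 2 * ln (B.+1%:R : R) / (t - t').
have lB : 0 <= ln (B.+1%:R : R) by rewrite ln_ge0 // ler1n.
have tt : 0 < t - t' by rewrite subr_gt0.
have Z0 : 0 <= Z by rewrite divr_ge0 ?mulr_ge0 // ltW.
have [r hr hS'] := spectrum_lt (M + `|L0| + Z + 1) ht0.
have lL := ler_norm L0; have lL' := normr_ge0 L0.
have r0 : 0 < r by lra using M0 Z0 hr lL'.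
have hZ : 2 * ln (B.+1%:R : R) <= (t - t') * r.
  by rewrite [leRHS]mulrC -ler_pdivrMr // -/Z; lra using M0 hr lL'.
have {}hS' : ((expR (- (r * t')))%:E < Lq_sum nu q (expR (- r)))%E.
  by apply: lt_le_trans hS'; rewrite lte_fin ltr_expR ltrN2 ltr_pM2l.
have [I [x [[sx sep] hsum]]] := Lq_sum_gt (expR_ge0 _) hS'.
pose m i := mass (cball (x i) (expR (- r))).
have L0r : L0 <= r by lra using M0 Z0 hr lL.
have mA i : expR (- (r * A)) <= m i by apply: hA.
have m0 i : 0 < m i by apply: lt_le_trans (mA i); apply: expR_gt0.
have m1 i : m i <= 1 by apply: mass_le1; apply: cball_closed.
have er : 0 < e * r by rewrite mulr_gt0.
have lm0 i : 0 <= - ln (m i) / (e * r) by rewrite divr_ge0 ?oppr_ge0 ?ln_le0 // ltW.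
have lmA i : - ln (m i) / (e * r) <= A / e.
  rewrite ler_pdivrMr // mulrA divfK ?lt0r_neq0 // lerNl mulrC -ler_expR lnK ?posrE //.
have kB i : (Num.truncn (- ln (m i) / (e * r)) < B.+1)%N.
  by rewrite ltnS; apply: le_truncn.
pose k i : 'I_B.+1 := Ordinal (kB i).
have mk i : expR (- (r * (e * (k i).+1%:R))) <= m i <= expR (- (r * (e * (k i : nat)%:R))).
  have /andP[h1 h2] := truncn_itv (lm0 i).
  rewrite -{1 2}(lnK (m0 i : m i \in Num.pos)) !ler_expR.
  move: h1 h2; rewrite ler_pdivlMr // ltr_pdivrMr // /k /= => h1 h2.
  by apply/andP; split; lra using h1 h2.
pose N j := #|{: {i : I | k i == j}}|.
have NB j : (N j)%:R < expR (r * (q * (e * (j : nat)%:R) - (t + t') / 2)).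
  rewrite ltNge; apply/negP => hN; apply: (hLk j r); first by have := MLk j; lra using Z0 hr lL'.
  exists {i : I | k i == j}, (fun i => x (val i)); split => //.
    by move=> [i iA] [i' iA'] /= ij; apply: sep.
  by move=> [i /= /eqP <-]; have /andP[] := mk i.
have : \sum_i m i `^ q <= \sum_(j < B.+1) (N j)%:R * expR (- (r * (q * (e * (j : nat)%:R)))).
  rewrite (partition_big k xpredT) //=; apply: ler_sum => j _.
  rewrite /N card_sig -sum1_card natr_sum mulr_suml big_mkcond [leRHS]big_mkcond.
  apply: ler_sum => i _; rewrite !inE; case: eqP => // <-; rewrite mul1r.
  have /andP[_ h] := mk i.
  apply: le_trans (ge0_ler_powR q0 _ _ h) _; rewrite ?nnegrE ?expR_ge0 ?(ltW (m0 i)) //.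
  by rewrite /powR gt_eqF ?expR_gt0 // expRK ler_expR le_eqVlt; apply/orP; left; apply/eqP; ring.
move=> hle; have := lt_le_trans hsum hle; apply/negP; rewrite -leNgt.
apply: (@le_trans _ _ (\sum_(j < B.+1) expR (- (r * ((t + t') / 2))))).
  apply: ler_sum => j _; apply: le_trans (ler_wpM2r (expR_ge0 _) (ltW (NB j))) _.
  by rewrite -expRD ler_expR le_eqVlt; apply/orP; left; apply/eqP; ring.
rewrite sumr_const card_ord -[leLHS]mulr_natl -{1}(@lnK _ B.+1%:R) ?posrE // -expRD ler_expR.
by lra using hZ.
Qed.

(** * The range of the realized pairs and its duality with the spectrum *)

Lemma realized_ge0 (a s : R) : realized a s -> 0 <= a.
Proof.
move=> ha; rewrite leNgt; apply/negP => a0.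
have e0 : 0 < - a / 2 by lra.
have [L L1 [I [g [h1 _ h3 _]]]] := ha _ 1 e0.
have /card_gt0P[i _] : (0 < #|I|)%N by rewrite -(ltr0n R); apply: lt_le_trans h1; apply: expR_gt0.
have := admissible_le1 (h3 i); rewrite -{2}expR0 ler_expR lerNl oppr0 => h.
have : 0 < L * (- (a + - a / 2)) by rewrite mulr_gt0; lra.
lra.
Qed.

Lemma realized_bounded : exists D : R, forall a s, realized a s -> s <= D.
Proof.
have [D [L0 [D0 hD]]] := packing_exponent; exists (D + 1) => a s ha.
have [r hr [I [x [[sx sep] h1 _]]]] := packing_of_realized (`|L0| + 1) ha ltr01.
have lL := ler_norm L0; have lL' := normr_ge0 L0.
have r0 : 0 < r by lra.
have sepr i j : i != j -> expR (- r) < enorm (x i - x j).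
  by move=> /sep; have := expR_gt0 (- r); lra.
have := le_trans h1 (hD r I x _ (fun i => support_attractor (sx i)) sepr).
by rewrite ler_expR ler_pM2l // lerBlDr => -> //; lra.
Qed.

Lemma realized_nonempty : exists a, realized a 0.
Proof.
suff h : (Lq_spectrum nu 0 < 1%:E)%E.
  by have [a [s [ha _]]] := realized_of_spectrum_lt (lexx 0) h; exists a; apply: realized0 ha.
apply: (@le_lt_trans _ _ 0%:E); last by rewrite lte_fin ltr01.
apply: spectrum_le => L0; exists L0 => //; have [y Ky hy] := support_point.
have sy : msupport nu y.
  by apply: (hy [::] (weight [::])); [exact: admissible_weight|rewrite /weight big_nil].
have sep : separated_in (fun _ : 'I_1 => y) (expR (- L0)).
  by split => // i j; rewrite !ord1 eqxx.
apply: le_trans (Lq_sum_ge 0 (expR_ge0 _) sep).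
by rewrite big_ord_recl big_ord0 addr0 powRr0 mulr0 oppr0 expR0.
Qed.

Lemma spectrum_ge (q t : R) : 0 <= q -> (forall a s, realized a s -> t <= q * a - s) ->
  (t%:E <= Lq_spectrum nu q)%E.
Proof.
move=> q0 h; rewrite leNgt; apply/negP => hlt.
have [t' ht' t't] : exists2 t', (Lq_spectrum nu q < t'%:E)%E & t' < t.
  move: hlt; case: (Lq_spectrum nu q) => [z| |] // h'.
    by rewrite lte_fin in h'; exists ((z + t) / 2); rewrite ?lte_fin; lra.
  by exists (t - 1); [exact: ltNyr|lra].
have [a [s [ha hs]]] := realized_of_spectrum_lt q0 ht'.
by have := h a s ha; lra.
Qed.

Lemma spectrum_fin_num (q : R) : 0 <= q -> Lq_spectrum nu q \is a fin_num.
Proof.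
move=> q0; have [D hD] := realized_bounded; have [a ha] := realized_nonempty.
rewrite fin_numElt; apply/andP; split.
  apply: (@lt_le_trans _ _ (- D)%:E); first exact: ltNyr.
  apply: spectrum_ge => // a' s' h; have := hD _ _ h.
  have : 0 <= q * a' by rewrite mulr_ge0 // (realized_ge0 h).
  lra.
by apply: le_lt_trans (spectrum_le_realized ha q0) _; exact: ltry.
Qed.

(** With [D] bounding all realized [s] and [m] the least realized level, [q m - D <= tau(q) <= q m];
    hence the slope at infinity equals [m], which is itself realized by closedness. *)
Lemma realized_of_slope (alpha : R) : (Lq_slope_pinfty nu <= alpha%:E)%E -> realized alpha 0.
Proof.
have [D hD] := realized_bounded; have [a1 ha1] := realized_nonempty.
pose A := [set a | realized a 0].
have A0 : A !=set0 by exists a1.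
have lA : lbound A 0 by move=> a; apply: realized_ge0.
have iA : has_inf A by split => //; exists 0.
have rA : realized (inf A) 0.
  apply: realized_closed => e e0; have [b Ab hb] := inf_adherent e0 iA.
  by apply: realized_le Ab _ _; lra.
have low a s : realized a s -> inf A <= a.
  by move=> /realized0 h; apply: ge_inf => //; exists 0.
pose f q := fine (Lq_spectrum nu q).
have fE (q : R) : 0 <= q -> Lq_spectrum nu q = (f q)%:E.
  by move=> q0; rewrite fineK // spectrum_fin_num.
have lim : (Lq_spectrum nu q / q%:E)%E @[q --> (+oo : set_system R)] --> (inf A)%:E.
  have : (f q / q)%:E @[q --> (+oo : set_system R)] --> (inf A)%:E.
    apply/cvg_EFin; first by near=> q.
    apply/cvgrPdist_le => e e0; pose De : R := D / e; near=> q => /=.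
    have q0 : 0 < q by near: q; apply: nbhs_pinfty_gt; rewrite num_real.
    have up : f q <= q * inf A.
      have := spectrum_le_realized rA (ltW q0).
      by rewrite subr0 (fE q (ltW q0)) lee_fin.
    have lo : q * inf A - D <= f q.
      rewrite -lee_fin -(fE q (ltW q0)); apply: spectrum_ge; first exact: ltW.
      move=> a s h; have := hD _ _ h; have := low _ _ h.
      by move=> /(ler_wpM2l (ltW q0)); lra.
    have up' : f q / q <= inf A by rewrite ler_pdivrMr // mulrC.
    have Dq : D <= e * q.
      rewrite mulrC -ler_pdivrMr //.
    have lo' : inf A - e <= f q / q by rewrite ler_pdivlMr //; lra.
    by rewrite ler_norml; apply/andP; split; lra.
  apply: cvg_trans; apply: near_eq_cvg; near=> q.
  have q0 : 0 < q by near: q; apply: nbhs_pinfty_gt; rewrite num_real.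
  by rewrite (fE q (ltW q0)) inver gt_eqF.
rewrite /Lq_slope_pinfty (cvg_lim _ lim) //.
by rewrite lee_fin => h; apply: realized_le rA h _.
Unshelve. all: by end_near. Qed.

Lemma realized_sup (alpha : R) : realized alpha 0 -> exists s, [/\ 0 <= s, realized alpha s &
  forall s', realized alpha s' -> s' <= s].
Proof.
move=> h0; have [D hD] := realized_bounded.
pose A := [set s | realized alpha s].
have sA : has_sup A by split; [exists 0|exists D => s; apply: hD].
exists (sup A); split.
- by apply: ub_le_sup => //; case: sA.
- apply: realized_closed => e e0; have [s As hs] := sup_adherent e0 sA.
  by apply: realized_le As _ _; lra.
- by move=> s hs; apply: ub_le_sup => //; case: sA.
Qed.

(* A supergradient of the concave function [a |-> sup {s | realized a s}] just to the right of [alpha]. *)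
Lemma legendre_le_sup (alpha s : R) : realized alpha s -> (forall s', realized alpha s' -> s' <= s) ->
  0 <= s -> (Lq_legendre nu alpha <= s%:E)%E.
Proof.
move=> hs smax s0; rewrite leNgt; apply/negP => hlt.
have [s1 ss1 hs1] : exists2 s1, s < s1 & forall q, 0 <= q -> (Lq_spectrum nu q <= (alpha * q - s1)%:E)%E.
  have [s1 ss1 hs1] : exists2 s1, s < s1 & (s1%:E <= Lq_legendre nu alpha)%E.
    move: hlt; case: (Lq_legendre nu alpha) => [z| |] // h.
      by exists z; rewrite ?lexx.
    by exists (s + 1); [lra|exact: leey].
  exists s1 => // q q0.
  have : (s1%:E <= (alpha * q)%:E - Lq_spectrum nu q)%E.
    by apply: le_trans hs1 _; apply: ereal_inf_lbound; exists q.
  have := spectrum_fin_num q0; case: (Lq_spectrum nu q) => [z| |] // _.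
  by rewrite -EFinB !lee_fin; lra.
(* By closedness the supremum is still below [s1 - e] slightly to the right of [alpha]. At [alpha]
   itself, possibly the left end of the domain, there may be no supergradient of finite slope. *)
have [e e0 he] : exists2 e, 0 < e & ~ realized (alpha + e) (s1 - e).
  apply: contrapT => h; have : realized alpha s1.
    by apply: realized_closed => e e0; apply: contrapT => h'; apply: h; exists e.
  by move=> /smax; rewrite leNgt ss1.
set a1 := alpha + e in he.
have r1 : realized a1 0 by apply: realized_le hs _ _; rewrite /a1; lra.
have [f1 [f10 hf1 f1max]] := realized_sup r1.
have f1s : f1 < s1 - e.
  rewrite ltNge; apply/negP => h; apply: he; apply: realized_le hf1 _ h; lra.
(* Slopes of the chords from the left. Their infimum is the left derivative at [a1]: nonnegative by
   monotonicity, and a supergradient by convexity of the set of realized pairs. *)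
pose B := [set (f1 - as_.2) / (a1 - as_.1) | as_ in [set as_ : R * R | realized as_.1 as_.2 /\ as_.1 < a1]].
have lB : lbound B 0.
  move=> _ [[a s'] /= [ha aa1] <-]; rewrite divr_ge0 ?subr_ge0 ?(ltW aa1) //.
  by apply: f1max; apply: realized_le ha _ _; lra.
have B0 : B !=set0 by exists ((f1 - s) / (a1 - alpha)), (alpha, s) => //=; split => //; rewrite /a1; lra using e0.
have iB : has_inf B by split => //; exists 0.
pose q := inf B.
have q0 : 0 <= q by apply: lb_le_inf.
have sg a s' : realized a s' -> s' <= f1 + q * (a - a1).
  move=> ha; have [aa1|] := ltP a a1.
    have : q <= (f1 - s') / (a1 - a) by apply: ge_inf; [exists 0|exists (a, s')].
    by rewrite ler_pdivlMr ?subr_gt0 //; lra.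
  rewrite le_eqVlt => /orP[/eqP aa1|aa1].
    by rewrite -aa1 subrr mulr0 addr0; apply: f1max; rewrite aa1.
  suff : (s' - f1) / (a - a1) <= q by rewrite ler_pdivrMr ?subr_gt0 //; lra using.
  apply: lb_le_inf => // _ [[a' t'] /= [ha' a'a1] <-].
  have d1 : 0 < a1 - a' by lra.
  have d2 : 0 < a - a1 by lra.
  have d3 : 0 < a - a' by lra.
  rewrite ler_pdivrMr // mulrAC ler_pdivlMr //.
  have t01 : 0 <= (a - a1) / (a - a') <= 1.
    by rewrite divr_ge0 ?(ltW d2) ?(ltW d3) //= ler_pdivrMr // mul1r; lra using d1.
  have hc := realized_convex ha' ha t01.
  have := f1max _ (realized_le hc _ (lexx _)).
  have -> : (a - a1) / (a - a') * a' + (1 - (a - a1) / (a - a')) * a = a1.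
    by field; rewrite lt0r_neq0.
  move=> /(_ (lexx _)).
  have -> : (a - a1) / (a - a') * t' + (1 - (a - a1) / (a - a')) * s' = ((a - a1) * t' + (a1 - a') * s') / (a - a').
    by field; rewrite lt0r_neq0.
  by rewrite ler_pdivrMr //; lra using.
have : ((q * a1 - f1)%:E <= (alpha * q - s1)%:E)%E.
  apply: le_trans (hs1 q q0); apply: spectrum_ge => // a s' /sg; lra using.
rewrite lee_fin /a1; have : 0 <= q * e by rewrite mulr_ge0 // ltW.
lra.
Qed.

(** Otherwise the concave nondecreasing supremum is constant from [alpha - dl] to [alpha], hence
    never exceeds [s]. Then [tau(0) = - s] and [tau(h) <= h (alpha - dl) - s], so the right
    derivative at 0 is at most [alpha - dl]. *)
Lemma realized_gap (alpha s dl : R) : (alpha%:E <= Lq_right_deriv0 nu)%E ->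
  realized alpha s -> (forall s', realized alpha s' -> s' <= s) -> 0 < dl ->
  exists2 k, 0 < k & ~ realized (alpha - dl) (s - k).
Proof.
move=> hal hs smax dl0; apply: contrapT => hn.
have {hn} hr : realized (alpha - dl) s.
  apply: realized_closed => e e0; apply: contrapT => h; apply: hn; exists e => // h'.
  by apply: h; apply: realized_le h' _ _; lra.
have top a s' : realized a s' -> s' <= s.
  move=> ha; have [aa|aa] := leP a alpha; first by apply: smax; apply: realized_le ha _ _.
  rewrite leNgt; apply/negP => ss.
  have d3 : 0 < a - (alpha - dl) by lra.
  have t01 : 0 <= (a - alpha) / (a - (alpha - dl)) <= 1.
    by rewrite divr_ge0 ?(ltW d3) ?subr_ge0 ?(ltW aa) //= ler_pdivrMr // mul1r; lra.
  have hc := realized_convex hr ha t01.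
  have e1 : (a - alpha) / (a - (alpha - dl)) * (alpha - dl) + (1 - (a - alpha) / (a - (alpha - dl))) * a = alpha.
    by field; rewrite lt0r_neq0.
  rewrite e1 in hc; have := smax _ hc.
  have -> : (a - alpha) / (a - (alpha - dl)) * s + (1 - (a - alpha) / (a - (alpha - dl))) * s' = s + dl * (s' - s) / (a - (alpha - dl)).
    by field; rewrite lt0r_neq0.
  by rewrite gerDl leNgt divr_gt0 // mulr_gt0 // subr_gt0.
pose f q := fine (Lq_spectrum nu q).
have fE (q : R) : 0 <= q -> Lq_spectrum nu q = (f q)%:E.
  by move=> q0; rewrite fineK // spectrum_fin_num.
have fle (q a s' : R) : 0 <= q -> realized a s' -> f q <= q * a - s'.
  by move=> q0 ha; rewrite -lee_fin -fE //; apply: spectrum_le_realized.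
have fge (q t : R) : 0 <= q -> (forall a s', realized a s' -> t <= q * a - s') -> t <= f q.
  by move=> q0 ha; rewrite -lee_fin -fE //; apply: spectrum_ge.
have f0 : f 0 = - s.
  apply/le_anti; rewrite (le_trans (fle _ _ _ (lexx 0) hr)) ?mul0r ?sub0r //=.
  by apply: fge => // a s' /top; lra.
pose g h := (f h - f 0) / h.
have gle (h : R) : 0 < h -> g h <= alpha - dl.
  move=> h0; rewrite /g ler_pdivrMr // f0 opprK -lerBrDr mulrC.
  exact: fle (ltW h0) hr.
have aux (r fh ha s1 s' : R) : 0 <= (1 - r) * (s1 - s') -> r * fh <= ha - r * s' ->
    r * fh + r * s1 - s1 <= ha - s' by lra.
(* The difference quotients are nonincreasing in [h], so the limit that defines the right derivative
   exists and is their supremum. *)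
have gmono : {in `]0, 1[ &, nonincreasing_fun g}.
  move=> h h'; rewrite !in_itv /= => /andP[h0 _] /andP[h'0 _] hh'.
  rewrite /g f0 !opprK ler_pdivlMr // -lerBlDr.
  apply: fge => [|a s' ha]; first exact: ltW.
  have hs' := top _ _ ha; have := fle _ _ _ (ltW h'0) ha.
  have r0 : 0 <= h / h' by rewrite divr_ge0 ?ltW.
  have r1 : h / h' <= 1 by rewrite ler_pdivrMr // mul1r.
  move=> /(ler_wpM2l r0); have -> : h / h' * (h' * a - s') = h * a - h / h' * s'.
    by field; rewrite lt0r_neq0.
  have -> : (f h' + s) / h' * h = h / h' * f h' + h / h' * s by ring.
  have : 0 <= (1 - h / h') * (s - s') by rewrite mulr_ge0 ?subr_ge0.
  exact: aux.
have lim : ((Lq_spectrum nu h - Lq_spectrum nu 0) / h%:E)%E @[h --> (0 : R)^'+] --> (sup (g @` `]0, 1[))%:E.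
  have : (g h)%:E @[h --> (0 : R)^'+] --> (sup (g @` `]0, 1[))%:E.
    apply/cvg_EFin; first by near=> h.
    apply: nonincreasing_at_right_cvgr; rewrite ?bnd_simp //.
    by exists (alpha - dl) => _ [h /= + <-]; rewrite in_itv /= => /andP[h0 _]; apply: gle.
  apply: cvg_trans; apply: near_eq_cvg; near=> h.
  have h0 : 0 < h by near: h; apply: nbhs_right_gt.
  by rewrite (fE h (ltW h0)) (fE 0 (lexx 0)) -EFinB inver gt_eqF.
move: hal; rewrite /Lq_right_deriv0 (cvg_lim _ lim) //.
rewrite lee_fin leNgt => /negP; apply.
apply: (@le_lt_trans _ _ (alpha - dl)); last by lra.
apply: ge_sup; first by exists (g 2^-1), 2^-1 => //=; rewrite in_itv /= invr_gt0 ltr0n invf_lt1 ?ltr1n.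
by move=> _ [h /= + <-]; rewrite in_itv /= => /andP[h0 _]; apply: gle.
Unshelve. all: by end_near. Qed.

(** * One stage of the Moran construction *)

(** The complement of [K] is null, and the distortion bounds say nothing about points outside [K],
    so inclusions are checked on [K] only. *)
Lemma le_mass_on (A B : set 'rV[R]_d) : closed A -> closed B ->
  (forall z, K z -> A z -> B z) -> mass A <= mass B.
Proof.
move=> cA cB h; have mA := closed_measurable cA; have mB := closed_measurable cB.
have mK := measurableC (closed_measurable attractor_closed).
rewrite -lee_fin -!massE // -[leRHS]adde0 -measure_attractorC.
apply: le_trans (_ : nu (B `|` ~` K) <= _)%E; last exact: measureU2.
apply: measure_le => //; first exact: measurableU.
by move=> z Az; have [Kz|] := pselect (K z); [left; apply: h|right].
Qed.

Lemma expR1_le4 : expR 1 <= 4 :> R.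
Proof.
have h : 2^-1 <= expR (- 2^-1) :> R by apply: le_trans (expR_ge1Dx _); lra.
have e : expR 1 = (expR (- 2^-1) ^+ 2)^-1 :> R.
  by rewrite -expRM_natl -expRN; congr expR; field.
rewrite e invf_ple ?posrE ?exprn_gt0 ?expR_gt0 //.
have : 2^-1 * 2^-1 <= expR (- 2^-1) * expR (- 2^-1) :> R by rewrite ler_pM.
by rewrite expr2; lra.
Qed.

Lemma packing_fails (a s : R) : ~ realized a s -> exists L0 : R, forall r, L0 <= r ->
  ~ packing (expR (- r)) (expR (r * s)) (expR (- (r * a))).
Proof.
move=> h; apply: contrapT => hn; apply: h; apply: realized_of_packings => L0.
apply: contrapT => h'; apply: hn; exists L0 => r hr hp'; apply: h'.
by exists r.
Qed.

(* The cylinders in [s] together dominate the measure near one ball; by pigeonhole one of them would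
   carry many of the heavy balls, which it pulls back to a packing. *)
Lemma overweight_count (e C x b L N q m : R) (s : seq (seq 'I_l * R)) (I : finType)
    (c : I -> 'rV[R]_d) :
  distortion_bound e C -> 16 <= x -> 0 < q -> 0 < N -> 0 < m -> (size s)%:R <= expR x ->
  (forall vP, vP \in s -> [/\ b - 1 <= lev vP.1 <= b + x, e * lev vP.1 + C <= 3 * x,
     0 <= vP.2 & vP.2 <= m]) ->
  (forall i, let A := cball (c i) (8 * expR (- (b + L + 16 * x))) in
     m * (q * expR x) < mass A /\ mass A <= \sum_(vP <- s) vP.2 * mass (X `&` T vP.1 @^-1` A)) ->
  (forall i j, i != j -> expR (- (b + L + 5 * x)) <= enorm (c i - c j)) ->
  ~ packing (expR (- (L + 11 * x))) N q -> #|I|%:R < expR x * N.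
Proof.
move=> [C0 _ hd _] x16 q0 N0 m1 hs sP cA csep npack.
pose B i := cball (c i) (8 * expR (- (b + L + 16 * x))).
have x17 : 17 <= expR x by apply: le_trans (expR_ge1Dx _); lra.
have pick i : exists j : 'I_(size s), let v := (nth ([::], 0) s j).1 in
    q <= mass (X `&` T v @^-1` (B i)).
  have [h1 h2] := cA i.
  have m0 : 0 < m * (q * expR x) by rewrite !mulr_gt0 ?expR_gt0.
  have [vP vs hv] := sum_pigeonhole m0 hs (le_trans (ltW h1) h2).
  have [v1 v2 v3 v4] := sP vP vs.
  exists (Ordinal (etrans (index_mem vP s) vs)); rewrite /= nth_index //.
  rewrite -(ler_pM2l m1); apply: le_trans (_ : vP.2 * mass (X `&` T vP.1 @^-1` B i) <= _).
    by apply: le_trans hv; rewrite mulrA mulfK // lt0r_neq0 // expR_gt0.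
  by apply: ler_wpM2r => //; apply: mass_ge0.
have [k hk] := fin_all_exists pick.
have [A hA kA] := pigeonhole_class k.
have {}hA : #|I|%:R <= expR x * #|A|%:R.
  apply: le_trans (_ : (#|'I_(size s)| * #|A|)%:R <= _); first by rewrite ler_nat.
  by rewrite card_ord natrM ler_wpM2r.
apply: le_lt_trans hA _; rewrite ltr_pM2l ?expR_gt0 // ltNge; apply/negP => hN.
apply: npack.
have [i0 i0A] : exists i, i \in A.
  by apply/card_gt0P; rewrite -(ltr0n R); apply: lt_le_trans hN.
pose v := (nth ([::], 0) s (k i0)).1.
have vs : nth ([::], 0) s (k i0) \in s by apply: mem_nth.
have [/andP[v1 v2] v3 _ _] := sP _ vs; rewrite -/v in v1 v2 v3.
have vA i : i \in A -> q <= mass (X `&` T v @^-1` (B i)).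
  by move=> iA; have := hk i; rewrite /= (kA i i0 iA i0A).
have meet (i : {i | i \in A}) : exists y, K y /\ B (val i) (T v y).
  case: i => i iA /=; have m0 := lt_le_trans q0 (vA i iA).
  have [y Ky [_ hy]] := mass_meets (@word_preimage_closed v _ (@cball_closed _ _ _ _)) m0.
  by exists y.
have [y hy] := fin_all_exists meet.
pose z := expR (- (b + L + 16 * x)).
have z0 : 0 < z by apply: expR_gt0.
have zx : 17 * z <= expR (- (b + L + 15 * x)).
  have -> : expR (- (b + L + 15 * x)) = expR x * z by rewrite -expRD; congr expR; ring.
  by rewrite ler_pM2r.
(* Up to a factor [exp (4 x)], pulling back by [v] multiplies distances by [exp b]. The balls go
   into balls of radius [expR (- (L + 11 * x))], while centres [expR (- (b + L + 5 * x))] apart give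
   points more than twice that radius apart. *)
exists {i | i \in A}, y; split.
- by rewrite card_sig; apply: le_trans hN _; rewrite ler_nat; apply: eq_leq; apply: eq_card.
- move=> [i iA] [j jA] /= ij.
  have {}ij : i != j by apply: contraNN ij => /eqP e'; apply/eqP/val_inj.
  have [Ky1 hy1] := hy (exist _ i iA); have [Ky2 hy2] := hy (exist _ j jA).
  set y1 := y _ in Ky1 hy1 *; set y2 := y _ in Ky2 hy2 *.
  rewrite /= /B /cball /= -/z in hy1 hy2.
  have sep := csep i j ij.
  have big : 34 * z <= expR (- (b + L + 5 * x)).
    apply: le_trans (_ : expR (- (b + L + 15 * x)) * 2 <= _); first by lra using zx.
    have -> : expR (- (b + L + 5 * x)) = expR (- (b + L + 15 * x)) * expR (10 * x).
      by rewrite -expRD; congr expR; ring.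
    by rewrite ler_pM2l ?expR_gt0 //; apply: le_trans (expR_ge1Dx _); lra using x16.
  have d1 : expR (- (b + L + 5 * x)) <= 2 * enorm (T v y1 - T v y2).
    have t1 := enorm_triangle (T v y1) (c i) (c j).
    have t2 := enorm_triangle (T v y2) (T v y1) (c j).
    rewrite (enormB (c i) (T v y1)) in t1.
    by move: sep big t1 t2 hy1 hy2; rewrite -/y1 -/y2; move: (expR _) => W; lra.
  have /andP[_ d2] := hd v y1 y2 Ky1 Ky2.
  have d3 : enorm (T v y1 - T v y2) <= expR (- b + 1 + 3 * x) * enorm (y1 - y2).
    apply: le_trans d2 _; apply: ler_wpM2r; first exact: enorm_ge0.
    by rewrite ler_expR; lra using v1 v3.
  have d4 : expR (- (b + L + 5 * x)) * expR (b - 1 - 3 * x) <= 2 * enorm (y1 - y2).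
    rewrite (_ : b - 1 - 3 * x = - (- b + 1 + 3 * x)); last by ring.
    rewrite (expRN (- b + 1 + 3 * x)) ler_pdivrMr ?expR_gt0 //.
    by move: d1 d3; move: (expR _) (expR _) => w1 w2; lra.
  rewrite -expRD in d4.
  apply: lt_le_trans (_ : 2^-1 * expR (- (b + L + 5 * x) + (b - 1 - 3 * x)) <= _); last by lra using d4.
  have -> : expR (- (b + L + 5 * x) + (b - 1 - 3 * x)) = expR (- (L + 11 * x)) * expR (3 * x - 1).
    by rewrite -expRD; congr expR; ring.
  have w1 := expR_ge1Dx (3 * x - 1); have w0 := expR_gt0 (- (L + 11 * x)).
  by nra.
- move=> [i iA]; have [Ky1 hy1] := hy (exist _ i iA); set y1 := y _ in Ky1 hy1 *.
  rewrite /= /B /cball /= -/z in hy1.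
  apply: le_trans (vA i iA) _; apply: le_mass_on; last 1 first.
  + move=> y2 Ky2 [_ hy2]; rewrite /preimage /B /cball /= -/z in hy2.
    have d1 : enorm (T v y2 - T v y1) <= 16 * z.
      have t1 := enorm_triangle (c i) (T v y2) (T v y1).
      rewrite (enormB (c i) (T v y1)) in t1; lra using hy1 hy2 t1.
    have /andP[d2 _] := hd v y2 y1 Ky2 Ky1.
    have d3 : expR (- b - 4 * x) * enorm (y2 - y1) <= enorm (T v y2 - T v y1).
      apply: le_trans _ d2; apply: ler_wpM2r; first exact: enorm_ge0.
      by rewrite ler_expR; lra using v2 v3.
    rewrite /cball /= -(ler_pM2l (expR_gt0 (- b - 4 * x))) -expRD.
    rewrite (_ : - b - 4 * x + _ = - (b + L + 15 * x)); last by ring.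
    by lra using z0 zx d1 d3.
  + exact/word_preimage_closed/cball_closed.
  + exact: cball_closed.
Qed.

(** The lower mass bound is multiplicative along words, so it concerns the added word [v i]. The
    upper bound must take overlaps into account, so it compares the masses of whole balls about
    parent and child. *)
Definition children (alpha dl : R) x0 (b b' : R) (N : nat) U (v : 'I_N -> seq 'I_l) :=
  [/\ forall i, section b' (U ++ v i),
      forall i, admissible (v i) (expR (- ((b' - b) * (alpha + dl)))),
      forall i, mass (cball (T (U ++ v i) x0) (8 * expR (- b'))) <=
        mass (cball (T U x0) (8 * expR (- b))) * expR (- ((b' - b) * (alpha - dl))) &
      forall i j y z, i != j -> K y -> K z ->
        expR (- b') <= enorm (T (U ++ v i) y - T (U ++ v j) z)].

(** [L = eta * b] is the length of a stage, [x = e * b] the distortion at its start and [e3] the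
    precision of the inserted system. Every loss must be small against [y = L * min (dl, k, 1)]. As
    [x] is proportional to [b] and not to [L], [e] is taken much smaller than [eta]; [Q] collects
    the coefficients with which [x] enters. *)
Lemma stage_parameters (alpha s dl k c : R) : 0 <= alpha -> 0 <= s -> 0 < dl -> 0 < k -> 0 < c ->
  exists e e3 eta : R, [/\ 0 < e <= 1 / 2, 0 < e3, 0 < eta & forall b, 0 < b ->
    let x := e * b in let L := eta * b in exists y : R,
    [/\ x + x * alpha + x * s + x * c = y / 64, y <= L /\ y <= L * dl, y <= L * k,
       e3 * L + c * (e3 * L) = y / 8 & L + 16 * x <= b /\ L + 16 * x <= b * dl]].
Proof.
move=> a0 s0 dl0 k0 c0.
pose th := Num.min (Num.min dl k) 1.
have th0 : 0 < th by rewrite !lt_min dl0 k0 ltr01.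
have th1 : th <= 1 by rewrite ge_min lexx orbT.
have thdl : th <= dl by rewrite !ge_min lexx.
have thk : th <= k by rewrite !ge_min lexx !orbT.
pose Q := 1 + alpha + s + c; have Q1 : 1 <= Q by rewrite /Q; lra.
have Q0 : 0 < Q by lra.
pose eta := th / 2; have eta0 : 0 < eta by rewrite divr_gt0.
have [ki ki0 kiE] : exists2 ki : R, 0 < ki & ki = 1 / 64 by exists (1 / 64); lra.
have ki1 : ki <= 1 by lra.
pose e := eta * th * ki / Q.
have e0 : 0 < e by rewrite divr_gt0 ?mulr_gt0.
have eQ : e * Q = eta * th * ki by rewrite /e; field; rewrite lt0r_neq0.
pose e3 := th / (8 * (1 + c)).
have c1 : 0 < 1 + c by lra.
have e30 : 0 < e3 by rewrite divr_gt0 ?mulr_gt0.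
have ec3 : e3 * (1 + c) = th / 8 by rewrite /e3; field; rewrite lt0r_neq0.
have et : eta * th <= 1 / 2.
  by apply: le_trans (_ : eta * 1 <= _); [rewrite ler_pM2l|rewrite /eta mulr1; lra using th1].
have e_small : e <= 1 / 2.
  apply: le_trans (_ : e * Q <= _); first by rewrite ler_peMr // ltW.
  by rewrite eQ; apply: le_trans et; rewrite ler_piMr // mulr_ge0 // ltW.
exists e, e3, eta; split => // [|b b0 x L]; first by rewrite e0.
pose y := L * th; exists y.
have L0 : 0 < L by rewrite mulr_gt0.
have x0 : 0 < x by rewrite mulr_gt0.
have xQ : x * Q = y / 64 by rewrite /x mulrAC eQ kiE /y /L; ring.
have xa : 0 <= x * alpha by rewrite mulr_ge0 // ltW.
have xs : 0 <= x * s by rewrite mulr_ge0 // ltW.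
have xc : 0 <= x * c by rewrite mulr_ge0 // ltW.
have xQ' : x + x * alpha + x * s + x * c = y / 64 by rewrite -xQ /Q; ring.
have y1 : y <= L by rewrite /y ler_piMr // ltW.
have L2 : L = b * th / 2 by rewrite /L /eta; ring.
have bth : b * th <= b by rewrite ler_piMr // ltW.
have bdl : b * th <= b * dl by rewrite ler_pM2l.
split => //.
- by split => //; rewrite ler_pM2l.
- by rewrite ler_pM2l.
- have -> : e3 * L + c * (e3 * L) = L * (e3 * (1 + c)) by ring.
  by rewrite ec3 /y mulrA.
- by split; lra using x0 xa xs xc xQ' y1 L2 bth bdl.
Qed.

(** A system for [(alpha, s)] at scale [L] is placed inside [U] and its words are extended to the
    section at [b']. Too many overweight children would, by [overweight_count], yield a packing that
    the gap at [(alpha - dl / 2, s - k)] forbids. *)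
Lemma stage (alpha s dl k : R) x0 : K x0 -> realized alpha s -> 0 <= s -> 0 < dl -> 0 < k ->
  ~ realized (alpha - dl / 2) (s - k) ->
  exists l0 : R, forall b, l0 <= b -> exists (b' : R) (N : nat),
  [/\ b + 1 <= b' <= b * (1 + dl), (0 < N)%N, expR ((b' - b) * (s - dl)) <= N%:R &
   forall U, section b U -> 0 < mass (cball (T U x0) (8 * expR (- b))) ->
     exists v : 'I_N -> seq 'I_l, children alpha dl x0 b b' U v].
Proof.
move=> Kx0 hs s0 dl0 k0 hgap; have a0 := realized_ge0 hs.
have [c c0 hext] := extension.
have [e [e3 [eta [/andP[e0 e_small] e30 eta0 scales]]]] := stage_parameters a0 s0 dl0 k0 c0.
have [C hd] := distortion e0; have [C0 _ hdist hcat] := hd.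
have [C1 C10 hsec] := section_lev e0.
have [C2 C20 hC2] := hext e e0.
have [R0 hR0] := AWSC_scale e0.
have [T0 hT0] := packing_fails hgap.
have [L1 hL1] := realized_eventually hs e30.
exists ((16 + C + C1 + C2) / e + (`|T0| + `|L1|) / eta + `|R0|) => b hb.
have [b0 xC LT Rb] : [/\ 0 < b, 16 + C + C1 + C2 <= e * b, `|T0| + `|L1| <= eta * b & R0 <= b].
  have q1 : 0 < (16 + C + C1 + C2) / e by rewrite divr_gt0 // !addr_gt0.
  have q2 : 0 <= (`|T0| + `|L1|) / eta by rewrite divr_ge0 ?addr_ge0 // ltW.
  have q3 := normr_ge0 R0; have q4 := ler_norm R0.
  split; [lra using hb q1 q2 q3| | |lra using hb q1 q2 q4].
    by rewrite [leRHS]mulrC -ler_pdivrMr //; lra using hb q2 q3.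
  by rewrite [leRHS]mulrC -ler_pdivrMr //; lra using hb q1 q3.
have [y [xQ' [y1 ydl] yk Le3 [Lb Lbdl]]] := scales b b0.
set x := e * b in xC xQ' Lb Lbdl; set L := eta * b in LT y1 ydl yk Le3 Lb Lbdl.
have L0 : 0 < L by rewrite mulr_gt0.
have x16 : 16 <= x by lra using xC C0 C10 C20.
have x0' : 0 < x by lra using x16.
have xa : 0 <= x * alpha by rewrite mulr_ge0 // ltW.
have xs : 0 <= x * s by rewrite mulr_ge0 // ltW.
have xc : 0 <= x * c by rewrite mulr_ge0 // ltW.
have xk : 0 <= x * k by rewrite mulr_ge0 // ltW.
have xdl : 0 <= x * dl by rewrite mulr_ge0 // ltW.
have e3L : 0 < e3 * L by rewrite mulr_gt0.
have ce3L : 0 < c * (e3 * L) by rewrite mulr_gt0.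
have La : 0 <= L * alpha by rewrite mulr_ge0 // ltW.
have L1L : L1 <= L by have h1 := ler_norm L1; have h2 := normr_ge0 T0; lra using h1 h2 LT.
have T0t : T0 <= L + 11 * x by have h1 := ler_norm T0; have h2 := normr_ge0 L1; lra using h1 h2 LT x0'.
have [I [g [gN glev gadm gsep]]] := hL1 L L1L.
(* The concatenated words have levels up to [b + L + 5 * x] and are separated at that scale. The
   surplus [11 * x] leaves room to extend them and makes the balls of radius [8 * expR (- b')] tiny
   against the separation. *)
pose b' := b + L + 16 * x.
pose zz := expR (L * (s - e3) - 1).
(* The number of children does not depend on [U], so that a branch is coded by digits in a mixed
   base. *)
pose N := maxn 1 (Num.truncn zz).
have zz0 : 0 < zz by apply: expR_gt0.
have /andP[tz1 tz2] := truncn_itv (ltW zz0).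
exists b', N; split.
- by rewrite /b'; apply/andP; split; lra using L0 x16 Lbdl.
- by rewrite leq_max.
- apply: le_trans (_ : zz / 2 <= _); last first.
    rewrite /N natr_max le_max; apply/orP.
    have [z2|z2] := leP zz 2; [left; lra using z2|right].
    by move: tz2; rewrite -natr1 => h; lra using h z2.
  rewrite ler_pdivlMr //; apply: le_trans (_ : expR ((b' - b) * (s - dl)) * expR 1 <= _).
    by rewrite ler_pM2l ?expR_gt0 //; have h := expR_ge1Dx (1 : R); lra using h.
  rewrite -expRD ler_expR /b'.
  have -> : (b + L + 16 * x - b) * (s - dl) = L * s + 16 * (x * s) - L * dl - 16 * (x * dl) by ring.
  by rewrite mulrBr; lra using xQ' ydl yk Le3 x16 xa xs xc xk xdl e3L ce3L.
move=> U hU mU.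
have /andP[lU1 lU2] := hsec _ _ hU; rewrite -/x in lU2.
have DU : e * lev U + C <= 3 * x.
  have : e * lev U <= e * (b + 2 * x) by rewrite ler_pM2l //; lra using lU1 lU2 xC C0 C10 C20.
  have : e * x <= 1 / 2 * x by rewrite ler_pM2r.
  by rewrite mulrDr -/x; lra using x16 xC C0 C10 C20.
have lUg i : b + L - e3 * L - 3 * x <= lev (U ++ g i) <= b + L + 5 * x.
  have := hcat U (g i); rewrite ler_norml => /andP[h1 h2]; have /andP[h3 h4] := glev i.
  by apply/andP; split; lra using h1 h2 h3 h4 DU lU1 lU2 xC C0 C10 C20.
have ext i : exists v, section b' ((U ++ g i) ++ v) /\
    admissible v (expR (- (c * (b' - lev (U ++ g i)) + e * b' + C2))).
  have /andP[h1 h2] := lUg i.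
  by apply: hC2; rewrite /b'; lra using h1 h2 x0' C20 xC C0 C10 b0 L0.
have [v hv] := fin_all_exists ext.
pose w i := g i ++ v i.
have wsec i : section b' (U ++ w i) by rewrite /w catA; exact: (hv i).1.
have wadm i : admissible (w i) (expR (- ((b' - b) * (alpha + dl)))).
  apply: admissible_le (admissible_cat (gadm i) (hv i).2).
  rewrite expR_ge0 -expRD ler_expR /=.
  have /andP[h1 h2] := lUg i.
  have h3 : c * (b' - lev (U ++ g i)) <= c * (e3 * L + 19 * x).
    by rewrite ler_pM2l // /b'; lra using h1 x0'.
  have h4 : e * b' <= 2 * x.
    rewrite /x mulrA [leRHS]mulrAC -mulrA mulrC -/x mulrA.
    rewrite (_ : 2 * b * e = e * (2 * b)); last by ring.
    by rewrite mulrC ler_pM2l // /b'; lra using Lb.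
  rewrite /b' in h3 h4 *.
  rewrite (_ : (b + L + 16 * x - b) * (alpha + dl) = L * alpha + L * dl + 16 * (x * alpha) + 16 * (x * dl)); last by ring.
  by lra using h1 h2 h3 h4 La xQ' ydl yk Le3 x16 xa xs xc xk xdl e3L ce3L xC C0 C10 C20.
have wsep i j y' z : i != j -> K y' -> K z -> expR (- (b + L + 5 * x)) <= enorm (T (U ++ w i) y' - T (U ++ w j) z).
  move=> ij Ky Kz; rewrite !word_cat.
  have Ky' := word_attractor (v i) Ky; have Kz' := word_attractor (v j) Kz.
  have h := gsep i j _ _ ij Ky' Kz'.
  have /andP[h1 _] := hdist U _ _ (word_attractor (g i) Ky') (word_attractor (g j) Kz').
  apply: le_trans h1; apply: le_trans (ler_wpM2l (expR_ge0 _) h).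
  by rewrite -expRD ler_expR; lra using DU lU2 x0' xC C0 C10 C20.
pose B i := cball (T (U ++ w i) x0) (8 * expR (- b')).
pose m := mass (cball (T U x0) (8 * expR (- b))).
pose good := [set i | mass (B i) <= m * expR (- ((b' - b) * (alpha - dl)))]%SET.
(* Fewer than [expR x * expR ((L + 11 * x) * (s - k)) <= zz] words are bad, out of at least
   [2 * zz]. *)
have count : zz <= #|good|%:R.
  have [s' [s1 s2 s3]] := hR0 b (T U x0) Rb.
  pose J := {i | i \in ~: good}%SET.
  have J_lt : #|{: J}|%:R < expR x * expR ((L + 11 * x) * (s - k)).
    apply: (@overweight_count e C x b L _ (expR (- ((L + 11 * x) * (alpha - dl / 2)))) m s' _
      (fun i : J => T (U ++ w (val i)) x0) hd x16); rewrite ?expR_gt0 //.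
    + move=> vP vs; have [/andP[h1 h2] h3 [y' Ky' hy']] := s2 _ vs.
      split; first by apply/andP; split; [exact: h1|exact: h2].
      * have : e * lev vP.1 <= e * (b + x) by rewrite ler_pM2l // /x; lra.
        have : e * x <= 1 / 2 * x by rewrite ler_pM2r.
        by rewrite mulrDr -/x; lra using x0' xC C0 C10 C20.
      * by have [] := h3.
      (* The cylinder meets the ball of radius [4 * expR (- b)] and has diameter at most
         [expR (1 - b) <= 4 * expR (- b)]; hence the radius [8 * expR (- b)] in [children]. *)
      * apply: admissible_mass h3 (@cball_closed _ _ _ _) _ => z Kz.
        rewrite /cball /=; apply: le_trans (enorm_triangle (T vP.1 y') _ _) _.
        have -> : 8 * expR (- b) = 4 * expR (- b) + 4 * expR (- b) by rewrite -mulrDl; congr (_ * _); ring.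
        apply: lerD; last exact: hy'.
        apply: le_trans (word_dist_lev _ Kz Ky') _.
        apply: le_trans (_ : expR 1 * expR (- b) <= _).
          by rewrite -expRD ler_expR; lra using h1.
        by rewrite ler_pM2r ?expR_gt0 // expR1_le4.
    + move=> [i /= iJ]; split.
        move: iJ; rewrite !inE -ltNge; apply: le_lt_trans.
        rewrite ler_pM2l // -expRD ler_expR /b'.
        have -> : (b + L + 16 * x - b) * (alpha - dl) = L * alpha + 16 * (x * alpha) - L * dl - 16 * (x * dl) by ring.
        have -> : (L + 11 * x) * (alpha - dl / 2) = L * alpha + 11 * (x * alpha) - L * dl / 2 - 11 * (x * dl) / 2 by field.
        by lra using xQ' ydl yk Le3 x16 xa xs xc xk xdl e3L ce3L.
      apply: s3; first exact: cball_closed.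
      apply: cballS; rewrite word_cat.
      apply: le_trans (_ : expR (- b) + expR (- b) <= _); last by lra using x0'.
      apply: lerD.
        apply: le_trans (word_dist_lev _ (word_attractor _ Kx0) Kx0) _.
        by rewrite ler_expR; lra using lU1.
      have -> : - (b + L + 16 * x) = - b + - (L + 16 * x) by ring.
      rewrite expRD mulrCA ler_piMr ?expR_ge0 // expRN ler_pdivrMr ?expR_gt0 // mul1r.
      by apply: le_trans (expR_ge1Dx _); lra using L0 x16.
    + move=> [i iJ] [j jJ] /= ij; apply: wsep => //.
    + exact: hT0.
  have cI : (#|I| = #|good| + #|{: J}|)%N.
    by rewrite card_sig -(cardsC good); congr addn; apply: eq_card.
  have h1 : expR x * expR ((L + 11 * x) * (s - k)) <= zz.
    rewrite -expRD ler_expR.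
    have -> : (L + 11 * x) * (s - k) = L * s + 11 * (x * s) - L * k - 11 * (x * k) by ring.
    by rewrite mulrBr; lra using xQ' ydl yk Le3 x16 xa xs xc xk xdl e3L ce3L.
  have h2 : 2 * zz <= expR (L * (s - e3)).
    have -> : expR (L * (s - e3)) = expR 1 * zz by rewrite -expRD; congr expR; ring.
    by rewrite ler_pM2r //; have h := expR_ge1Dx (1 : R); lra using h.
  by move: gN; rewrite cI natrD; lra using J_lt h1 h2.
have NG : (N <= #|good|)%N.
  rewrite geq_max; apply/andP; split; first by rewrite -(ltr0n R); lra using count zz0.
  by rewrite -(ler_nat R); lra using tz1 count.
pose f (i : 'I_N) : I := enum_val (widen_ord NG i).
have fgood i : f i \in good by apply: enum_valP.
have finj i j : i != j -> f i != f j.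
  apply: contraNN => /eqP /enum_val_inj /(congr1 val) /= h.
  by apply/eqP/val_inj.
exists (fun i => w (f i)); split => //.
- by move=> i; have := fgood i; rewrite inE.
- move=> i j y' z /finj ij Ky Kz; apply: le_trans (wsep _ _ _ _ ij Ky Kz).
  by rewrite ler_expR /b'; lra using x0'.
Qed.

(** * Iterating the stages: a Cantor set inside the level set *)

Lemma near0_expP (P : set R) : (\forall r \near (0 : R)^'+, P r) <->
  exists L0 : R, forall r, L0 <= r -> P (expR (- r)).
Proof.
split=> [/nbhs_right0P[e /= e0 he]|[L0 hP]].
  have e2 : 0 < e / 2 by rewrite divr_gt0.
  exists (- ln (e / 2)) => r hr; rewrite -[expR _]add0r; apply: he; last exact: expR_gt0.
  rewrite /ball_ /= sub0r normrN ger0_norm ?expR_ge0 //.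
  apply: (@le_lt_trans _ _ (e / 2)); last by rewrite ltr_pdivrMr // ltr_pMr // ltr1n.
  by rewrite -[leRHS]lnK ?posrE // ler_expR; lra.
near=> r; have r0 : 0 < r by near: r; apply: nbhs_right_gt.
rewrite -(lnK r0) -[ln r]opprK; apply: hP.
have : r <= expR (- L0) by near: r; apply: nbhs_right_le; apply: expR_gt0.
by rewrite -{1}(lnK r0) ler_expR; lra.
Unshelve. all: by end_near. Qed.
Lemma limit_point (f : nat -> 'rV[R]_d) (r : nat -> R) : (forall j, K (f j)) ->
  (forall i j, (i <= j)%N -> enorm (f j - f i) <= r i) ->
  exists z, forall j, enorm (z - f j) <= r j.
Proof.
move=> Kf hf.
have [z [_ cz]] : K `&` cluster (f @ \oo) !=set0.
  by apply: attractor_compact; exists 0%N => // n _; apply: Kf.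
exists z => j; apply/ler_addgt0Pr => e e0.
have [|_ [[n /= jn <-] hz]] := cz (f @` [set n | (j <= n)%N]) _ _ (nbhs_cball z e0).
  by exists j => // n /= jn; exists n.
have h1 := enorm_triangle (f n) z (f j); have h2 := hf _ _ jn.
by apply: le_trans h1 _; rewrite addrC; apply: lerD => //; rewrite enormB.
Qed.

(** A Stolz-Cesaro argument: increments of [c] that are [o] of those of [b] sum up to [o(b)],
    because [b] tends to infinity. *)
Lemma slow_growth (b dl c : nat -> R) : (forall j, b j + 1 <= b j.+1) ->
  (forall e : R, 0 < e -> exists J, forall j, (J <= j)%N -> dl j <= e) ->
  (forall j, c j.+1 <= c j + (b j.+1 - b j) * dl j) ->
  forall e : R, 0 < e -> exists J, forall j, (J <= j)%N -> c j <= e * b j.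
Proof.
move=> hb hdl hc e e0; have e2 : 0 < e / 2 by rewrite divr_gt0.
have [J hJ] := hdl _ e2.
have step n : c (J + n)%N <= c J + (b (J + n)%N - b J) * (e / 2).
  elim: n => [|n IH]; first by rewrite addn0 subrr mul0r addr0.
  rewrite addnS; apply: le_trans (hc _) _.
  have : (b (J + n).+1 - b (J + n)%N) * dl (J + n)%N <= (b (J + n).+1 - b (J + n)%N) * (e / 2).
    by apply: ler_wpM2l; [have := hb (J + n)%N; lra|apply: hJ; apply: leq_addr].
  by move: IH; lra.
have big n : b J + n%:R <= b (J + n)%N.
  elim: n => [|n IH]; first by rewrite addn0 addr0.
  by rewrite addnS -natr1; have := hb (J + n)%N; lra.
pose M := (c J - b J * (e / 2)) / (e / 2) - b J.
have M1 := archi_boundP (normr_ge0 M); have M2 := ler_norm M.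
exists (J + Num.bound `|M|)%N => j hj.
have jJ : (J <= j)%N by apply: leq_trans hj; apply: leq_addr.
rewrite -(subnKC jJ); set n := (j - J)%N.
have n1 : (Num.bound `|M|)%:R <= n%:R :> R by rewrite ler_nat /n leq_subRL.
have h1 := big n; have h2 := step n.
have h3 : (c J - b J * (e / 2)) / (e / 2) <= b (J + n)%N by rewrite /M in M2; lra.
rewrite ler_pdivrMr // in h3.
by move: h2 h3; lra.
Qed.
Lemma level_setP (alpha : R) z : level_set nu alpha z <->
  forall e : R, 0 < e -> exists L0, forall r, L0 <= r ->
    expR (- (r * (alpha + e))) <= mass (cball z (expR (- r))) <= expR (- (r * (alpha - e))).
Proof.
have q (r : R) : 0 < mass (cball z r) ->
    (lne (nu (cball z r)) / (ln r)%:E)%E = (ln (mass (cball z r)) / ln r)%:E \/ ln r = 0.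
  move=> m0; have [e|n0] := eqVneq (ln r) 0; [by right|left].
  rewrite massE; last by apply: closed_measurable; apply: cball_closed.
  by rewrite lne_EFin // inver (negbTE n0) -EFinM.
split=> [h e e0|h].
  move/fine_cvgP: h => [fin /cvgrPdist_le/(_ e e0) near].
  have [L0 hL] := (near0_expP _).1 (filterI fin near).
  exists (1 + `|L0|) => r hr.
  have r0 : 0 < r by have := normr_ge0 L0; lra.
  have [f1 f2] : ((lne (nu (cball z (expR (- r)))) / (ln (expR (- r)))%:E)%E \is a fin_num) /\
      `|alpha - fine (lne (nu (cball z (expR (- r)))) / (ln (expR (- r)))%:E)| <= e.
    by apply: hL; have := ler_norm L0; lra.
  have m0 : 0 < mass (cball z (expR (- r))).
    rewrite lt_def mass_ge0 andbT; apply/eqP => m0; move: f1.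
    rewrite massE ?m0; last by apply: closed_measurable; apply: cball_closed.
    by rewrite le0_lneNy // expRK inver oppr_eq0 (gt_eqF r0) mulNyr invrN ltr0_sg ?oppr_lt0 ?invr_gt0 // mulN1e.
  have [e1|e1] := q _ m0; last by move: e1; rewrite expRK; lra using r0.
  move: f2; rewrite e1 /= expRK invrN mulrN opprK.
  set w := ln _ => hw; have we : mass (cball z (expR (- r))) = expR w by rewrite lnK.
  rewrite we !ler_expR.
  have : `|(alpha + w / r) * r| <= e * r by rewrite normrM (gtr0_norm r0) ler_pM2r.
  rewrite mulrDl divfK ?gt_eqF // ler_norml => /andP[h1 h2].
  by apply/andP; split; lra using h1 h2.
rewrite /level_set /=; apply/fine_cvgP.
have val (r : R) : 0 < r -> 0 < mass (cball z (expR (- r))) ->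
    (lne (nu (cball z (expR (- r)))) / (ln (expR (- r)))%:E)%E = (- (ln (mass (cball z (expR (- r)))) / r))%:E.
  move=> r0 /q [->|e]; last by move: r0; rewrite -oppr_lt0 -(expRK (- r)) e ltxx.
  by rewrite expRK invrN mulrN.
split.
  have [L0 hL] := h 1 ltr01; apply/near0_expP; exists (1 + `|L0|) => r hr.
  have h1 := ler_norm L0; have h2 := normr_ge0 L0.
  have /hL/andP[h3 _] : L0 <= r by lra.
  by rewrite val //; [lra|apply: lt_le_trans h3; apply: expR_gt0].
apply/cvgrPdist_le => e e0; have [L0 hL] := h e e0; apply/near0_expP; exists (1 + `|L0|) => r hr.
have h1 := ler_norm L0; have h2 := normr_ge0 L0.
have r0 : 0 < r by lra.
have /hL/andP[h3 h4] : L0 <= r by lra.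
have m0 : 0 < mass (cball z (expR (- r))) by apply: lt_le_trans h3; apply: expR_gt0.
rewrite /= val //= opprK; move: h3 h4; rewrite -[mass _]lnK // !ler_expR expRK.
move: (ln _) => w h3 h4.
rewrite -(ler_pM2r r0) -[X in _ * X <= _](gtr0_norm r0) -normrM mulrDl divfK ?gt_eqF //.
by rewrite ler_norml; apply/andP; split; lra using h3 h4.
Qed.
(** Diagonal choice: the tolerance [n.+1%:R^-1] is used once the scale has passed the threshold
    [l0 n] from which [stage] works for it. *)
Lemma schedule (alpha s B : R) x0 : K x0 -> realized alpha s -> 0 <= s ->
  (forall dl : R, 0 < dl -> exists2 k : R, 0 < k & ~ realized (alpha - dl) (s - k)) ->
  exists (b dl : nat -> R) (N : nat -> nat), [/\ 0 < b 0%N, B < b 0%N,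
    forall e : R, 0 < e -> exists J, forall j, (J <= j)%N -> dl j <= e &
    forall j, [/\ b j + 1 <= b j.+1 <= b j * (1 + dl j), (0 < N j)%N,
      expR ((b j.+1 - b j) * (s - dl j)) <= (N j)%:R &
      forall U, section (b j) U -> 0 < mass (cball (T U x0) (8 * expR (- b j))) ->
        exists v : 'I_(N j) -> seq 'I_l, children alpha (dl j) x0 (b j) (b j.+1) U v]].
Proof.
move=> Kx0 hs s0 gap.
pose P (dl b b' : R) (N : nat) := [/\ b + 1 <= b' <= b * (1 + dl), (0 < N)%N,
  expR ((b' - b) * (s - dl)) <= N%:R &
  forall U, section b U -> 0 < mass (cball (T U x0) (8 * expR (- b))) ->
    exists v : 'I_N -> seq 'I_l, children alpha dl x0 b b' U v].
have inv_gt0 (n : nat) : 0 < n.+1%:R^-1 :> R by rewrite invr_gt0.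
have ex n : exists l0 : R, forall b, l0 <= b -> exists b' N, P n.+1%:R^-1 b b' N.
  have n2 : 0 < n.+1%:R^-1 / 2 :> R by rewrite divr_gt0.
  have [k k0 hk] := gap _ n2.
  have [l0 hl] := stage Kx0 hs s0 (inv_gt0 n) k0 hk.
  by exists l0.
have [l0 hl0] := choice ex.
(* The bound by the integer part of [b] makes the maximum finite and still lets it tend to infinity.
   The default 0 of an empty maximum is harmless as [l0 0%N <= b0]. *)
pose n (b : R) := (\max_(i < (Num.truncn b).+1 | (l0 i <= b)%R) i)%N.
pose b0 : R := 1 + `|l0 0%N| + `|B|.
have b0B : B < b0.
  by have := normr_ge0 (l0 0%N); have := ler_norm B; rewrite /b0 => h1 h2; lra.
have b01 : 1 <= b0 /\ l0 0%N <= b0.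
  have := normr_ge0 (l0 0%N); have := ler_norm (l0 0%N); have := normr_ge0 B.
  by rewrite /b0 => h1 h2 h3; split; lra.
have nP (b : R) : b0 <= b -> l0 (n b) <= b.
  move=> hb; apply: (big_ind (fun m => l0 m <= b)) => //; first by apply: le_trans hb; exact: b01.2.
  by move=> i j hi hj; rewrite /maxn; case: ifP.
have ex2 (b : R) : exists w : R * nat, b0 <= b -> P (n b).+1%:R^-1 b w.1 w.2.
  have [hb|hb] := leP b0 b; last by exists (0, 0%N).
  by have [b' [N h]] := hl0 _ _ (nP _ hb); exists (b', N).
have [w hw] := choice ex2.
pose b (j : nat) : R := iter j (fun x : R => (w x).1) b0.
have bge j : b0 + j%:R <= b j.
  elim: j => [|j IH]; first by rewrite addr0.
  have : b0 <= b j by apply: le_trans IH; rewrite lerDl.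
  by move=> /hw[/andP[h _] _ _ _]; rewrite -natr1 addrA; apply: le_trans h; rewrite lerD2r.
have b0j j : b0 <= b j by apply: le_trans (bge j); rewrite lerDl.
exists b, (fun j => (n (b j)).+1%:R^-1), (fun j => (w (b j)).2); split.
- by apply: lt_le_trans b01.1.
- exact: b0B.
- move=> e e0; have e1 : 0 < e^-1 by rewrite invr_gt0.
  have M1 := archi_boundP (ltW e1); set M := Num.bound _ in M1.
  have L1 := archi_boundP (normr_ge0 (l0 M)); set L := Num.bound _ in L1.
  exists (maxn M L) => j; rewrite geq_max => /andP[jM jL].
  have hM : M%:R <= b j by apply: le_trans (bge j); rewrite -[leLHS]add0r lerD ?ler_nat //; have := b01.1; lra.
  have hL : l0 M <= b j.
    apply: le_trans (bge j); apply: le_trans (ler_norm _) _; apply: le_trans (ltW L1) _.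
    by rewrite -[leLHS]add0r lerD ?ler_nat //; have := b01.1; lra.
  have Mt : (M < (Num.truncn (b j)).+1)%N.
    have /andP[_ h] := truncn_itv (le_trans (ler0n R M) hM).
    by rewrite -(ltr_nat R); apply: le_lt_trans h.
  have Mn : (M <= n (b j))%N by apply: (leq_bigmax_cond (Ordinal Mt)).
  rewrite -[leRHS]invrK lef_pV2 ?posrE //.
  by apply: le_trans (ltW M1) _; rewrite ler_nat; apply: leqW.
- by move=> j; apply: hw.
Qed.
(** The children are chosen as a function of stage and word, so branches with equal first digits
    share their words and the separation applies where they part. The constant [a] is the weight of
    the root word. *)
Lemma branches (alpha : R) x0 (b dl : nat -> R) (N : nat -> nat) : K x0 ->
  0 < b 0%N -> lev [::] < b 0%N ->
  (forall j U, section (b j) U -> 0 < mass (cball (T U x0) (8 * expR (- b j))) ->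
     exists v : 'I_(N j) -> seq 'I_l, children alpha (dl j) x0 (b j) (b j.+1) U v) ->
  exists (W : (nat -> nat) -> nat -> seq 'I_l) (a : R), [/\ 0 < a,
    forall t, (forall j, t j < N j)%N -> forall j, [/\ section (b j) (W t j),
      exists v, W t j.+1 = W t j ++ v,
      admissible (W t j) (a * expR (- \sum_(i < j) (b i.+1 - b i) * (alpha + dl i))) &
      mass (cball (T (W t j) x0) (8 * expR (- b j))) <=
        expR (- \sum_(i < j) (b i.+1 - b i) * (alpha - dl i))] &
    forall t t' j y z, (forall j, t j < N j)%N -> (forall j, t' j < N j)%N ->
      (forall i, (i < j)%N -> t i = t' i) -> t j <> t' j -> K y -> K z ->
      expR (- b j.+1) <= enorm (T (W t j.+1) y - T (W t' j.+1) z)].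
Proof.
move=> Kx0 b0 lb hc.
have [i0 pi0] := positive_letter.
have [m hU0] := section_extend i0 lb; rewrite cat0s in hU0; set U0 := nseq m i0 in hU0.
have w0 : 0 < weight U0.
  by rewrite /U0; elim: (m) => [|n IH]; rewrite /weight ?big_nil //= big_cons mulr_gt0.
have ex (w : nat * seq 'I_l) : exists v : nat -> seq 'I_l, let: (j, U) := w in
    section (b j) U -> 0 < mass (cball (T U x0) (8 * expR (- b j))) ->
    children alpha (dl j) x0 (b j) (b j.+1) U (fun i : 'I_(N j) => v i).
  case: w => j U; have [hU|] := pselect (section (b j) U); last by exists (fun=> [::]).
  have [mU|] := pselect (0 < mass (cball (T U x0) (8 * expR (- b j)))); last by exists (fun=> [::]).
  have [v hv] := hc j U hU mU.
  (* Digits are natural numbers, so one type of sequences serves all stages; a digit outside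
     ['I_(N j)] gets the empty word. *)
  exists (fun i => if insub i is Some k then v k else [::]) => _ _.
  have e : (fun i : 'I_(N j) => if insub (val i) is Some k then v k else [::]) = v.
    by apply/funext => i; rewrite valK.
  by rewrite e.
have [nx hnx] := choice ex.
pose W := fix W (t : nat -> nat) (j : nat) : seq 'I_l :=
  if j is k.+1 then W t k ++ nx (k, W t k) (t k) else U0.
pose a := weight U0.
have mass_pos j U (c : R) : section (b j) U -> admissible U c -> 0 < c ->
    0 < mass (cball (T U x0) (8 * expR (- b j))).
  move=> [_ hU _] hc' c0; apply: lt_le_trans c0 _.
  apply: admissible_mass hc' (@cball_closed _ _ _ _) _ => x Kx.
  apply: le_trans (word_dist_lev _ Kx Kx0) _.
  apply: le_trans (_ : expR (- b j) <= _); first by rewrite ler_expR lerN2.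
  by rewrite ler_peMl ?expR_ge0 // ler1n.
have inv t : (forall j, t j < N j)%N -> forall j, [/\ section (b j) (W t j),
      admissible (W t j) (a * expR (- \sum_(i < j) (b i.+1 - b i) * (alpha + dl i))) &
      mass (cball (T (W t j) x0) (8 * expR (- b j))) <=
        expR (- \sum_(i < j) (b i.+1 - b i) * (alpha - dl i))].
  move=> ht; elim=> [|j [h1 h2 h3]].
    rewrite !big_ord0 !oppr0 expR0 mulr1; split => //; first exact: admissible_weight.
    by apply: mass_le1; apply: cball_closed.
  have mp := mass_pos _ _ _ h1 h2 (mulr_gt0 w0 (expR_gt0 _)).
  have [c1 c2 c3 _] := hnx (j, W t j) h1 mp.
  pose k := Ordinal (ht j).
  split; first exact: (c1 k).
    rewrite big_ord_recr /= opprD expRD mulrA.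
    by apply: admissible_cat h2 (c2 k).
  apply: le_trans (c3 k) _; rewrite big_ord_recr /= opprD expRD.
  by apply: ler_wpM2r => //; apply: expR_ge0.
exists W, a; split => // [t ht j|t t' j y z ht ht' agree ne Ky Kz].
  have [h1 h2 h3] := inv t ht j; split => //.
  by exists (nx (j, W t j) (t j)).
have e : W t j = W t' j.
  elim: j agree {ne} => [|j IH] agree //=.
  by rewrite -IH => [|i ij]; [rewrite agree|apply: agree; apply: ltnW].
have [h1 h2 h3] := inv t ht j.
have mp := mass_pos _ _ _ h1 h2 (mulr_gt0 w0 (expR_gt0 _)).
have [_ _ _ c4] := hnx (j, W t j) h1 mp.
rewrite /= -e; apply: (c4 (Ordinal (ht j)) (Ordinal (ht' j))) => //.
by apply/eqP => /(congr1 val).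
Qed.
Lemma scale_mono (b : nat -> R) i j : (forall j, b j + 1 <= b j.+1) -> (i <= j)%N ->
  b i + (j - i)%:R <= b j.
Proof.
move=> hb ij; rewrite -{2}(subnKC ij); elim: (j - i)%N => [|n IH]; first by rewrite addn0 addr0.
by rewrite addnS -natr1; have := hb (i + n)%N; lra.
Qed.
Lemma scale_bracket (b : nat -> R) (J : nat) (r : R) : (forall j, b j + 1 <= b j.+1) -> b J <= r ->
  exists j, [/\ (J <= j)%N, b j <= r & r < b j.+1].
Proof.
move=> hb hr; have ex : exists n, r < b n.
  exists (J + Num.bound `|(r - b J)%R|)%N.
  have := scale_mono hb (leq_addr (Num.bound `|(r - b J)%R|) J); rewrite addKn.
  by have := archi_boundP (normr_ge0 (r - b J)); have := ler_norm (r - b J); lra.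
case: (ex_minnP ex) => m rm min.
have Jm : (J < m)%N.
  rewrite ltnNge; apply/negP => mJ; have h := scale_mono hb mJ.
  have : 0 <= (J - m)%:R :> R by [].
  by lra.
case: m Jm rm min => // m Jm rm min; exists m; split => //.
by rewrite leNgt; apply/negP => /min; rewrite ltnn.
Qed.

(** Masses along the scales [b j] suffice since consecutive scales have ratio tending to 1. The
    lower bound is assumed for the radius [expR (1 - b j)], large enough for a ball about the limit
    point to contain the cylinder. *)
Lemma level_of_scales (alpha : R) z (b : nat -> R) : 0 <= alpha -> 0 < b 0%N ->
  (forall j, b j + 1 <= b j.+1) ->
  (forall e : R, 0 < e -> exists J, forall j, (J <= j)%N -> b j.+1 <= b j * (1 + e)) ->
  (forall e : R, 0 < e -> exists J, forall j, (J <= j)%N ->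
     expR (- (b j * (alpha + e))) <= mass (cball z (expR (1 - b j))) /\
     mass (cball z (expR (- b j))) <= expR (- (b j * (alpha - e)))) ->
  level_set nu alpha z.
Proof.
move=> a0 b0 hb slow hm; apply/level_setP => e e0.
pose e4 := e / 4; have e40 : 0 < e4 by rewrite divr_gt0.
pose eta := e4 / (2 * (1 + alpha + e4)).
have den : 0 < 2 * (1 + alpha + e4) by lra.
have eta0 : 0 < eta by rewrite divr_gt0.
have eta1 : eta * (2 * (1 + alpha + e4)) = e4 by rewrite /eta divfK // gt_eqF.
have ea : 0 <= eta * alpha by rewrite mulr_ge0 // ltW.
have ee : 0 <= eta * e4 by rewrite mulr_ge0 // ltW.
have eta2 : eta <= 1 / 2.
  by rewrite /eta ler_pdivrMr //; lra.
have [J1 hJ1] := slow _ eta0; have [J2 hJ2] := hm _ e40.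
exists (b (maxn J1 J2)) => r /(scale_bracket hb)[j [+ bj rj]].
rewrite geq_max => /andP[j1 j2].
have bj0 : 0 < b j.
  by have := scale_mono hb (leq0n j); have : 0 <= (j - 0)%:R :> R by []; lra.
have s1 := hJ1 j j1; have s2 := hJ1 j.+1 (leqW j1).
(* The lower bound is read two stages ahead: [b j.+2 - 1 >= b j.+1 > r], so the ball of radius
   [expR (1 - b j.+2)] lies in that of radius [expR (- r)]. *)
have [_ m1] := hJ2 j j2; have [m2 _] := hJ2 j.+2 (leqW (leqW j2)).
have h1 := hb j; have h2 := hb j.+1.
have r0 : 0 < r by apply: lt_le_trans bj.
have be : b j * eta <= r * eta by rewrite ler_pM2r.
have s3 : b j.+2 <= r * (1 + 3 * eta).
  apply: le_trans s2 _; apply: le_trans (_ : b j * (1 + eta) * (1 + eta) <= _).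
    by apply: ler_wpM2r => //; lra using eta0.
  rewrite -mulrA; apply: le_trans (_ : r * ((1 + eta) * (1 + eta)) <= _).
    by apply: ler_wpM2r => //; apply: mulr_ge0; lra using eta0.
  rewrite ler_pM2l //.
  have : eta * eta <= eta * (1 / 2) by rewrite ler_pM2l.
  by lra using eta0.
apply/andP; split.
  apply: le_trans (_ : expR (- (b j.+2 * (alpha + e4))) <= _).
    rewrite ler_expR lerN2; apply: le_trans (_ : r * (1 + 3 * eta) * (alpha + e4) <= _).
      by apply: ler_wpM2r => //; lra using a0 e40.
    by rewrite -mulrA ler_pM2l //; rewrite /e4 in e40 eta1 ee *; lra using eta0 eta1 ea ee.
  apply: le_trans m2 _; apply: le_mass; [exact: cball_closed|exact: cball_closed|].
  by apply: cballS; rewrite subrr enorm0 add0r ler_expR; lra using rj h2.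
apply: le_trans (_ : mass (cball z (expR (- b j))) <= _).
  apply: le_mass; [exact: cball_closed|exact: cball_closed|].
  by apply: cballS; rewrite subrr enorm0 add0r ler_expR; lra using bj.
apply: le_trans m1 _; rewrite ler_expR lerN2.
have g1 : (r - b j) * alpha <= b j * eta * alpha by apply: ler_wpM2r => //; lra using rj s1.
have g2 : b j * (eta * alpha) <= r * (eta * alpha) by apply: ler_wpM2r.
have g3 : r * (eta * alpha) <= r * e4 by rewrite ler_pM2l //; lra using eta0 eta1 ea ee.
have g4 : b j * e4 <= r * e4 by rewrite ler_pM2r.
have g5 : 0 < r * e4 by rewrite mulr_gt0.
by rewrite (_ : e = 4 * e4); [lra using g1 g2 g3 g4 g5|rewrite /e4; field].
Qed.
Lemma moran_points (alpha s : R) : realized alpha s -> 0 <= s ->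
  (forall dl : R, 0 < dl -> exists2 k : R, 0 < k & ~ realized (alpha - dl) (s - k)) ->
  exists (b : nat -> R) (N : nat -> nat) (z : (nat -> nat) -> 'rV[R]_d), [/\
    [/\ forall j, (0 < N j)%N, forall j, 0 < b j & forall j, b j + 1 <= b j.+1],
    forall e : R, 0 < e -> exists J, forall j, (J <= j)%N -> b j.+1 <= b j * (1 + e),
    forall e : R, 0 < e -> exists J, forall j, (J <= j)%N ->
      expR (b j * (s - e)) <= (\prod_(i < j) N i)%:R,
    forall t, (forall j, t j < N j)%N -> level_set nu alpha (z t) &
    forall t t' j, (forall j, t j < N j)%N -> (forall j, t' j < N j)%N ->
      (forall i, (i < j)%N -> t i = t' i) -> t j <> t' j ->
      expR (- b j.+1) <= enorm (z t - z t')].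
Proof.
move=> hs s0 gap; have [[x0 Kx0] _ _ _] := hK.
have [b [dl [N [b0 lb dl0 hb]]]] := schedule (lev [::]) Kx0 hs s0 gap.
have b1 j : b j + 1 <= b j.+1 by have [/andP[]] := hb j.
have bpos j : 0 < b j.
  by have := scale_mono b1 (leq0n j); have : 0 <= (j - 0)%:R :> R by []; lra.
have step j U : section (b j) U -> 0 < mass (cball (T U x0) (8 * expR (- b j))) ->
    exists v : 'I_(N j) -> seq 'I_l, children alpha (dl j) x0 (b j) (b j.+1) U v.
  by have [_ _ _] := hb j; apply.
have [W [a [a0 hW sep]]] := branches Kx0 b0 lb step.
have ext t : (forall j, t j < N j)%N -> forall i j, (i <= j)%N -> exists v, W t j = W t i ++ v.
  move=> ht i j /subnKC <-; elim: (j - i)%N => [|n [v hv]].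
    by exists [::]; rewrite addn0 cats0.
  rewrite addnS; have [_ [v' ->] _ _] := hW t ht (i + n)%N.
  by exists (v ++ v'); rewrite hv catA.
have cyl t j y z : (forall j, t j < N j)%N -> K y -> K z ->
    enorm (T (W t j) y - T (W t j) z) <= expR (- b j).
  move=> ht Ky Kz; have [[_ h _] _ _ _] := hW t ht j.
  by apply: le_trans (word_dist_lev _ Ky Kz) _; rewrite ler_expR lerN2.
have lim t : exists z, (forall j, t j < N j)%N -> forall j, enorm (z - T (W t j) x0) <= expR (- b j).
  have [ht|] := pselect (forall j, t j < N j)%N; last by exists 0.
  have [||z hz] := @limit_point (fun j => T (W t j) x0) (fun j => expR (- b j)).
  - by move=> j; apply: word_attractor.
  - move=> i j ij /=; have [v ->] := ext t ht _ _ ij.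
    by rewrite word_cat; apply: cyl => //; apply: word_attractor.
  - by exists z.
have [z hz] := choice lim.
exists b, N, z; split.
- by split=> // j; have [] := hb j.
- move=> e e0; have [J hJ] := dl0 e e0; exists J => j Jj.
  have [/andP[_ h] _ _ _] := hb j; apply: le_trans h _.
  by rewrite ler_pM2l // lerD2l hJ.
(* The deficit against the exponent [s] grows by [(b j.+1 - b j) * dl j] per stage, so [slow_growth]
   makes it [o(b j)]. The two mass exponents are treated alike with [c1] and [c2]. *)
- move=> e e0; pose c j := b j * s - \sum_(i < j) (b i.+1 - b i) * (s - dl i).
  have [|J hJ] := slow_growth b1 dl0 (c := c) _ e0.
    by move=> j; rewrite /c big_ord_recr /=; lra.
  exists J => j Jj; apply: le_trans (_ : expR (\sum_(i < j) (b i.+1 - b i) * (s - dl i)) <= _).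
    by rewrite ler_expR; have := hJ j Jj; rewrite /c; lra.
  rewrite {Jj}; elim: j => [|j IH]; first by rewrite !big_ord0 expR0.
  rewrite !big_ord_recr /= expRD natrM; have [_ _ h _] := hb j.
  by apply: ler_pM => //; apply: expR_ge0.
- move=> t ht; apply: (level_of_scales (b := b)) => //.
  + exact: realized_ge0 hs.
  + move=> e e0; have [J hJ] := dl0 e e0; exists J => j Jj.
    have [/andP[_ h] _ _ _] := hb j; apply: le_trans h _.
    by rewrite ler_pM2l // lerD2l hJ.
  + move=> e e0.
    pose c1 j := - ln a + \sum_(i < j) (b i.+1 - b i) * (alpha + dl i) - b j * alpha.
    pose c2 j := b j * alpha - \sum_(i < j) (b i.+1 - b i) * (alpha - dl i).
    have [|J1 h1] := slow_growth b1 dl0 (c := c1) _ e0.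
      by move=> j; rewrite /c1 big_ord_recr /=; lra.
    have [|J2 h2] := slow_growth b1 dl0 (c := c2) _ e0.
      by move=> j; rewrite /c2 big_ord_recr /=; lra.
    exists (maxn J1 J2) => j; rewrite geq_max => /andP[j1 j2].
    have [_ _ adm mle] := hW t ht j; have hzj := hz t ht j; split.
      apply: le_trans (_ : a * expR (- \sum_(i < j) (b i.+1 - b i) * (alpha + dl i)) <= _).
        rewrite -[a in leRHS]lnK // -expRD ler_expR.
        by have := h1 j j1; rewrite /c1; lra using.
      apply: admissible_mass adm (@cball_closed _ _ _ _) _ => x Kx.
      have k1 := cyl t j _ _ ht Kx Kx0.
      have k2 := enorm_triangle (T (W t j) x0) (T (W t j) x) (z t).
      rewrite (enormB (T (W t j) x0)) in k2.
      rewrite /cball /= expRD; apply: le_trans k2 _.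
      apply: le_trans (_ : 2 * expR (- b j) <= _); first by lra.
      by rewrite ler_pM2r ?expR_gt0 //; apply: le_trans (expR_ge1Dx _); lra using.
    apply: le_trans (_ : expR (- \sum_(i < j) (b i.+1 - b i) * (alpha - dl i)) <= _); last first.
      by rewrite ler_expR; have := h2 j j2; rewrite /c2; lra using.
    apply: le_trans mle; apply: le_mass; [exact: cball_closed|exact: cball_closed|].
    by apply: cballS; have := expR_gt0 (- b j); lra.
- move=> t t' j ht ht' agree ne.
  suff near (e : R) : 0 < e -> expR (- b j.+1) <= e + enorm (z t - z t').
    by apply/ler_addgt0Pl => e e0; apply: near.
  (* Separation holds between points of the cylinders of [W t n]; the limit points are within
     [e / 2] of these for large [n]. *)
  move=> e0; pose n := (j.+1 + Num.bound `|ln (e / 2)|)%N.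
  have jn : (j.+1 <= n)%N by apply: leq_addr.
  have small : expR (- b n) <= e / 2.
    have e2 : 0 < e / 2 by rewrite divr_gt0.
    rewrite -[leRHS]lnK // ler_expR.
    have k1 := scale_mono b1 jn; rewrite addKn in k1.
    have k2 := archi_boundP (normr_ge0 (ln (e / 2))).
    have k3 := ler_norm (- ln (e / 2)); rewrite normrN in k3.
    by have k4 := bpos j.+1; lra using k1 k2 k3 k4.
  have [v hv] := ext t ht _ _ jn; have [v' hv'] := ext t' ht' _ _ jn.
  have h := sep t t' j _ _ ht ht' agree ne (word_attractor v Kx0) (word_attractor v' Kx0).
  rewrite -!word_cat -hv -hv' in h.
  have h1 := hz t ht n; have h2 := hz t' ht' n; rewrite enormB in h1.
  have h3 := enorm_triangle (z t) (T (W t n) x0) (T (W t' n) x0).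
  have h4 := enorm_triangle (z t') (z t) (T (W t' n) x0).
  by lra using small h h1 h2 h3 h4.
Qed.
(* A cover of [E] pulls back to a cover of [[0, 1[] by intervals of length [2 C diam^s]. *)
Lemma holder_param (E : set 'rV[R]_d) (phi : R -> 'rV[R]_d) (s C : R) : 0 < s -> 0 < C ->
  (forall t, 0 <= t < 1 -> E (phi t)) ->
  (forall t t', 0 <= t < 1 -> 0 <= t' < 1 -> `|t - t'| <= C * enorm (phi t - phi t') `^ s) ->
  hausdorff_measure s E != 0%E.
Proof.
move=> s0 C0 hE hphi; apply/eqP => h0.
(* With this bound on the content, the intervals that cover [[0, 1[] have total length less than
   [2 * C / (4 * C) = 1 / 2]. *)
have c4 : 0 < (4 * C)^-1 by rewrite invr_gt0 mulr_gt0.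
have : (hausdorff_content s 1 E < (4 * C)^-1%:E)%E.
  apply: le_lt_trans (_ : 0%E < _)%E; last by rewrite lte_fin.
  by rewrite -h0; apply: ereal_sup_ubound; exists 1 => //=.
move=> /ereal_inf_lt[_ [F [EF dF] <-] hF].
pose D k := fine (diam (F k)).
have DE k : diam (F k) = (D k)%:E.
  by rewrite fineK // ge0_fin_numE ?diam_ge0 //; apply: le_lt_trans (dF k) (ltry _).
have D0 k : 0 <= D k by rewrite -lee_fin -DE diam_ge0.
have ex k : exists t : R, forall t', 0 <= t' < 1 -> F k (phi t') -> `|t - t'| <= C * D k `^ s.
  have [[t [t01 Ft]]|hn] := pselect (exists t, 0 <= t < 1 /\ F k (phi t)); last first.
    by exists 0 => t' h1 h2; exfalso; apply: hn; exists t'.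
  exists t => t' t'01 Ft'; apply: le_trans (hphi _ _ t01 t'01) _.
  rewrite ler_pM2l //; apply: ge0_ler_powR; rewrite ?nnegrE ?enorm_ge0 //; first exact: ltW.
  by rewrite -lee_fin -DE; apply: ereal_sup_ubound; right; exists (phi t, phi t').
have [c hc] := choice ex.
pose I k := `[c k - C * D k `^ s, c k + C * D k `^ s]%classic.
have mI k : lebesgue_measure (I k) = ((2 * C)%:E * diam (F k) `^ s)%E.
  rewrite DE poweR_EFin -EFinM /I lebesgue_measure_itv /= lte_fin.
  have : 0 <= C * D k `^ s by rewrite mulr_ge0 ?powR_ge0 // ltW.
  rewrite le_eqVlt => /orP[/eqP e|h].
    by rewrite -e subr0 addr0 ltxx -mulrA -e mulr0.
  by rewrite ifT ?EFinN -?EFinB; [congr EFin; ring|lra].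
have : (lebesgue_measure (`[0%R, 1%R[%classic : set R) <= \sum_(0 <= k <oo) lebesgue_measure (I k))%E.
  apply: measure_sigma_subadditive => //; first by move=> k; apply: measurable_itv.
  move=> t /=; rewrite in_itv /= => t01; have [k _ Fk] := EF _ (hE t t01).
  exists k => //; rewrite /I /= in_itv /=; have := hc k t t01 Fk.
  by rewrite ler_norml => /andP[h1 h2]; apply/andP; split; lra.
rewrite (eq_eseriesr (fun k _ => mI k)) nneseriesZl; last by move=> k _; exact: poweR_ge0.
rewrite lebesgue_measure_itv /= lte_fin ltr01 oppr0 adde0 => h1.
have : (1 < 1%:E :> \bar R)%E.
  apply: le_lt_trans h1 _; apply: lt_le_trans (_ : (2 * C)%:E * (4 * C)^-1%:E <= _)%E.
    by rewrite lte_pmul2l // lte_fin mulr_gt0.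
  rewrite -EFinM lee_fin ler_pdivrMr ?mulr_gt0 //; lra.
by rewrite ltxx.
Qed.

(* [dg t] is the expansion of [t] in the mixed base [N]. *)
Lemma digits (N : nat -> nat) : (forall j, 0 < N j)%N ->
  exists dg : R -> nat -> nat, (forall t, 0 <= t < 1 -> forall j, (dg t j < N j)%N) /\
  forall t t' j, 0 <= t < 1 -> 0 <= t' < 1 -> (forall i, (i < j)%N -> dg t i = dg t' i) ->
    `|t - t'| * (\prod_(i < j) N i)%:R <= 1.
Proof.
move=> N0.
(* [u t j] is the fractional part left after [j] digits. Each common digit multiplies the difference
   of two such remainders by [N j]. *)
pose u := fix u (t : R) (j : nat) : R :=
  if j is k.+1 then (N k)%:R * u t k - (Num.truncn ((N k)%:R * u t k))%:R else t.
have u01 t j : 0 <= t < 1 -> 0 <= u t j < 1.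
  move=> t01; elim: j => //= j /andP[h1 h2].
  have /andP[k1 k2] := truncn_itv (mulr_ge0 (ler0n R (N j)) h1).
  by move: k2; rewrite -natr1 => k2; apply/andP; split; lra.
exists (fun t j => Num.truncn ((N j)%:R * u t j)); split.
  move=> t t01 j; have /andP[h1 h2] := u01 t j t01.
  have /andP[k1 _] := truncn_itv (mulr_ge0 (ler0n R (N j)) h1).
  rewrite -(ltr_nat R); apply: le_lt_trans k1 _.
  by rewrite -[ltRHS]mulr1 ltr_pM2l // ltr0n.
move=> t t' j t01 t'01 agree.
have -> : `|t - t'| * (\prod_(i < j) N i)%:R = `|u t j - u t' j|.
  elim: j agree => [|j IH] agree; first by rewrite big_ord0 mulr1.
  rewrite big_ord_recr natrM mulrA IH => [|i ij]; last by apply: agree; apply: ltnW.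
  have -> : u t j.+1 - u t' j.+1 = (N j)%:R * (u t j - u t' j).
    by rewrite /= (agree j (ltnSn j)); ring.
  by rewrite normrM mulrC ger0_norm.
have /andP[a1 a2] := u01 t j t01; have /andP[b1 b2] := u01 t' j t'01.
by rewrite ler_norml; apply/andP; split; lra.
Qed.
(** If the digits of [t] and [t'] first differ at [j], then [|t - t'|] is at most about
    [exp (- b j s)], while the points are at least [exp (- b j.+1)] apart. As [b j.+1 / b j] tends
    to 1, the inverse is Holder of every exponent [s' < s]. *)
Lemma dimH_level_ge (alpha s : R) : realized alpha s -> 0 <= s ->
  (forall dl : R, 0 < dl -> exists2 k : R, 0 < k & ~ realized (alpha - dl) (s - k)) ->
  level_set nu alpha !=set0 /\ (s%:E <= dimH (level_set nu alpha))%E.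
Proof.
move=> hs s0 gap.
have [b [N [z [[N0 b0 b1] slow hN hz sep]]]] := moran_points hs s0 gap.
split; first by exists (z (fun=> 0%N)); apply: hz.
apply: le_ereal_inf_tmp => _ [s' [s'0 hH] <-]; rewrite lee_fin leNgt; apply/negP => s's.
have sp : 0 < s by apply: lt_trans s's.
pose e := (s - s') / 2; have e0 : 0 < e by rewrite divr_gt0 // subr_gt0.
(* Then [(1 + eta) * s' <= s' + e = s - e], so the growth of the scale fits between [s'] and [s]. *)
pose eta := e / s; have eta0 : 0 < eta by rewrite divr_gt0.
have [J1 hJ1] := slow _ eta0; have [J2 hJ2] := hN _ e0.
pose J := maxn J1 J2.
have [dg [dgN hdg]] := digits N0.
(* This constant takes care of the pairs that already part at a stage before [J]. *)
pose C := expR (b J * s').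
have C1 : 1 <= C by rewrite -expR0 ler_expR mulr_ge0 // ltW.
have se : 0 < s - e by rewrite /e; lra.
have es : eta * s' <= e.
  apply: le_trans (_ : eta * s <= _); first by rewrite ler_pM2l // ltW.
  by rewrite /eta divfK // gt_eqF.
suff main (t t' : R) : 0 <= t < 1 -> 0 <= t' < 1 ->
    `|t - t'| <= C * enorm (z (dg t) - z (dg t')) `^ s'.
  have := holder_param s'0 (lt_le_trans ltr01 C1) (phi := fun t => z (dg t)) _ main.
  by move=> /(_ (level_set nu alpha)); rewrite hH eqxx => h; apply: notF; apply: h => t /dgN /hz.
move=> t01 t'01.
(* Equal digits at all stages force [t = t'], because the products of the [N i] are unbounded when
   [s - e > 0]. *)
have [[j0 hj0]|same] := pselect (exists j, dg t j != dg t' j); last first.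
  have agree j i : (i < j)%N -> dg t i = dg t' i.
    by move=> _; apply: contrapT => h; apply: same; exists i; apply/eqP.
  apply: le_trans (_ : 0 <= _); last by rewrite mulr_ge0 ?powR_ge0 // ltW // (lt_le_trans ltr01).
  rewrite leNgt; apply/negP => tt; set w := `|t - t'| in tt.
  have ws : 0 < w * (s - e) by rewrite mulr_gt0.
  have wi : 0 <= (w * (s - e))^-1 by rewrite invr_ge0 ltW.
  have hn := archi_boundP wi; set n := Num.bound _ in hn.
  have h1 := hdg t t' (maxn n J2) t01 t'01 (agree _).
  have h2 := hJ2 _ (leq_maxr n J2).
  have h3 : w * (b (maxn n J2) * (s - e)) <= 1.
    apply: le_trans h1; rewrite ler_pM2l //; apply: le_trans h2.
    by apply: le_trans (expR_ge1Dx _); lra using.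
  have h4 : n%:R <= b (maxn n J2).
    have := scale_mono b1 (leq0n (maxn n J2)); rewrite subn0.
    have : n%:R <= (maxn n J2)%:R :> R by rewrite ler_nat leq_maxl.
    by have := b0 0%N; lra using.
  have h5 : (w * (s - e))^-1 < b (maxn n J2) by apply: lt_le_trans h4.
  have : 1 < b (maxn n J2) * (w * (s - e)) by rewrite -ltr_pdivrMr // div1r.
  by move: h3; rewrite mulrCA; lra.
have ex : exists j, dg t j != dg t' j by exists j0.
case: (ex_minnP ex) => j /eqP nej min.
have agree i : (i < j)%N -> dg t i = dg t' i.
  by move=> ij; apply/eqP; apply: contraTT ij => h; rewrite -leqNgt; apply: min.
have h1 := sep _ _ j (dgN t t01) (dgN t' t'01) agree nej.
apply: le_trans (_ : C * expR (- b j.+1 * s') <= _); last first.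
  rewrite ler_pM2l ?(lt_le_trans ltr01) // expRM.
  by apply: ge0_ler_powR; rewrite ?nnegrE ?enorm_ge0 ?expR_ge0 // ltW.
have [jJ|Jj] := ltnP j J.
  apply: le_trans (_ : 1 <= _).
    have /andP[a1 a2] := t01; have /andP[a3 a4] := t'01.
    by rewrite ler_norml; apply/andP; split; lra using a1 a2 a3 a4.
  rewrite -expRD -expR0 ler_expR mulNr -mulrBl mulr_ge0 ?(ltW s'0) // subr_ge0.
  have := scale_mono b1 jJ; have : 0 <= (J - j.+1)%:R :> R by [].
  by lra using.
apply: le_trans (_ : expR (- b j.+1 * s') <= _); last by rewrite ler_peMl // expR_ge0.
move: Jj; rewrite geq_max => /andP[j1 j2].
have h2 := hdg t t' j t01 t'01 agree; have h3 := hJ2 j j2.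
apply: le_trans (_ : expR (- (b j * (s - e))) <= _).
  rewrite expRN -[leRHS]mul1r ler_pdivlMr ?expR_gt0 //; apply: le_trans h2.
  by apply: ler_wpM2l.
rewrite ler_expR mulNr lerN2; apply: le_trans (_ : b j * (1 + eta) * s' <= _).
  by apply: ler_wpM2r; [exact: ltW|exact: hJ1].
by rewrite -mulrA ler_pM2l // mulrDl mul1r; rewrite /e in es *; lra using es.
Qed.

(** * Hausdorff null sets and the upper bound of the dimension *)

Lemma diam_set0 : diam (set0 : set 'rV[R]_d) = 0%E.
Proof.
by apply/eqP; rewrite eq_le diam_ge0 andbT; apply/diam_leP; split.
Qed.

Lemma hausdorff_content_ge0 (s dl : R) (A : set 'rV[R]_d) : (0 <= hausdorff_content s dl A)%E.
Proof.
apply: le_ereal_inf_tmp => _ [F _ <-]; apply: nneseries_ge0 => k _ _; exact: poweR_ge0.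
Qed.

Lemma hausdorff_measure_eq0 (s : R) (A : set 'rV[R]_d) :
  (forall dl e : R, 0 < dl -> 0 < e -> (hausdorff_content s dl A <= e%:E)%E) ->
  hausdorff_measure s A = 0%E.
Proof.
move=> h; apply/eqP; rewrite eq_le; apply/andP; split.
  apply: ge_ereal_sup => _ [dl /= dl0 <-]; apply/lee_addgt0Pr => e e0.
  by rewrite add0e; apply: h.
apply: le_trans (hausdorff_content_ge0 s 1 A) _.
by apply: ereal_sup_ubound; exists 1 => //=.
Qed.
Lemma hausdorff_null_bigcup (s : R) (A : set 'rV[R]_d) (E : nat -> set 'rV[R]_d) :
  A `<=` \bigcup_k E k -> (forall k, hausdorff_measure s (E k) = 0%E) ->
  hausdorff_measure s A = 0%E.
Proof.
move=> AE hE; apply: hausdorff_measure_eq0 => dl e dl0 e0.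
have cov k : exists F : nat -> set 'rV[R]_d, [/\ E k `<=` \bigcup_i F i,
    forall i, (diam (F i) <= dl%:E)%E &
    (\sum_(0 <= i <oo) diam (F i) `^ s <= (e / (2 ^ k.+1)%:R)%:E)%E].
  have ek : 0 < e / (2 ^ k.+1)%:R by rewrite divr_gt0 // ltr0n expn_gt0.
  have : (hausdorff_content s dl (E k) < (e / (2 ^ k.+1)%:R)%:E)%E.
    apply: (@le_lt_trans _ _ 0%E); last by rewrite lte_fin.
    by rewrite -(hE k); apply: ereal_sup_ubound; exists dl.
  by move=> /ereal_inf_lt[_ [F [h1 h2] <-] h3]; exists F; split => //; apply: ltW.
have [F hF] := choice cov.
have /card_set_bijP[f bf] : ([set: nat] #= [set: nat * nat])%card.
  by rewrite card_eq_sym; exact: card_nat2.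
apply: (@le_trans _ _ (\sum_(0 <= n <oo) diam (F (f n).1 (f n).2) `^ s)%E).
  apply: ereal_inf_lbound; exists (fun n => F (f n).1 (f n).2) => //; split.
    move=> x /AE[k _ Ek]; have [h1 _ _] := hF k; have [i _ Fi] := h1 x Ek.
    have [_ _ /(_ (k, i) I)[n _ fn]] := bf.
    by exists n => //; rewrite fn.
  by move=> n; have [_ h _] := hF (f n).1.
have pos k i : (0 <= diam (F k i) `^ s)%E by apply: poweR_ge0.
rewrite nneseries_esumT; last by move=> n; apply: pos.
rewrite -(@reindex_esum R _ _ setT setT f (fun w : nat * nat => (diam (F w.1 w.2) `^ s)%E) bf).
have -> : [set: nat * nat] = [set: nat] `*`` (fun=> [set: nat]).
  by apply/seteqP; split => -[].
rewrite -(@esum_esum R _ _ setT (fun=> setT) (fun k i => (diam (F k i) `^ s)%E)) //.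
rewrite -nneseries_esumT; last by move=> k; apply: esum_ge0.
apply: (@le_trans _ _ (\sum_(0 <= k <oo) (e / (2 ^ k.+1)%:R)%:E)%E); last exact/epsilon_trick0/ltW.
apply: lee_nneseries => [k _ _|k _]; first exact: esum_ge0.
by rewrite -nneseries_esumT //; have [_ _] := hF k.
Qed.

Lemma hausdorff_null_finite_covers (s : R) (A : set 'rV[R]_d) : 0 < s ->
  (forall dl e : R, 0 < dl -> 0 < e -> exists (n : nat) (c : nat -> 'rV[R]_d) (r : R),
     [/\ 0 <= r, 2 * r <= dl, n%:R * (2 * r) `^ s <= e &
      forall x, A x -> exists2 i, (i < n)%N & cball (c i) r x]) ->
  hausdorff_measure s A = 0%E.
Proof.
move=> s0 h; apply: hausdorff_measure_eq0 => dl e dl0 e0.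
have [n [c [r [r0 rdl rs hA]]]] := h dl e dl0 e0.
(* The cover is padded with empty sets, which contribute 0 because [s > 0]. *)
pose F i := if (i < n)%N then cball (c i) r else set0.
have dF i : (diam (F i) <= (2 * r)%:E)%E.
  rewrite /F; case: ifP => _; last by rewrite diam_set0 lee_fin mulr_ge0.
  apply/diam_leP; split; first by rewrite mulr_ge0.
  move=> x y hx hy; apply: le_trans (enorm_triangle (c i) _ _) _.
  by rewrite mulr2n mulrDl mul1r (enormB (c i)); apply: lerD.
apply: (@le_trans _ _ (\sum_(0 <= i <oo) diam (F i) `^ s)%E).
  apply: ereal_inf_lbound; exists F => //; split.
    by move=> x /hA[i ni ci]; exists i => //; rewrite /F ni.
  by move=> i; apply: le_trans (dF i) _; rewrite lee_fin.
rewrite (nneseries_split 0 n) => [|k _]; last exact: poweR_ge0.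
rewrite eseries0 ?adde0 => [|i ni _]; last by rewrite /F ltnNge ni diam_set0 poweR0r // gt_eqF.
apply: le_trans (_ : (\sum_(0 <= i < 0 + n) ((2 * r) `^ s)%:E)%E <= _)%E.
  apply: lee_sum => i _; rewrite -poweR_EFin.
  by apply: gt0_ler_poweR; rewrite ?in_itv /= ?diam_ge0 ?lee_fin ?mulr_ge0 ?leey // ltW.
by rewrite sumEFin lee_fin sumr_const_nat subn0 add0n -[leLHS]mulr_natl.
Qed.
Lemma maximal_separated (A : set 'rV[R]_d) (r : R) (B : nat) :
  (forall s : seq 'rV[R]_d, (forall x, x \in s -> A x) ->
     pairwise (fun x y => r < enorm (x - y)) s -> (size s <= B)%N) ->
  exists s : seq 'rV[R]_d, [/\ (forall x, x \in s -> A x),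
    pairwise (fun x y => r < enorm (x - y)) s &
    forall x, A x -> exists2 i, (i < size s)%N & cball (nth 0 s i) r x].
Proof.
move=> hB.
pose P n := `[< exists s : seq 'rV[R]_d, [/\ size s = n, (forall x, x \in s -> A x) &
  pairwise (fun x y => r < enorm (x - y)) s] >].
have ex : exists n, P n by exists 0%N; apply/asboolP; exists [::].
have ub n : P n -> (n <= B)%N by move=> /asboolP[s [<- h1 h2]]; apply: hB.
case: (ex_maxnP ex ub) => n /asboolP[s [sn sA sp]] max.
exists s; split => // x Ax; apply: contrapT => hn.
have /max : P n.+1.
  apply/asboolP; exists (x :: s); split; first by rewrite /= sn.
    by move=> y; rewrite inE => /orP[/eqP ->|/sA].
  rewrite /= sp andbT; apply/allP => y /(nthP 0)[i si <-]; rewrite ltNge; apply/negP => h.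
  by apply: hn; exists i.
by rewrite ltnn.
Qed.

(** For each [e > 0] the level set is contained in the union of these sets over natural [k], and on
    each of them one radius serves all points. *)
Definition uniform_level (alpha e k : R) : set 'rV[R]_d := [set x | forall r, k <= r ->
  expR (- (r * (alpha + e))) <= mass (cball x (expR (- r))) <= expR (- (r * (alpha - e)))].

Lemma uniform_level_support (alpha e k : R) x : uniform_level alpha e k x -> msupport nu x.
Proof.
move=> hx; apply: positive_support => r r0.
have /hx/andP[h _] : k <= Num.max k (- ln r) by rewrite le_max lexx.
apply: lt_le_trans (lt_le_trans (expR_gt0 _) h) _.
apply: le_mass; [exact: cball_closed|exact: cball_closed|apply: cballS].
by rewrite subrr enorm0 add0r -[leRHS]lnK // ler_expR lerNl le_max lexx orbT.
Qed.
(** The mass is controlled from both sides, so its [q]-th power is at least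
    [exp (- r (alpha q + |q| e))] for either sign of [q]. *)
Lemma uniform_level_count (alpha e k q t r : R) (s : seq 'rV[R]_d) : k <= r -> 0 <= r ->
  (Lq_sum nu q (expR (- r)) <= (expR (- (r * t)))%:E)%E ->
  (forall x, x \in s -> uniform_level alpha e k x) ->
  pairwise (fun x y => 2 * expR (- r) < enorm (x - y)) s ->
  (size s)%:R <= expR (r * (alpha * q - t + `|q| * e)).
Proof.
move=> kr r0 hL sA sp.
pose f (i : 'I_(size s)) := nth 0 s i.
have fA i : uniform_level alpha e k (f i) by apply: sA; apply: mem_nth.
have sep : separated_in f (expR (- r)).
  split=> [i|i j]; first exact: uniform_level_support (fA i).
  have lt (a b : 'I_(size s)) : (a < b)%N -> 2 * expR (- r) < enorm (f a - f b).
    by move=> ab; move/(pairwiseP 0): sp; apply; rewrite ?inE.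
  rewrite neq_ltn => /orP[/lt //|/lt]; by rewrite enormB.
have := le_trans (Lq_sum_ge q (expR_ge0 _) sep) hL; rewrite lee_fin => h.
have h1 : (size s)%:R * expR (- (r * (alpha * q + `|q| * e))) <= expR (- (r * t)).
  apply: le_trans h; rewrite -[X in X%:R]card_ord -sum1_card natr_sum mulr_suml.
  apply: ler_sum => i _; rewrite mul1r.
  have /andP[m1 m2] := fA i r kr.
  have m0 := lt_le_trans (expR_gt0 _) m1.
  move: m1 m2; rewrite -[mass _]lnK // -expRM !ler_expR; set w := ln _ => m1 m2.
  have : `|(w + r * alpha) * q| <= r * e * `|q|.
    rewrite normrM; apply: ler_wpM2r; first exact: normr_ge0.
    by rewrite ler_norml; apply/andP; split; lra using m1 m2.
  by rewrite ler_norml => /andP[k1 _]; lra using k1.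
have -> : r * (alpha * q - t + `|q| * e) = - (r * t) - - (r * (alpha * q + `|q| * e)) by ring.
by rewrite expRD [X in _ * X]expRN ler_pdivlMr ?expR_gt0.
Qed.
Lemma level_null (alpha q t s : R) : (t%:E < Lq_spectrum nu q)%E -> alpha * q - t < s -> 0 < s ->
  hausdorff_measure s (level_set nu alpha) = 0%E.
Proof.
move=> ht hs s0; have [L0 hL] := spectrum_gt ht.
pose g := s - (alpha * q - t); have g0 : 0 < g by rewrite subr_gt0.
have q1 : 0 < 1 + `|q| by have := normr_ge0 q; lra.
(* Half of the gap [g] pays for [|q| * e]; the other half beats the constant [4 ^ s] from the
   diameters as [r] grows. *)
pose e := g / (2 * (1 + `|q|)).
have e0 : 0 < e by rewrite divr_gt0 // mulr_gt0.
have qe : `|q| * e <= g / 2.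
  have : (1 + `|q|) * e = g / 2 by rewrite /e; field; rewrite gt_eqF.
  by lra.
apply: (hausdorff_null_bigcup (E := fun k : nat => uniform_level alpha e k%:R)).
  move=> x /level_setP/(_ e e0)[L hx]; exists (Num.bound `|L|) => // r hr.
  apply: hx; apply: le_trans hr; apply: le_trans (ler_norm _) _.
  exact/ltW/archi_boundP/normr_ge0.
move=> k; apply: hausdorff_null_finite_covers => // dl eta dl0 eta0.
have c4 : 0 < 4 :> R by lra.
pose r : R := k%:R + `|L0| + `|ln 4 - ln dl| + `|s * ln 4 - ln eta| / (g / 2).
have [kr Lr dr er] : [/\ k%:R <= r, L0 <= r, ln 4 - ln dl <= r & s * ln 4 - ln eta <= r * (g / 2)].
  have n1 := normr_ge0 L0; have n2 := normr_ge0 (ln 4 - ln dl).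
  have n3 : 0 <= `|s * ln 4 - ln eta| / (g / 2) by rewrite divr_ge0 // divr_ge0 // ltW.
  have k1 := ler_norm L0; have k2 := ler_norm (ln 4 - ln dl).
  have k3 := ler_norm (s * ln 4 - ln eta); have n0 : 0 <= k%:R :> R by [].
  split; rewrite /r; [lra using n1 n2 n3|lra using n0 n2 n3 k1|lra using n0 n1 n3 k2|].
  rewrite -ler_pdivrMr ?divr_gt0 //.
  apply: le_trans (_ : `|s * ln 4 - ln eta| / (g / 2) <= _); last by lra using n0 n1 n2.
  by rewrite ler_pM2r // invr_gt0 divr_gt0.
have r0 : 0 <= r by apply: le_trans kr.
have count := uniform_level_count (alpha := alpha) (e := e) kr r0 (hL r Lr).
have [|c [cA cp cov]] := @maximal_separated (uniform_level alpha e k%:R) (2 * expR (- r))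
  (Num.truncn (expR (r * (alpha * q - t + `|q| * e)))).
  by move=> c' cA cp; have := count c' cA cp => h; rewrite truncn_ge_nat // expR_ge0.
have e4 : 2 * (2 * expR (- r)) = expR (ln 4 - r).
  by rewrite expRD lnK // mulrA; congr (_ * _); ring.
exists (size c), (fun i => nth 0 c i), (2 * expR (- r)); split => //.
- by rewrite e4 -[leRHS]lnK // ler_expR; lra using dr.
- rewrite e4 -expRM; apply: le_trans (ler_wpM2r (expR_ge0 _) (count c cA cp)) _.
  rewrite -expRD -[leRHS]lnK // ler_expR.
  have : r * (`|q| * e) <= r * (g / 2) by apply: ler_wpM2l.
  have -> : alpha * q - t + `|q| * e = s - g + `|q| * e by rewrite /g; ring.
  by move=> h; lra using er h.
Qed.

(** [dimH] only tests positive exponents and vanishes on the empty set, so [alpha * q] must be at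
    least the spectrum. One point of the level set gives this: it is a packing by a single ball at
    every fine scale. *)
Lemma dimH_level_le (alpha q : R) : level_set nu alpha !=set0 ->
  (dimH (level_set nu alpha) <= (alpha * q)%:E - Lq_spectrum nu q)%E.
Proof.
move=> [x hx].
have le_t t : (t%:E < Lq_spectrum nu q)%E -> t <= alpha * q.
  move=> ht; rewrite leNgt; apply/negP => lt.
  have [L0 hL] := spectrum_gt ht.
  have q1 : 0 < 1 + `|q| by have := normr_ge0 q; lra.
  pose e := (t - alpha * q) / (1 + `|q|).
  have e0 : 0 < e by rewrite divr_gt0 // subr_gt0.
  have qe : `|q| * e < t - alpha * q.
    have : (1 + `|q|) * e = t - alpha * q by rewrite /e; field; rewrite gt_eqF.
    by lra using e0.
  have /level_setP/(_ e e0)[L hL'] := hx.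
  pose r := 1 + `|L| + `|L0|.
  have [r1 r2 r3] : [/\ L <= r, L0 <= r & 0 < r].
    have n1 := normr_ge0 L; have n2 := normr_ge0 L0; have k1 := ler_norm L; have k2 := ler_norm L0.
    by split; rewrite /r; lra using n1 n2 k1 k2.
  have := @uniform_level_count alpha e L q t r [:: x] r1 (ltW r3) (hL r r2).
  rewrite /= -expR0 ler_expR => h; have : 0 <= r * (alpha * q - t + `|q| * e).
    by apply: h => // y; rewrite inE => /eqP ->.
  by rewrite pmulr_rge0 //; lra using qe.
case E : (Lq_spectrum nu q) le_t => [tau| |] le_t.
- apply/lee_addgt0Pr => e e0; apply: ereal_inf_lbound; exists (alpha * q - tau + e) => //.
  have tau_le : tau <= alpha * q.
    rewrite leNgt; apply/negP => h; have := le_t ((tau + alpha * q) / 2).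
    by rewrite lte_fin => h'; have := h' ltac:(lra); lra.
  split; first by lra.
  by apply: (@level_null _ q (tau - e / 2)); rewrite ?E ?lte_fin; lra.
- by exfalso; have := le_t (alpha * q + 1) (ltry _); lra.
- by have -> : ((alpha * q)%:E - -oo = +oo)%E by []; exact: leey.
Qed.
Lemma dimH_ge0 (A : set 'rV[R]_d) : (0 <= dimH A)%E.
Proof. by apply: le_ereal_inf_tmp => _ [s [s0 _] <-]; rewrite lee_fin ltW. Qed.

Lemma dimH_le_legendre (alpha : R) : level_set nu alpha !=set0 ->
  (dimH (level_set nu alpha) <= Lq_legendre nu alpha)%E.
Proof. by move=> h; apply: le_ereal_inf_tmp => _ [q _ <-]; apply: dimH_level_le. Qed.

Lemma multifractal_nondegenerate (alpha : R) :
  (Lq_slope_pinfty nu <= alpha%:E <= Lq_right_deriv0 nu)%E ->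
  level_set nu alpha !=set0 /\ dimH (level_set nu alpha) = Lq_legendre nu alpha.
Proof.
move=> /andP[h1 h2].
have [s [s0 hs smax]] := realized_sup (realized_of_slope h1).
have [ne ge] := dimH_level_ge hs s0 (fun dl => realized_gap h2 hs smax).
split => //; apply/eqP; rewrite eq_le dimH_le_legendre //=.
exact: le_trans (legendre_le_sup hs smax s0) ge.
Qed.

(** * The attractor that is a single point *)

Lemma Lq_sum_singleton x0 (q r : R) : K = [set x0] -> 0 < r -> Lq_sum nu q r = 1%E.
Proof.
move=> Kx r0.
have m1 : mass (cball x0 r) = 1.
  apply: mass_contains; first exact: cball_closed.
  by rewrite Kx => _ ->; rewrite /cball /= subrr enorm0 ltW.
apply/eqP; rewrite eq_le; apply/andP; split.
  apply: ge_ereal_sup => _ [D [hD _] <-].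
  have : D `<=` [set x0] by rewrite -Kx; apply: subset_trans hD support_attractor.
  move=> /subset_set1[->|->]; first by rewrite esum_set0 lee01.
  by rewrite esum_set1 ?ball_powE ?m1 ?powR1 // lee_fin.
have sx : msupport nu x0.
  apply: positive_support => e e0; rewrite mass_contains //; first exact: cball_closed.
  by rewrite Kx => _ ->; rewrite /cball /= subrr enorm0 ltW.
have sep : separated_in (fun _ : unit => x0) r by split=> // -[] [].
have := Lq_sum_ge q (ltW r0) sep.
by rewrite (big_pred1 tt) ?m1 ?powR1 // => -[].
Qed.
Lemma spectrum_singleton x0 (q : R) : K = [set x0] -> Lq_spectrum nu q = 0%E.
Proof.
move=> Kx; apply/eqP; rewrite eq_le; apply/andP; split.
  apply: spectrum_le => L0; exists L0 => //.
  by rewrite (Lq_sum_singleton _ Kx) ?expR_gt0 // mulr0 oppr0 expR0.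
have key (t : R) : t < 0 -> ~ (Lq_spectrum nu q < t%:E)%E.
  move=> t0 ht; have [r r1] := spectrum_lt 1 ht.
  rewrite (Lq_sum_singleton _ Kx) ?expR_gt0 // lee_fin -[leRHS]expR0 ler_expR leNgt => /negP; apply.
  by rewrite oppr_gt0 pmulr_rlt0 //; lra.
case E : (Lq_spectrum nu q) => [t| |] //.
  rewrite lee_fin leNgt; apply/negP => t0; apply: (key (t / 2)); first by lra.
  by rewrite E lte_fin; lra.
by exfalso; apply: (key (-1)); rewrite ?E ?ltNyr //; lra.
Qed.

(** [nu] is a point mass and the spectrum vanishes identically. So [alpha = 0], the level set
    contains the point, and [q = 0] shows that the Legendre transform is at most 0. *)
Lemma multifractal_singleton x0 (alpha : R) : K = [set x0] ->
  (Lq_slope_pinfty nu <= alpha%:E <= Lq_right_deriv0 nu)%E ->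
  level_set nu alpha !=set0 /\ dimH (level_set nu alpha) = Lq_legendre nu alpha.
Proof.
move=> Kx.
have -> : Lq_slope_pinfty nu = 0%E.
  rewrite /Lq_slope_pinfty (_ : (fun q : R => _) = cst 0%E) ?lim_cst //.
  by apply/funext => q; rewrite (spectrum_singleton _ Kx) mul0e.
have -> : Lq_right_deriv0 nu = 0%E.
  rewrite /Lq_right_deriv0 (_ : (fun h : R => _) = cst 0%E) ?lim_cst //.
  by apply/funext => h; rewrite !(spectrum_singleton _ Kx) sube0 mul0e.
rewrite !lee_fin -eq_le => /eqP <-.
have ne : level_set nu 0 !=set0.
  exists x0; apply/level_setP => e e0; exists 0 => r r0.
  rewrite mass_contains; [|exact: cball_closed|]; last first.
    by rewrite Kx => _ ->; rewrite /cball /= subrr enorm0 expR_ge0.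
  rewrite -expR0 !ler_expR add0r sub0r mulrN opprK oppr_le0.
  by rewrite mulr_ge0 // ltW.
split => //; apply/eqP; rewrite eq_le dimH_le_legendre //=.
apply: le_trans (dimH_ge0 _); apply: ereal_inf_lbound; exists 0 => //.
by rewrite mul0r (spectrum_singleton _ Kx) sube0.
Qed.

End Attractor.

Theorem theorem1p3 (R : realType) (d l : nat) (X : set 'rV[R]_d)
    (S : 'I_l -> 'rV[R]_d -> 'rV[R]_d) (K : set 'rV[R]_d) (p : 'I_l -> R)
    (nu : probability (borelRV R d) R)
    (hS : C1_conformal_IFS X S) (hK : is_attractor X S K)
    (hp : probability_vector p) (hnu : self_conformal_measure X S p nu)
    (hAWSC : AWSC X S K) (alpha : R)
    (halpha : (Lq_slope_pinfty nu <= alpha%:E <= Lq_right_deriv0 nu)%E) :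
  level_set nu alpha !=set0 /\ dimH (level_set nu alpha) = Lq_legendre nu alpha.
Proof.
have [[x0 Kx0] _ _ _] := hK.
have [nondeg|single] := pselect (exists x y, [/\ K x, K y & x != y]).
  exact: (multifractal_nondegenerate hS hK nondeg hp hnu hAWSC halpha).
have Kx : K = [set x0].
  apply/seteqP; split=> [x Kx|_ ->] //=.
  by apply: contrapT => /eqP ne; apply: single; exists x, x0.
by apply: (multifractal_singleton hS hK hnu Kx halpha).
Qed.
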